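(* Let $G$ be a finite nonempty simple graph with no isolated vertices. Then the matching complex $M(G)$ is a two-dimensional Buchsbaum complex if and only if $G$ is (up to isomorphism) one of the following graphs: (a) a member of one of the families $\mathcal{B}_{C_7}$, $\mathcal{B}_P$, or $\mathcal{B}_i$ for some $i\in\{1,\dots,9\}$; (b) one of the two exceptional graphs $E_1$ and $E_2$; (c) a disconnected graph such that either (i) $G$ has exactly three connected components, each of which is either $K_3$ or a star graph, or (ii) $G$ has exactly two connected components, one of which is $K_3$ or a star graph and the other of which is either the bowtie graph $B$ or a graph in one of the families $\mathcal{G}_1,\mathcal{G}_2,\mathcal{G}_3$.
   Context: A matching in $G$ is a set of edges no two of which share an endpoint. $M(G)$ is the simplicial complex whose faces are all matchings of $G$ (its vertices are the edges of $G$). A two-dimensional simplicial complex $\Delta$ is Buchsbaum if for every vertex $v$ of $\Delta$, $\mathrm{link}_\Delta v=\{\tau\in\Delta: v\notin\tau,\ \tau\cup\{v\}\in\Delta\}$ is a connected graph (1-dimensional complex) with at least one edge. The star graph $S_n$ ($n\ge 1$) has $n+1$ vertices: one center joined to $n$ leaves. Subgraphs are not necessarily induced. Each family below is taken up to isomorphism and given by: vertices, required edges, optional edges (any subset of these may be included), and a set $U$ of vertices (''unfilled''; possibly empty). One may moreover add any finite number (possibly zero) of new vertices, each joined to some nonempty subset of $U$ (new vertices have no other neighbors). $\mathcal{G}_1$: vertices $1,\dots,5$; required $12,23,34,45$; optional $14,25$; $U=\{2,4\}$. $\mathcal{G}_2$: vertices $1,\dots,5$; required $12,23,13,34,45$;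 optional $14,24$; $U=\{4\}$. $\mathcal{G}_3$: vertices $1,\dots,5$; required $12,23,34,45,51$; optional $13,35,25,24,14$; $U=\emptyset$. Bowtie graph $B$: vertices $1,\dots,5$, edges $12,23,13,34,45,35$. $\mathcal{B}_1$: vertices $g_1,g_2,g_3,v_1,v_2,v_3$; required $g_1v_1,g_2v_2,g_3v_3$; no optional edges; $U=\{g_1,g_2,g_3\}$. $\mathcal{B}_2$: vertices $g_1,g_2,g_3,v_1,\dots,v_4$; required $g_1v_1,g_1v_3,g_2v_1,g_2v_2,g_2v_3,g_2v_4,g_3v_2,g_3v_4$; no optional edges; $U=\{g_1,g_2,g_3\}$. $\mathcal{B}_3$: vertices $g_1,g_2,g_3,v_1,\dots,v_4$; required $g_1v_2,v_2g_2,g_2v_3,v_3g_3,g_3v_4,v_4g_1,v_1g_1,v_1g_2,v_1g_3$; optional $g_1v_3,g_2v_4,g_3v_2$; $U=\{g_1,g_2,g_3\}$. $\mathcal{B}_4$: vertices $g_1,g_2,g_3,v_1,\dots,v_5$; required $g_1v_2,v_2g_2,g_2v_3,v_3g_3,g_3v_4,v_4g_1,g_1v_5,g_2v_1,g_3v_1$; optional $g_1v_3,g_2v_4,g_3v_2$; $U=\{g_1,g_2,g_3\}$. $\mathcal{B}_5$: vertices $g_1,g_2,g_3,v_1,\dots,v_5$; required $g_1v_1,g_1v_2,g_1v_3,g_2v_1,g_2v_3,g_2v_5,g_3v_3,g_3v_4,g_3v_5$; optional $g_2v_2,g_2v_4,g_1v_5,g_3v_1$; $U=\{g_1,g_2,g_3\}$.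 $\mathcal{B}_6$: vertices $g_1,g_2,g_3,v_1,\dots,v_5$; required $g_1v_1,g_1v_2,g_2v_2,g_2v_3,g_2v_5,g_3v_5,g_3v_4$; optional $g_3v_2,g_3v_3,g_2v_4$; $U=\{g_1,g_2,g_3\}$. $\mathcal{B}_7$: vertices $g,v_1,\dots,v_7$; required $v_1v_2,v_2v_3,v_1v_3,gv_1,gv_4,v_4v_5,v_5v_6,v_4v_6,gv_7$; optional $gv_2,gv_3,gv_5,gv_6$; $U=\{g\}$. $\mathcal{B}_8$: vertices $g_1,g_2,v_1,\dots,v_6$; required $v_1v_2,v_2v_3,v_1v_3,g_1v_1,g_1v_4,g_1v_5,g_2v_4,g_2v_6$; optional $g_1v_2,g_1v_3,g_2v_5,g_1v_6$; $U=\{g_1,g_2\}$. $\mathcal{B}_9$: vertices $g_1,g_2,v_1,\dots,v_6$; required $v_1v_2,v_2v_3,v_1v_3,g_1v_1,g_2v_1,g_1v_6,g_2v_6,g_1v_4,g_2v_5$; optional $g_2v_4,g_1v_5$; $U=\{g_1,g_2\}$. $E_1$: two copies of $K_4$ sharing exactly one vertex (7 vertices, 12 edges). $E_2$: a $K_4$ and a 4-cycle $C_4$ sharing exactly one vertex (7 vertices, 10 edges). $\mathcal{B}_{C_7}$: the family of all graphs $G$ (without isolated vertices) containing the 7-cycle $C_7$ as a subgraph such that $M(G)$ is a two-dimensional Buchsbaum complex. $\mathcal{B}_P$ (petal graphs): graphs formed from three graphs, each either $K_3$ or a star graph with at least two edges, by gluing them together at a single vertex; for each star the gluing vertex must be a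 non-central vertex (leaf; for $S_2$ the center is the vertex of degree 2). *)

(* Defs.v *)
From mathcomp Require Export all_boot.

Set Implicit Arguments.
Unset Strict Implicit.
Unset Printing Implicit Defensive.

(** * Finite simple graphs *)

Record sgraph := SGraph {
  vertex :> finType;
  adj : rel vertex;
  adj_sym : symmetric adj;
  adj_irr : irreflexive adj
}.
Arguments adj {s}.

(* The simple graph generated by a relation: its symmetric closure, with the
   loops removed. *)
Section GraphOfRel.
Variables (T : finType) (r : rel T).

Definition adj_of_rel : rel T := [rel x y | (x != y) && (r x y || r y x)].

Fact adj_of_rel_sym : symmetric adj_of_rel.
Proof. by move=> x y; rewrite /adj_of_rel /= eq_sym orbC. Qed.

Fact adj_of_rel_irr : irreflexive adj_of_rel.
Proof. by move=> x; rewrite /adj_of_rel /= eqxx. Qed.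

Definition graph_of_rel : sgraph := SGraph adj_of_rel_sym adj_of_rel_irr.
End GraphOfRel.

Definition no_isolated (G : sgraph) : Prop := forall x : G, exists y : G, adj x y.

Definition isomorphic (G H : sgraph) : Prop :=
  exists2 f : G -> H, bijective f & forall x y : G, adj (f x) (f y) = adj x y.

Definition contains_subgraph (G H : sgraph) : Prop :=
  exists2 f : H -> G, injective f & forall x y : H, adj x y -> adj (f x) (f y).

Definition induced (G : sgraph) (A : {set G}) : sgraph :=
  graph_of_rel [rel x y : {x : G | x \in A} | adj (val x) (val y)].

Definition component (G : sgraph) (x : G) : sgraph :=
  induced [set y | connect adj x y].

Definition num_components (G : sgraph) : nat := n_comp (@adj G) G.

Definition disconnected (G : sgraph) : Prop :=
  exists x y : G, ~~ connect adj x y.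

Definition complete_graph (n : nat) : sgraph :=
  graph_of_rel (fun _ _ : 'I_n => true).

Definition cycle_graph (n : nat) : sgraph :=
  graph_of_rel (fun i j : 'I_n => j == ordS i).

(* [star_graph n] has n leaves; its center is [ord0]. *)
Definition star_graph (n : nat) : sgraph :=
  graph_of_rel (fun i _ : 'I_n.+1 => i == ord0).

(* The disjoint union of G and H in which y is identified with x. *)
Definition glue (G : sgraph) (x : G) (H : sgraph) (y : H) : sgraph :=
  graph_of_rel (fun a b : G + {z : H | z != y} =>
    match a, b with
    | inl u, inl v => adj u v
    | inr u, inr v => adj (val u) (val v)
    | inl u, inr v => (u == x) && adj y (val v)
    | inr _, inl _ => false
    end).

(** * Simplicial complexes, given by their set of faces *)

Section Complex.
Variables (V : finType).
Implicit Type D : {set {set V}}.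

Definition has_dim D (d : nat) : Prop := \max_(F in D) #|F| = d.+1.

Definition link D (v : V) : {set {set V}} :=
  [set F in D | (v \notin F) && (v |: F \in D)].

Definition skeleton_adj D : rel V := [rel x y | (x != y) && ([set x; y] \in D)].

Definition connected_complex D : Prop :=
  forall x y : V, [set x] \in D -> [set y] \in D -> connect (skeleton_adj D) x y.

Definition buchsbaum2 D : Prop :=
  has_dim D 2 /\
  forall v : V, [set v] \in D -> has_dim (link D v) 1 /\ connected_complex (link D v).
End Complex.

Definition edges (G : sgraph) : {set {set G}} :=
  [set [set p.1; p.2] | p : G * G & adj p.1 p.2].

Definition matching_complex (G : sgraph) : {set {set {set G}}} :=
  [set M : {set {set G}} | (M \subset edges G) && trivIset M].

(** * Families of graphs *)

(* Vertices are coded by 0, ..., fam_size - 1, and an edge by a pair of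
   codes, in either order. *)
Record family := Family {
  fam_size : nat;
  required : seq (nat * nat);
  optional : seq (nat * nat);
  unfilled : seq nat
}.

(* The member of F with optional edges O and with k new vertices, the i-th of
   which has neighborhood N i. *)
Definition member (F : family) (O : seq (nat * nat)) (k : nat)
    (N : 'I_k -> {set 'I_(fam_size F)}) : sgraph :=
  graph_of_rel (fun a b : 'I_(fam_size F) + 'I_k =>
    match a, b with
    | inl u, inl v => (val u, val v) \in required F ++ O
    | inl u, inr i => u \in N i
    | inr _, _ => false
    end).

Definition in_family (F : family) (G : sgraph) : Prop :=
  exists (O : seq (nat * nat)) (k : nat) (N : 'I_k -> {set 'I_(fam_size F)}),
    [/\ {subset O <= optional F},
        forall i : 'I_k, N i != set0,
        forall (i : 'I_k) (u : 'I_(fam_size F)), u \in N i -> val u \in unfilled F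
      & isomorphic G (member O N)].

Definition G1 : family := let v i := i.-1 in
  Family 5
    [:: (v 1, v 2); (v 2, v 3); (v 3, v 4); (v 4, v 5)]
    [:: (v 1, v 4); (v 2, v 5)]
    [:: v 2; v 4].

Definition G2 : family := let v i := i.-1 in
  Family 5
    [:: (v 1, v 2); (v 2, v 3); (v 1, v 3); (v 3, v 4); (v 4, v 5)]
    [:: (v 1, v 4); (v 2, v 4)]
    [:: v 4].

Definition G3 : family := let v i := i.-1 in
  Family 5
    [:: (v 1, v 2); (v 2, v 3); (v 3, v 4); (v 4, v 5); (v 5, v 1)]
    [:: (v 1, v 3); (v 3, v 5); (v 2, v 5); (v 2, v 4); (v 1, v 4)]
    [::].

Definition bowtie : sgraph :=
  let v i := i.-1 in
  graph_of_rel (fun a b : 'I_5 => (val a, val b) \in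
    [:: (v 1, v 2); (v 2, v 3); (v 1, v 3); (v 3, v 4); (v 4, v 5); (v 3, v 5)]).

Definition B1 : family := let g i := i.-1 in let v i := i + 2 in
  Family 6
    [:: (g 1, v 1); (g 2, v 2); (g 3, v 3)]
    [::]
    [:: g 1; g 2; g 3].

Definition B2 : family := let g i := i.-1 in let v i := i + 2 in
  Family 7
    [:: (g 1, v 1); (g 1, v 3); (g 2, v 1); (g 2, v 2); (g 2, v 3);
        (g 2, v 4); (g 3, v 2); (g 3, v 4)]
    [::]
    [:: g 1; g 2; g 3].

Definition B3 : family := let g i := i.-1 in let v i := i + 2 in
  Family 7
    [:: (g 1, v 2); (v 2, g 2); (g 2, v 3); (v 3, g 3); (g 3, v 4);
        (v 4, g 1); (v 1, g 1); (v 1, g 2); (v 1, g 3)]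
    [:: (g 1, v 3); (g 2, v 4); (g 3, v 2)]
    [:: g 1; g 2; g 3].

Definition B4 : family := let g i := i.-1 in let v i := i + 2 in
  Family 8
    [:: (g 1, v 2); (v 2, g 2); (g 2, v 3); (v 3, g 3); (g 3, v 4);
        (v 4, g 1); (g 1, v 5); (g 2, v 1); (g 3, v 1)]
    [:: (g 1, v 3); (g 2, v 4); (g 3, v 2)]
    [:: g 1; g 2; g 3].

Definition B5 : family := let g i := i.-1 in let v i := i + 2 in
  Family 8
    [:: (g 1, v 1); (g 1, v 2); (g 1, v 3); (g 2, v 1); (g 2, v 3);
        (g 2, v 5); (g 3, v 3); (g 3, v 4); (g 3, v 5)]
    [:: (g 2, v 2); (g 2, v 4); (g 1, v 5); (g 3, v 1)]
    [:: g 1; g 2; g 3].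

Definition B6 : family := let g i := i.-1 in let v i := i + 2 in
  Family 8
    [:: (g 1, v 1); (g 1, v 2); (g 2, v 2); (g 2, v 3); (g 2, v 5);
        (g 3, v 5); (g 3, v 4)]
    [:: (g 3, v 2); (g 3, v 3); (g 2, v 4)]
    [:: g 1; g 2; g 3].

Definition B7 : family := let g := 0 in let v i := i in
  Family 8
    [:: (v 1, v 2); (v 2, v 3); (v 1, v 3); (g, v 1); (g, v 4);
        (v 4, v 5); (v 5, v 6); (v 4, v 6); (g, v 7)]
    [:: (g, v 2); (g, v 3); (g, v 5); (g, v 6)]
    [:: g].

Definition B8 : family := let g i := i.-1 in let v i := i + 1 in
  Family 8
    [:: (v 1, v 2); (v 2, v 3); (v 1, v 3); (g 1, v 1); (g 1, v 4);
        (g 1, v 5); (g 2, v 4); (g 2, v 6)]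
    [:: (g 1, v 2); (g 1, v 3); (g 2, v 5); (g 1, v 6)]
    [:: g 1; g 2].

Definition B9 : family := let g i := i.-1 in let v i := i + 1 in
  Family 8
    [:: (v 1, v 2); (v 2, v 3); (v 1, v 3); (g 1, v 1); (g 2, v 1);
        (g 1, v 6); (g 2, v 6); (g 1, v 4); (g 2, v 5)]
    [:: (g 2, v 4); (g 1, v 5)]
    [:: g 1; g 2].

Definition in_some_B (G : sgraph) : Prop :=
  exists2 i, 1 <= i <= 9 &
    in_family (nth B1 [:: B1; B2; B3; B4; B5; B6; B7; B8; B9] i.-1) G.

(* The choice of the gluing vertices is immaterial, since complete graphs and
   cycles are vertex-transitive. *)
Definition E1 : sgraph :=
  glue (ord0 : complete_graph 4) (ord0 : complete_graph 4).

Definition E2 : sgraph :=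
  glue (ord0 : complete_graph 4) (ord0 : cycle_graph 4).

Definition in_B_C7 (G : sgraph) : Prop :=
  [/\ no_isolated G, contains_subgraph G (cycle_graph 7)
    & buchsbaum2 (matching_complex G)].

Inductive petal : forall H : sgraph, H -> Prop :=
| petal_K3 (x : complete_graph 3) : petal x
| petal_star (n : nat) (x : star_graph n) : 2 <= n -> x != ord0 -> petal x.

Definition in_B_P (G : sgraph) : Prop :=
  exists (H1 H2 H3 : sgraph) (x1 : H1) (x2 : H2) (x3 : H3),
    [/\ petal x1, petal x2, petal x3
      & isomorphic G (glue (inl x1 : glue x1 x2) x3)].

Definition K3_or_star (G : sgraph) : Prop :=
  isomorphic G (complete_graph 3) \/
  exists2 n, 1 <= n & isomorphic G (star_graph n).

Definition bowtie_or_G123 (G : sgraph) : Prop :=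
  isomorphic G bowtie \/ [\/ in_family G1 G, in_family G2 G | in_family G3 G].

(* Main.v *)
From Stdlib Require List.
From mathcomp Require Import all_boot.
Require Import Defs.

Set Implicit Arguments.
Unset Strict Implicit.
Unset Printing Implicit Defensive.

(** In the link of an edge [e] in the matching complex, the vertices are the edges of [G] disjoint
    from [e], and two of them are joined when they are disjoint. Being two-dimensional Buchsbaum
    thus comes down to elementary conditions on [G] ([good_buchsbaum2], [buchsbaum2_good]): there is
    a matching of size three and none of size four, every two disjoint edges extend to a matching of
    size three, and, given an edge [ab] and a 4-cycle avoiding it, some edge avoiding [a] and [b]
    has an end off the cycle. The last condition is what connectivity adds: two edges of the link at
    distance more than three come with neighbours that form a 4-cycle with them, and without the
    extra edge the two perfect matchings of that cycle are separate parts of the link.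

    From left to right, the theorem is a finite case analysis on graphs of unbounded size. Outside
    three disjoint edges the vertices are pairwise nonadjacent, since there is no matching of size
    four; so [G] is known once the edges among a few named vertices and the possible neighbourhoods
    of the others are known. [solve] starts from a small subgraph. While the known edges violate a
    condition, it branches over the edges that could repair it; once they violate none, it places
    the core of a template in what is known and branches over the edges that the template does not
    allow. A graph with a 7-cycle is in the family of [C7]. The other graphs are searched from the
    subgraphs in [starts], each under the assumption that the earlier ones do not occur; the last
    one is the matching of size three itself. [solve_sound] shows that a successful search
    classifies every graph, and [solve_all_starts] is the search.

    From right to left, the vertices outside the core of a template are adjacent to unfilled core
    vertices only, so a single code can stand for all of them. The conditions then become a finite
    check for each template ([template_ok], [piece_good]).

    It remains to identify templates with the graphs of the theorem. [piece] says that [G], or the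
    part of it on a vertex set, belongs to a template. Disconnected graphs, petal graphs and the two
    exceptional graphs are templates put together from blocks by [assemble]. [assemble_piece] and
    [piece_assemble] turn membership in such a template into a decomposition of [G], which is read
    as the list of components ([components_assemble]) or as a gluing at one vertex
    ([assemble_rooted], [rooted_assemble]). *)

(** * The search procedure on partially known graphs *)

Notation code := (nat * nat)%type.

(** [apart] lists the pairs of core vertices that may have no common neighbour outside the core. It
    serves families put together from blocks, where an attached vertex must not join two blocks. *)
Record template := Template {
  template_family :> family;
  apart : seq code
}.

(* Unlike [andb] and [orb], these two do not evaluate their second argument
   when the first one decides: [vm_compute] is call-by-value. *)
Notation "a &? b" := (if a then b else false) (at level 40, left associativity).
Notation "a |? b" := (if a then true else b) (at level 50, left associativity).

Fixpoint some_in (A : Type) (a : pred A) l :=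
  if l is x :: l' then a x |? some_in a l' else false.

Fixpoint every_in (A : Type) (a : pred A) l :=
  if l is x :: l' then a x &? every_in a l' else true.

Definition pmem (l : seq code) i j :=
  some_in (fun q => (eqn q.1 i &? eqn q.2 j) |? (eqn q.1 j &? eqn q.2 i)) l.

(** The questions on which the search branches: are two named vertices adjacent, and does some
    unnamed vertex see both of them. With equal arguments, the second asks for an unnamed neighbour
    of a single vertex. *)
Inductive item := Pair of nat & nat | Outer of nat & nat.

(** The codes below [named] are names of vertices of [G], and those below [base] belong to the
    starting subgraph. [yes] and [no] hold the known edges and non-edges, [far] the pairs without a
    common unnamed neighbour. *)
Record state := State {
  named : nat;
  base : nat;
  yes : seq code;
  no : seq code;
  far : seq code
}.

Definition in_range s it :=
  match it with Pair i j | Outer i j => (i < named s) && (j < named s) end.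

Definition known s it :=
  if it is Pair i j then pmem (yes s) i j else false.

(** A vertex named during the search was one of the pairwise nonadjacent unnamed vertices, so it has
    no unnamed neighbour; hence the comparisons with [base]. *)
Definition refuted s it :=
  match it with
  | Pair i j => (i == j) |? pmem (no s) i j
  | Outer i j => (base s <= i) |? (base s <= j) |? pmem (far s) i j
  end.

(** The vertex that answers an [Outer] question receives the next code. As it was unnamed so far and
    sees [i] and [j], the entries of [far] become non-edges at it. *)
Definition assume s it :=
  match it with
  | Pair i j => State (named s) (base s) ((i, j) :: yes s) (no s) (far s)
  | Outer i j => let n := named s in
      State n.+1 (base s)
        ((i, n) :: (if i == j then yes s else (j, n) :: yes s))
        ([seq (k, n) | k <- iota 0 (base s)
            & pmem (far s) k k || pmem (far s) i k || pmem (far s) j k] ++ no s)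
        (far s)
  end.

Definition refuse s it :=
  match it with
  | Pair i j => State (named s) (base s) (yes s) ((i, j) :: no s) (far s)
  | Outer i j => State (named s) (base s) (yes s) (no s) ((i, j) :: far s)
  end.

Definition apart_codes (p q : code) :=
  ~~ (eqn p.1 q.1 |? eqn p.1 q.2 |? eqn p.2 q.1 |? eqn p.2 q.2).

Fixpoint has_matching k (l : seq code) :=
  if k is k'.+1 then
    (fix loop l := if l is p :: l' then
       has_matching k' (filter (apart_codes p) l') |? loop l' else false) l
  else true.

(* Each order lists all the vertices and starts with an edge. *)
Record pattern := Pattern {
  psize : nat;
  pedges : seq code;
  orders : seq (seq nat)
}.

Section Place.
Variables (A : Type) (cand : seq nat) (ok : seq code -> nat -> nat -> bool).
Variable stop : seq code -> option A.

(** Backtracking over the possible images of the vertices in [order]. The test [ok] only prunes;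
    [stop] judges the complete assignment, and correctness rests on it alone. *)
Fixpoint place (order : seq nat) (m : seq code) : option A :=
  if order is a :: order' then
    (fix loop xs := if xs is x :: xs' then
       if ok m a x then
         if place order' ((a, x) :: m) is Some r then Some r else loop xs'
       else loop xs'
     else None) cand
  else stop m.
End Place.

(** Vertices with a neighbour among those already placed come first, so that a wrong placement is
    detected early. *)
Fixpoint greedy k (req : seq code) (placed rest : seq nat) : seq nat :=
  if k is k'.+1 then
    if [seq a <- rest | some_in (pmem req a) placed] is a :: _
    then a :: greedy k' req (a :: placed) (rem a rest)
    else if rest is a :: rest' then a :: greedy k' req (a :: placed) rest'
    else [::]
  else [::].

Definition search_order n req := greedy n req [::] (iota 0 n).

Definition images n (m : seq code) : seq nat :=
  [seq (head (0, 0) [seq q <- m | q.1 == i]).2 | i <- iota 0 n].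

Definition allowed_place (req : seq code) s m a x :=
  every_in (fun q => if eqn q.2 x then false else
    if pmem req a q.1 then pmem (yes s) x q.2 else true) m.

Definition graph_image n (es : seq code) s (im : seq nat) :=
  (size im == n) &? uniq im &? all (gtn (named s)) im &?
  every_in (fun q => pmem (yes s) (nth 0 im q.1) (nth 0 im q.2)) es.

Definition has_pattern (p : pattern) s (e : code) :=
  some_in (fun o =>
    place (iota 0 (named s)) (allowed_place (pedges p) s)
      (fun m => if graph_image (psize p) (pedges p) s (images (psize p) m)
                then Some tt else None)
      (drop 2 o) [:: (nth 0 o 0, e.1); (nth 0 o 1, e.2)]) (orders p).

(** [k] counts the edges just added, which are at the front of [yes s]. A copy of a forbidden
    pattern that was not there before must use one of them, so only copies through these edges are
    sought. *)
Definition killed (forb : seq pattern) s k :=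
  has_matching 4 (yes s) |?
  some_in (fun e => some_in (fun p => has_pattern p s e) forb) (take k (yes s)).

Definition outside (l : seq nat) := fun i => i \notin l.

(** The forms that an edge avoiding the ends of [p] and [q] can take: unnamed vertices are pairwise
    nonadjacent, so one of its ends is named. *)
Definition ext_items s (p q : code) : seq item :=
  let r := [seq i <- iota 0 (named s) | outside [:: p.1; p.2; q.1; q.2] i] in
  [seq Pair i j | i <- r, j <- r] ++ [seq Outer i i | i <- r].

(** The forms that an edge avoiding [e], with an end off the 4-cycle on [p] and [q], can take. An
    unnamed end is off the cycle by itself; if both ends are named, one is in [o]. *)
Definition c4_items s (e p q : code) : seq item :=
  let r := [seq i <- iota 0 (named s) | outside [:: e.1; e.2] i] in
  let o := [seq i <- r | outside [:: p.1; p.2; q.1; q.2] i] in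
  [seq Pair i j | i <- o, j <- r] ++ [seq Outer i i | i <- r].

Definition cycle4 s (p q : code) :=
  (pmem (yes s) p.1 q.1 &? pmem (yes s) p.2 q.2) |?
  (pmem (yes s) p.1 q.2 &? pmem (yes s) p.2 q.1).

Definition inside (p q e : code) :=
  let l := [:: p.1; p.2; q.1; q.2] in (e.1 \in l) && (e.2 \in l).

Fixpoint find_some (A B : Type) (f : A -> option B) l :=
  if l is x :: l' then if f x is Some r then Some r else find_some f l' else None.

(** [None] means that the known edges meet the conditions of [good] for this pair of disjoint edges.
    Otherwise the answer lists what could still repair the failure, and an empty list is a
    contradiction. *)
Definition violated2 s (p q : code) : option (seq item) :=
  let third := [seq e <- yes s | apart_codes p e &? apart_codes q e] in
  if third is [::] then Some [seq it <- ext_items s p q | ~~ refuted s it]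
  else if cycle4 s p q then
    find_some (fun e =>
      if some_in (fun d => apart_codes e d &? ~~ inside p q d) (yes s) then None
      else Some [seq it <- c4_items s e p q | ~~ refuted s it]) third
  else None.

Fixpoint violated s l : option (seq item) :=
  if l is p :: l' then
    if find_some (fun q => if apart_codes p q then violated2 s p q else None) l'
      is Some r then Some r else violated s l'
  else None.

Definition listed (T : template) i j := pmem (required T) i j |? pmem (optional T) i j.

Definition degree (l : seq code) i :=
  count (fun q => eqn q.1 i |? eqn q.2 i) l.

Definition place_ok (T : template) s m a x :=
  every_in (fun q => if eqn q.2 x then false else
    if pmem (yes s) x q.2 then listed T a q.1 else ~~ pmem (required T) a q.1) m
  &? ((a \in unfilled T) |? (degree (yes s) x <= degree (required T) a + degree (optional T) a)).

(** A demand is a list of facts that must not all hold if [G] is to be the member of [T] whose core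
    is [im]. *)
Definition demands (T : template) s (im : seq nat) : seq (seq item) :=
  let n := fam_size T in
  let rest := [seq x <- iota 0 (named s) | x \notin im] in
  let core := [seq i <- iota 0 n | i \notin unfilled T] in
  let c := nth 0 im in
  [seq [:: Pair (c p.1) (c p.2)] |
    p <- [seq (i, j) | i <- iota 0 n, j <- iota 0 n] & (p.1 < p.2) &? ~~ listed T p.1 p.2] ++
  [seq [:: Pair (c i) x] | i <- core, x <- rest] ++
  [seq [:: Pair x y] | x <- rest, y <- rest] ++
  [seq [:: Outer (c i) (c i)] | i <- core] ++
  [seq [:: Outer x x] | x <- rest] ++
  [seq [:: Outer (c p.1) (c p.2)] | p <- apart T] ++
  [seq [:: Pair (c p.1) x; Pair (c p.2) x] | p <- apart T, x <- rest].

(** [None] when a demand is already broken; otherwise one open fact from each demand that is not yet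
    secured by a refuted one. An empty list therefore means that the template fits. *)
Definition pending s (ds : seq (seq item)) : option (seq item) :=
  if every_in (fun d => ~~ every_in (known s) d) ds then
    Some (flatten [seq take 1 [seq it <- d | ~~ known s it] |
                     d <- ds & ~~ some_in (refuted s) d])
  else None.

Definition core_image (T : template) s (im : seq nat) :=
  graph_image (fam_size T) (required T) s im.

Definition fit (T : template) s : option (seq item) :=
  place (iota 0 (named s)) (place_ok T s)
    (fun m => let im := images (fam_size T) m in
       if core_image T s im then pending s (demands T s im) else None)
    (search_order (fam_size T) (required T)) [::].

(** Each item is first assumed, which opens a new search, and then refused for the rest of the list.
    After the last one the search resumes with all of them refused: a violation is then beyond
    repair, and the listed obstacles to a template are gone. *)
Fixpoint solve fuel forb ts s : bool :=
  if fuel is fuel'.+1 then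
    let branch := fix branch l s :=
      if l is it :: l' then
        if refuted s it then branch l' s else in_range s it &?
        (let s' := assume s it in killed forb s' (size (yes s') - size (yes s)) |? solve fuel' forb ts s')
        &? branch l' (refuse s it)
      else solve fuel' forb ts s in
    match violated s (yes s) with
    | Some [::] => true
    | Some l => branch l s
    | None =>
      match find_some (fun T => fit T s) ts with
      | Some [::] => true
      | Some l => branch l s
      | None => false
      end
    end
  else false.

Definition start (p : pattern) := State (psize p) (psize p) (pedges p) [::] [::].

Definition plain F := Template F [::].
(** A block is a family with the codes that its core vertices take in the whole; blocks may share
    codes. The pairs kept apart are those of unfilled codes that are not unfilled in a common
    block. *)
Definition assemble n (bs : seq (seq nat * family)) : template :=
  let ren b := map (fun p : code => (nth 0 b p.1, nth 0 b p.2)) in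
  let unf b := [seq nth 0 b.1 i | i <- unfilled b.2] in
  let us := flatten (map unf bs) in
  Template
   (Family n (flatten [seq ren b.1 (required b.2) | b <- bs])
     (flatten [seq ren b.1 (optional b.2) | b <- bs])
     us)
   [seq p <- [seq (i, j) | i <- us, j <- us]
      | (p.1 < p.2) && ~~ has (fun b => (p.1 \in unf b) && (p.2 \in unf b)) bs].

Definition tri : family := Family 3 [:: (0,1); (1,2); (0,2)] [::] [::].
(** The center is the unfilled vertex, so that further leaves are added vertices. In [ray] the
    center is 1, and 0 is the leaf at which petals are glued; a second leaf is required. *)
Definition star : family := Family 2 [:: (0,1)] [::] [:: 0].
Definition ray : family := Family 3 [:: (0,1); (1,2)] [::] [:: 1].
Definition bow : family := Family 5 [:: (0,1); (1,2); (0,2); (2,3); (3,4); (2,4)] [::] [::].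
Definition kfour : family := Family 4 [:: (0,1); (0,2); (0,3); (1,2); (1,3); (2,3)] [::] [::].
Definition cfour : family := Family 4 [:: (0,1); (1,2); (2,3); (3,0)] [::] [::].

Definition K3_plus F := assemble 8 [:: (iota 0 3, tri); (iota 3 5, F)].
Definition star_plus F := assemble 7 [:: (iota 0 2, star); (iota 2 5, F)].
Definition disjoint3 (b1 b2 b3 : family) :=
  let n1 := fam_size b1 in let n2 := fam_size b2 in let n3 := fam_size b3 in
  assemble (n1 + n2 + n3) [:: (iota 0 n1, b1); (iota n1 n2, b2); (iota (n1 + n2) n3, b3)].
Definition petals b1 b2 b3 :=
  assemble 7 [:: ([:: 0; 1; 2], b1); ([:: 0; 3; 4], b2); ([:: 0; 5; 6], b3)].
Definition E1_template := assemble 7 [:: (iota 0 4, kfour); ([:: 0; 4; 5; 6], kfour)].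
Definition E2_template := assemble 7 [:: (iota 0 4, kfour); ([:: 0; 4; 5; 6], cfour)].

(** In this and the next patterns with several orders, there is one order for each class of oriented
    edges under the automorphisms of the pattern, so that a new edge is tried in every role. *)
Definition C7 := Pattern 7
  [:: (0,1); (1,2); (2,3); (3,4); (4,5); (5,6); (6,0)] [:: iota 0 7].
Definition C5K2 := Pattern 7
  [:: (0,1); (1,2); (2,3); (3,4); (4,0); (5,6)]
  [:: iota 0 7; [:: 5; 6; 0; 1; 2; 3; 4]].
Definition K3K3K2 := Pattern 8
  [:: (0,1); (1,2); (0,2); (3,4); (4,5); (3,5); (6,7)]
  [:: iota 0 8; [:: 6; 7; 0; 1; 2; 3; 4; 5]].
Definition K3P4 := Pattern 7
  [:: (0,1); (1,2); (0,2); (3,4); (4,5); (5,6)]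
  [:: iota 0 7; [:: 3; 4; 5; 6; 0; 1; 2]; [:: 4; 3; 5; 6; 0; 1; 2];
      [:: 4; 5; 3; 6; 0; 1; 2]].
Definition K3K2K2 := Pattern 7
  [:: (0,1); (1,2); (0,2); (3,4); (5,6)]
  [:: iota 0 7; [:: 3; 4; 0; 1; 2; 5; 6]].
Definition C6 := Pattern 6
  [:: (0,1); (1,2); (2,3); (3,4); (4,5); (5,0)] [:: iota 0 6].
Definition P7 := Pattern 7
  [:: (0,1); (1,2); (2,3); (3,4); (4,5); (5,6)]
  [:: iota 0 7; [:: 1; 0; 2; 3; 4; 5; 6]; [:: 1; 2; 0; 3; 4; 5; 6];
      [:: 2; 1; 0; 3; 4; 5; 6]; [:: 2; 3; 1; 0; 4; 5; 6]; [:: 3; 2; 4; 1; 0; 5; 6]].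
Definition P6 := Pattern 6
  [:: (0,1); (1,2); (2,3); (3,4); (4,5)]
  [:: iota 0 6; [:: 1; 0; 2; 3; 4; 5]; [:: 1; 2; 0; 3; 4; 5];
      [:: 2; 1; 0; 3; 4; 5]; [:: 2; 3; 1; 0; 4; 5]].
Definition K2K2K2 := Pattern 6 [:: (0,1); (2,3); (4,5)] [:: iota 0 6].

(** * The conditions on the graph, and basic facts *)

(** The bound on the dimension, then for links: no isolated vertex, and connectedness. In [good_c4]
    the cycle is [c], [d], [f], [e]; without the edge [xy], the edges [cd] and [ef] would be cut off
    from [ce] and [df] in the link of [ab]. *)
Record good (G : sgraph) : Prop := Good {
  good_max : forall a b c d e f g h : G, uniq [:: a; b; c; d; e; f; g; h] ->
    adj a b -> adj c d -> adj e f -> adj g h -> False;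
  good_ext : forall a b c d : G, uniq [:: a; b; c; d] -> adj a b -> adj c d ->
    exists x y, [/\ adj x y, x \notin [:: a; b; c; d] & y \notin [:: a; b; c; d]];
  good_c4 : forall a b c d e f : G, uniq [:: a; b; c; d; e; f] ->
    adj a b -> adj c d -> adj e f -> adj c e -> adj d f ->
    exists x y, [/\ adj x y, x \notin [:: a; b; c; d; e; f] & y \notin [:: a; b]]
}.

Definition contains (p : pattern) (G : sgraph) : bool :=
  [exists f : {ffun 'I_(psize p) -> G}, injectiveb f &&
    [forall i, forall j, ((val i, val j) \in pedges p) ==> adj (f i) (f j)]].

Lemma adjC (G : sgraph) (x y : G) : adj x y = adj y x.
Proof. exact: adj_sym. Qed.

Lemma adjxx (G : sgraph) (x : G) : adj x x = false.
Proof. exact: adj_irr. Qed.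

Lemma adj_neq (G : sgraph) (x y : G) : adj x y -> x != y.
Proof. by apply: contraTneq => ->; rewrite adjxx. Qed.

Lemma some_inE (A : eqType) (a : pred A) l : some_in a l = has a l.
Proof. by elim: l => //= x l ->. Qed.

Lemma every_inE (A : eqType) (a : pred A) l : every_in a l = all a l.
Proof. by elim: l => //= x l ->. Qed.

Lemma pmemE l i j : pmem l i j = ((i, j) \in l) || ((j, i) \in l).
Proof.
rewrite /pmem some_inE; elim: l => //= -[a b] l ->; rewrite !inE !xpair_eqE !eqnE.
rewrite (eq_sym i a) (eq_sym j b) (eq_sym j a) (eq_sym i b).
by case: (a == i) (b == j) (a == j) (b == i) ((i, j) \in l) => -[] [] [] [].
Qed.

Lemma In_map (A : eqType) (B : Type) (f : A -> B) x (l : seq A) :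
  x \in l -> List.In (f x) (map f l).
Proof. by elim: l => //= y l IH; rewrite inE => /orP[/eqP->|/IH]; auto. Qed.

Lemma In_allpairs (A1 A2 : eqType) (B : Type) (f : A1 -> A2 -> B) x y l1 l2 :
  x \in l1 -> y \in l2 -> List.In (f x y) [seq f x y | x <- l1, y <- l2].
Proof.
move=> Hx Hy; elim: l1 Hx => //= a l1 IH; rewrite inE => /orP[/eqP<-|/IH H];
  apply/List.in_app_iff; [left|by right].
exact: (In_map (f x)).
Qed.

(** * States realized in a graph *)

Section Holds.
Variables (G : sgraph) (s : state).
Implicit Type v : nat -> G.

Definition unnamed v (x : G) := x \notin [seq v i | i <- iota 0 (named s)].

(** [holds_indep] comes from three disjoint edges in the starting subgraph: an edge between unnamed
    vertices would extend them to a matching of size four. [holds_new] is its consequence for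
    vertices named later. *)
Record holds v : Prop := Holds {
  holds_inj : forall i j, i < named s -> j < named s -> v i = v j -> i = j;
  holds_yes : forall i j, (i, j) \in yes s ->
    [/\ i < named s, j < named s & adj (v i) (v j)];
  holds_no : forall i j, (i, j) \in no s ->
    [/\ i < named s, j < named s & ~~ adj (v i) (v j)];
  holds_far : forall i j, (i, j) \in far s ->
    [/\ i < named s, j < named s
      & forall x, unnamed v x -> adj x (v i) -> adj x (v j) -> False];
  holds_base : base s <= named s;
  holds_new : forall i x, base s <= i -> i < named s -> unnamed v x -> ~~ adj x (v i);
  holds_indep : forall x y, unnamed v x -> unnamed v y -> ~~ adj x y
}.

Definition holds_item v it : bool :=
  match it with
  | Pair i j => adj (v i) (v j)
  | Outer i j => [exists x, [&& unnamed v x, adj x (v i) & adj x (v j)]]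
  end.

Lemma unnamedP v x :
  reflect (exists2 i, i < named s & x = v i) (~~ unnamed v x).
Proof.
rewrite /unnamed negbK; apply: (iffP mapP) => -[i]; rewrite ?mem_iota => Hi ->;
  by exists i; rewrite ?mem_iota.
Qed.

Lemma pmem_yes v i j : holds v -> pmem (yes s) i j ->
  [/\ i < named s, j < named s & adj (v i) (v j)].
Proof.
by move=> H; rewrite pmemE => /orP[] /(holds_yes H) [] // ? ?; rewrite adjC.
Qed.

Lemma refuted_false v it : holds v -> in_range s it -> refuted s it -> ~~ holds_item v it.
Proof.
move=> H; case: it => i j /= /andP[Hi Hj].
  case: eqP => [-> _|_]; first by rewrite adjxx.
  by rewrite pmemE => /orP[] /(holds_no H)[] // _ _; rewrite adjC.
case: leqP => [bi _|_].
  apply/existsPn => x; apply/negP => /and3P[ux ai _].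
  by move: (holds_new H bi Hi ux); rewrite ai.
case: leqP => [bj _|_].
  apply/existsPn => x; apply/negP => /and3P[ux _ aj].
  by move: (holds_new H bj Hj ux); rewrite aj.
rewrite pmemE => /orP[] /(holds_far H)[_ _ F]; apply/existsPn => x;
  apply/negP => /and3P[ux ai aj]; exact: (F x).
Qed.
End Holds.

Lemma uniq_named (G : sgraph) s (v : nat -> G) (l : seq nat) : holds s v ->
  all (gtn (named s)) l -> uniq l -> uniq (map v l).
Proof.
move=> H /allP al u; rewrite map_inj_in_uniq // => i j /al Hi /al Hj.
exact: (holds_inj H).
Qed.

Lemma refuse_holds (G : sgraph) s (v : nat -> G) it :
  holds s v -> in_range s it -> ~~ holds_item s v it -> holds (refuse s it) v.
Proof.
case=> inj y n f b nw ind; case: it => i j /= /andP[Hi Hj] /= F; split=> //=.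
  by move=> a c; rewrite inE => /orP[/eqP[-> ->]|/n].
move=> a c; rewrite inE => /orP[/eqP[-> ->]|/f //]; split=> // x ux ai aj.
by case/existsP: F; exists x; apply/and3P.
Qed.

Lemma assume_holds (G : sgraph) s (v : nat -> G) it :
  holds s v -> in_range s it -> holds_item s v it ->
  exists v' : nat -> G, holds (assume s it) v'.
Proof.
case=> inj y n f b nw ind; case: it => i j /= /andP[Hi Hj] F.
  exists v; split=> //= a c.
  by rewrite inE => /orP[/eqP[-> ->]|/y].
case/existsP: F => x /and3P[ux ai aj].
pose w k := if k == named s then x else v k.
have wn : w (named s) = x by rewrite /w eqxx.
have wE k : k < named s -> w k = v k by rewrite /w; case: eqP => // ->; rewrite ltnn.
have vx k : k < named s -> v k <> x.
  by move=> Hk E; case/negP: ux; apply/mapP; exists k; rewrite ?mem_iota.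
pose s' := assume s (Outer i j).
have un z : unnamed s' w z -> unnamed s v z /\ z != x.
  rewrite /unnamed (_ : named s' = named s + 1) ?addn1 // -addn1 iotaD map_cat /= mem_cat wn inE.
  rewrite negb_or => /andP[H ->]; split=> //; apply: contra H => /mapP[k].
  rewrite mem_iota /= => Hk ->; apply/mapP; exists k; rewrite ?mem_iota ?wE //.
have lt k : k < named s -> k < (named s).+1 by exact: leqW.
exists w; split=> /=.
- move=> a c; rewrite !ltnS (leq_eqVlt a) (leq_eqVlt c).
  case/orP=> [/eqP->|Ha] /orP[/eqP->|Hc] //; rewrite ?wn ?wE //.
  + by move/esym/vx => /(_ Hc).
  + by move/vx => /(_ Ha).
  + exact: inj.
- have old a c : (a, c) \in yes s ->
      [/\ a < (named s).+1, c < (named s).+1 & adj (w a) (w c)].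
    by case/y => Ha Hc; rewrite !wE //; split; auto.
  move=> a c; case: eqP => _; rewrite !inE => /orP[/eqP[-> ->]|].
  + by rewrite wn wE // adjC; split; auto.
  + exact: old.
  + by rewrite wn wE // adjC; split; auto.
  + case/orP=> [/eqP[-> ->]|]; last exact: old.
    by rewrite wn wE // adjC; split; auto.
(* The new non-edges: if [x] saw [k], it would be an unnamed vertex contradicting an entry of
   [far]. *)
- move=> a c; rewrite mem_cat => /orP[/mapP[k]|].
    rewrite mem_filter mem_iota /= => /andP[Hk kb] [-> ->].
    have kn := leq_trans kb b; split; auto; rewrite wn wE //.
    rewrite adjC; apply/negP => xk; case/orP: Hk => [/orP[]|]; rewrite pmemE;
      by case/orP=> /f[_ _ /(_ x ux)]; auto.
  by case/n => Ha Hc; rewrite !wE //; split; auto.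
- move=> a c /f[Ha Hc Hf]; split; auto => z /un[uz _]; rewrite !wE //; exact: Hf.
- exact: leqW.
- move=> a z ba; rewrite ltnS (leq_eqVlt a) => /orP[/eqP->|Ha] /un[uz _].
    by rewrite wn; exact: ind.
  by rewrite wE //; exact: nw.
- by move=> a c /un[ua _] /un[uc _]; exact: ind.
Qed.

Lemma place_some (A : Type) cand ok (stop : seq code -> option A) order m r :
  place cand ok stop order m = Some r -> exists m', stop m' = Some r.
Proof.
elim: order m => /= [|a o IH] m; first by exists m.
move: {2}cand => xs; elim: xs => //= x xs IHx; case: ifP => // _.
by case E: place => [r'|//] [rr]; rewrite rr in E; exact: IH E.
Qed.

Lemma find_someP (A : eqType) (B : Type) (f : A -> option B) l r :
  find_some f l = Some r -> exists2 x, x \in l & f x = Some r.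
Proof.
elim: l => //= x l IH; case E: (f x) => [b|].
  by case=> <-; exists x; rewrite ?mem_head.
by case/IH => y yl <-; exists y; rewrite // inE yl orbT.
Qed.

(** The subgraph on [A] belongs to [T], with core enumerated by [f]. No optional edges or added
    vertices are chosen here: they are read off from [G]. *)
Definition piece (T : template) (G : sgraph) (A : {set G}) (f : nat -> G) : Prop :=
  let core := [seq f i | i <- iota 0 (fam_size T)] in
  [/\ uniq core /\ {subset core <= A},
      forall i j, (i, j) \in required T -> adj (f i) (f j),
      forall i j, i < fam_size T -> j < fam_size T -> adj (f i) (f j) -> listed T i j,
      forall x y, x \in A -> y \in A -> x \notin core -> adj x y ->
        exists2 u, u \in unfilled T & y = f u
    & forall x i j, (i, j) \in apart T -> i < fam_size T -> j < fam_size T ->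
        x \in A -> x \notin core ->
        adj x (f i) -> adj x (f j) -> False].

Lemma piece_inj (T : template) (G : sgraph) (A : {set G}) f i j : piece T A f ->
  i < fam_size T -> j < fam_size T -> f i = f j -> i = j.
Proof.
case=> -[uc _] _ _ _ _ Hi Hj /eqP; rewrite -[i](nth_iota 0 0 Hi) -[j](nth_iota 0 0 Hj).
rewrite -!(nth_map 0 (f 0)) ?size_iota // nth_uniq ?size_map ?size_iota //.
by rewrite !nth_iota // => /eqP.
Qed.

Lemma piece_mem (T : template) (G : sgraph) (A : {set G}) f i : piece T A f -> i < fam_size T -> f i \in A.
Proof. by case=> -[_ cA] _ _ _ _ Hi; apply/cA/map_f; rewrite mem_iota. Qed.

(** * Soundness of the search *)

Section Sound.
Variables (G : sgraph) (good_G : good G).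

Lemma graph_imageP s (v : nat -> G) n es im : holds s v -> graph_image n es s im ->
  [/\ size im = n, uniq im, forall i, i < n -> nth 0 im i < named s,
      forall i j, i < n -> j < n -> v (nth 0 im i) = v (nth 0 im j) -> i = j
    & forall i j, (i, j) \in es -> adj (v (nth 0 im i)) (v (nth 0 im j))].
Proof.
move=> H /andP[/andP[/andP[/eqP sz u] /allP al]]; rewrite every_inE => /allP es_yes.
have lt i : i < n -> nth 0 im i < named s.
  by move=> Hi; apply: al; rewrite mem_nth // sz.
split=> // [i j Hi Hj /(holds_inj H) E|i j ij].
  by apply/eqP; rewrite -(nth_uniq 0 _ _ u) ?sz //; apply/eqP/E; auto.
by case: (pmem_yes H (es_yes _ ij)).
Qed.

Lemma has_pattern_sound s (v : nat -> G) p e :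
  holds s v -> has_pattern p s e -> contains p G.
Proof.
move=> H; rewrite /has_pattern some_inE => /hasP[o _].
case E: place => [[]|//] _; have [m] := place_some E; case: ifP => // im _.
have [sz u lt inj es] := graph_imageP H im.
apply/existsP; exists [ffun i : 'I_(psize p) => v (nth 0 (images (psize p) m) i)].
apply/andP; split.
  by apply/injectiveP => i j; rewrite !ffunE => /inj ij; apply/val_inj/ij.
apply/forallP => i; apply/forallP => j; apply/implyP => ij; rewrite !ffunE; exact: es.
Qed.

Lemma apart_codesE (p q : code) :
  apart_codes p q = [&& p.1 != q.1, p.1 != q.2, p.2 != q.1 & p.2 != q.2].
Proof.
rewrite /apart_codes !eqnE.
by case: (p.1 == _) (p.1 == _) (p.2 == _) (p.2 == _) => -[] [] [].
Qed.

Definition ends (ps : seq code) := flatten [seq [:: p.1; p.2] | p <- ps].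

Lemma has_matching_ends k l : has_matching k l -> exists ps,
  [/\ size ps = k, {subset ps <= l}
    & all (fun p => p.1 != p.2) l -> uniq (ends ps)].
Proof.
elim: k l => [|k IHk] l; first by exists [::].
elim: l => // p l IH; rewrite [has_matching _ _]/=; case: ifP => [m _|_ /IH].
  have [ps [sz sub u]] := IHk _ m; exists (p :: ps); split=> /=.
  - by rewrite sz.
  - move=> q; rewrite !inE => /orP[->//|/sub].
    by rewrite mem_filter => /andP[_ ->]; rewrite orbT.
  - case/andP=> p12 al; rewrite u; last first.
      by apply/allP => q; rewrite mem_filter => /andP[_ /(allP al)].
    rewrite andbT inE negb_or p12 /=; apply/andP; split; apply/negP;
      case/flattenP => _ /mapP[q /sub qp ->]; move: qp;
      rewrite mem_filter apart_codesE !inE => /andP[/and4P[n1 n2 n3 n4] _] /orP[] /eqP E.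
    + by rewrite E eqxx in n1.
    + by rewrite E eqxx in n2.
    + by rewrite E eqxx in n3.
    + by rewrite E eqxx in n4.
case=> ps [sz sub u]; exists ps; split=> //= [q /sub ql|/andP[_]//].
by rewrite inE ql orbT.
Qed.

Lemma matching4_sound s (v : nat -> G) : holds s v -> has_matching 4 (yes s) -> False.
Proof.
move=> H /has_matching_ends[ps [sz sub u]].
have {}u : uniq (ends ps).
  apply: u; apply/allP => -[i j] /(holds_yes H)[_ _ /adj_neq] /=.
  by apply: contraNneq => ->.
have inj : {in ends ps &, injective v}.
  have rng i : i \in ends ps -> i < named s.
    case/flattenP => _ /mapP[[a b] /sub/(holds_yes H)[Ha Hb _] ->].
    by rewrite !inE => /orP[] /eqP->.
  by move=> i j /rng Hi /rng Hj; exact: (holds_inj H).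
case: ps sz sub u inj => [|[a b] [|[c d] [|[e f] [|[g h] [|]]]]] // _ sub u inj.
have E i j : (i, j) \in [:: (a, b); (c, d); (e, f); (g, h)] -> adj (v i) (v j).
  by case/sub/(holds_yes H).
apply: (good_max good_G (a := v a) (b := v b) (c := v c) (d := v d) (e := v e)
  (f := v f) (g := v g) (h := v h));
  try by apply: E; rewrite !inE eqxx ?orbT.
by rewrite -(map_inj_in_uniq inj) in u.
Qed.

Lemma killed_sound forb s (v : nat -> G) k : holds s v ->
  (forall p : pattern, List.In p forb -> ~~ contains p G) -> killed forb s k -> False.
Proof.
move=> H nf; rewrite /killed; case: ifP => [/(matching4_sound H) //|_].
rewrite some_inE => /hasP[e _]; elim: forb nf => //= p ps IH nf.
case: ifP => [/(has_pattern_sound H) pG _|_]; last by apply: IH; auto.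
by move: (nf p (or_introl erefl)); rewrite pG.
Qed.

(** This closes a branch: the conditions of [good] provide an edge [xy], but every form it could
    take is refuted. The cases are which of [x] and [y] are named; not both are unnamed, by
    independence. *)
Lemma refuted_edge s (v : nat -> G) (x y : G) (r1 r2 : seq nat) : holds s v ->
  adj x y ->
  (forall i, i < named s -> x = v i -> i \in r1) ->
  (forall i, i < named s -> y = v i -> i \in r2) ->
  (forall i j, i \in r1 -> j \in r2 -> refuted s (Pair i j)) ->
  (forall i, i \in r1 -> refuted s (Outer i i)) ->
  (forall i, i \in r2 -> refuted s (Outer i i)) -> False.
Proof.
move=> H xy x1 y2 P h1 h2.
case: (boolP (unnamed s v x)) => [ux|/unnamedP[i Hi xi]];
  case: (boolP (unnamed s v y)) => [uy|/unnamedP[j Hj yj]].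
- by move: (holds_indep H ux uy); rewrite xy.
- have := refuted_false H _ (h2 _ (y2 _ Hj yj)); rewrite /= Hj => /(_ isT)/existsPn/(_ x).
  by rewrite ux -yj xy.
- have := refuted_false H _ (h1 _ (x1 _ Hi xi)); rewrite /= Hi => /(_ isT)/existsPn/(_ y).
  by rewrite uy -xi adjC xy.
- have := refuted_false H _ (P _ _ (x1 _ Hi xi) (y2 _ Hj yj)); rewrite /= Hi Hj => /(_ isT).
  by rewrite -xi -yj xy.
Qed.

Lemma outside_image s (v : nat -> G) (x : G) (l : seq nat) :
  x \notin [seq v j | j <- l] -> forall i, i < named s -> x = v i ->
  i \in [seq i <- iota 0 (named s) | outside l i].
Proof.
move=> xl i Hi xi; rewrite mem_filter mem_iota /= add0n Hi andbT.
by apply: contra xl => il; apply/mapP; exists i.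
Qed.

Lemma violated2_sound s (v : nat -> G) p q : holds s v ->
  p \in yes s -> q \in yes s -> apart_codes p q -> violated2 s p q = Some [::] -> False.
Proof.
have nil l : Some [seq it <- l | ~~ refuted s it] = Some [::] -> 
    forall it, List.In it l -> refuted s it.
  case; elim: l => //= it l IH; case: ifP => // /negbFE r /IH Hl it' [<- //|]; exact: Hl.
move=> H py qy apq; have := apq; rewrite apart_codesE /violated2.
case: p q py qy apq => [a b] [c d] py qy apq /=.
have [Ha Hb ab] := holds_yes H py; have [Hc Hd cd] := holds_yes H qy.
case/and4P => ac ad bc bd.
have ne x y : adj (v x) (v y) -> x != y.
  by move/adj_neq; apply: contraNneq => ->.
case E: filter => [|e l]; first move/nil => R.
  have u : uniq [:: a; b; c; d].
    by rewrite /= !inE !negb_or ac ad bc bd !ne.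
  have u4 : uniq (map v [:: a; b; c; d]) by apply: (uniq_named H); rewrite //= Ha Hb Hc Hd.
  have [x [y [xy xn yn]]] := good_ext good_G u4 ab cd.
  apply: (refuted_edge H xy (outside_image (l := [:: a; b; c; d]) xn)
    (outside_image (l := [:: a; b; c; d]) yn)) => [i j Hi Hj|i Hi|i Hi];
    apply: R; apply/List.in_app_iff; [left|right|right].
  - exact: In_allpairs.
  - exact: (In_map (fun i => Outer i i)).
  - exact: (In_map (fun i => Outer i i)).
case: ifP => // c4; rewrite -{e l}E => fs; have {fs} [e] := find_someP fs.
rewrite mem_filter => /andP[ape ey]; case: ifP => // _ /nil R.
move: ape; case: ifP => //; rewrite !apart_codesE.
case: e ey R => [e f] ey R /=; have [He Hf ef] := holds_yes H ey.
move=> /and4P[ae af be bf] /and4P[ce cf de df].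
have fin x y : adj x y -> x \notin [seq v j | j <- [:: a; b; c; d; e; f]] ->
    y \notin [seq v j | j <- [:: e; f]] -> False.
  move=> xy xn yn.
  have xo i : i < named s -> x = v i -> i \in [seq i <- 
     [seq i <- iota 0 (named s) | outside [:: e; f] i] | outside [:: a; b; c; d] i].
    move=> Hi xi; have := outside_image xn Hi xi.
    by rewrite !mem_filter /outside !inE !negb_or => /andP[/and5P[-> -> -> -> /andP[-> ->]] ->].
  apply: (refuted_edge H xy xo (outside_image yn)) => [i j Hi Hj|i Hi|i Hi];
    apply: R; apply/List.in_app_iff; [left|right|right].
  - exact: In_allpairs.
  - by apply: (In_map (fun i => Outer i i)); move: Hi; rewrite mem_filter => /andP[].
  - exact: (In_map (fun i => Outer i i)).
(* The cycle is closed either by [ac] and [bd] or by [ad] and [bc]; the second case is the first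
   with [c] and [d] exchanged. *)
have go c' d' : {subset [:: c; d] <= [:: c'; d']} -> c' < named s -> d' < named s ->
    uniq [:: e; f; a; b; c'; d'] ->
    adj (v c') (v d') -> adj (v a) (v c') -> adj (v b) (v d') -> False.
  move=> sub Hc' Hd' u cd' ac' bd'.
  have u6 : uniq (map v [:: e; f; a; b; c'; d']).
    by apply: (uniq_named H); rewrite //= He Hf Ha Hb Hc' Hd'.
  have [x [y [xy xn yn]]] := good_c4 good_G u6 ef ab cd' ac' bd'.
  apply: (fin x y xy _ yn); apply: contra xn => /mapP[i Hi ->].
  apply: (map_f v (s := [:: e; f; a; b; c'; d'])); move: Hi (sub i); rewrite !inE.
  by case: (i == a) (i == b) (i == c) (i == d) (i == e) (i == f) => -[] [] [] [] [] //=;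
    do ?[move=> _ /(_ isT) ->]; rewrite ?orbT.
have u : uniq [:: e; f; a; b; c; d].
  rewrite /= !inE !negb_or !(eq_sym e) !(eq_sym f) ae af be bf ce cf de df ac ad bc bd.
  by rewrite (ne _ _ ef) (ne _ _ ab) (ne _ _ cd).
have {}c4 : (pmem (yes s) a c && pmem (yes s) b d) || (pmem (yes s) a d && pmem (yes s) b c).
  exact: c4.
case/orP: c4 => /andP[/(pmem_yes H)[_ _ ap] /(pmem_yes H)[_ _ bp]].
  exact: (go c d).
apply: (go d c) => //; last by rewrite adjC.
  by move=> i; rewrite !inE orbC.
have ->: [:: e; f; a; b; d; c] = [:: e; f; a; b] ++ rev [:: c; d] by [].
rewrite cat_uniq rev_uniq has_rev; move: u.
by have ->: [:: e; f; a; b; c; d] = [:: e; f; a; b] ++ [:: c; d] by []; rewrite cat_uniq.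
Qed.

Lemma violated_sound s (v : nat -> G) : holds s v -> violated s (yes s) = Some [::] -> False.
Proof.
move=> H; suff gen l : {subset l <= yes s} -> violated s l = Some [::] -> False.
  by apply: gen.
elim: l => //= p l IH sl; case E: find_some => [r|]; last first.
  by apply: IH => x xl; apply: sl; rewrite inE xl orbT.
case=> r0; have [q ql] := find_someP E; case: ifP => // apq; rewrite r0.
by apply: (violated2_sound H _ _ apq); apply: sl; rewrite inE ?eqxx ?ql ?orbT.
Qed.

Lemma pending_sound s ds : pending s ds = Some [::] ->
  forall d, List.In d ds -> exists2 it, List.In it d & refuted s it.
Proof.
rewrite /pending; case: ifP => // al [E] d; elim: ds al E => //= d' ds IH.
case: ifP => // kd' al; case: ifP => [nr|/negbFE].
  move=> E [<-|]; last first.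
    by apply: IH => //; move: E => /=; case: (take 1 [seq it <- d' | ~~ known s it]).
  move/negbTE: kd' nr E => /=; elim: d' => //= it d'' IHd.
  by case: (known s it) => //= k; case: ifP => // _ nr /(IHd k nr)[i]; exists i; auto.
move=> r E [<-|]; last exact: IH.
elim: d' r {kd'} => //= it d'' IHd; case: ifP => [r _|_ /IHd[i]]; first by exists it; auto.
by exists i; auto.
Qed.

Lemma fit_sound T s (v : nat -> G) : holds s v -> fit T s = Some [::] ->
  exists f, piece T [set: G] f.
Proof.
move=> H ft; have {ft} [m] := place_some ft; set n := fam_size T; set im := images n m.
rewrite /core_image; case: ifP => // gi /pending_sound dem.
have [sz u lt inj req] := graph_imageP H gi; rewrite -/n in sz lt inj.
exists (fun i => v (nth 0 im i)).
pose f i := v (nth 0 im i); pose rest := [seq x <- iota 0 (named s) | x \notin im].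
(* Any fact that would keep [G] out of [T] fulfils a demand completely, but each demand contains a
   refuted item. *)
have ref d : List.In d (demands T s im) ->
    all (in_range s) d -> all (holds_item s v) d -> False.
  move/dem => [it itd r]; elim: d itd => //= it' d IH [->|/IH H'] /andP[r1 rd] /andP[h1 hd].
    by move: (refuted_false H r1 r); rewrite h1.
  exact: H'.
have coreP x : reflect (exists2 i, i < n & x = f i) (x \in [seq f i | i <- iota 0 n]).
  by apply: (iffP mapP) => -[i]; rewrite ?mem_iota => Hi ->; exists i; rewrite ?mem_iota.
have restP k x : k < named s -> x = v k -> x \notin [seq f i | i <- iota 0 n] -> k \in rest.
  move=> Hk xk; rewrite mem_filter mem_iota /= add0n Hk andbT; apply: contra => /(nthP 0)[i].
  rewrite sz => Hi ik; apply/coreP; exists i; rewrite // xk -ik //.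
have rest_lt k : k \in rest -> k < named s by rewrite mem_filter mem_iota => /andP[].
have inc l1 l2 l3 l4 l5 l6 l7 (d : seq item) :
  [\/ List.In d l1, List.In d l2, List.In d l3 | [\/ List.In d l4, List.In d l5, List.In d l6 | List.In d l7]] ->
   List.In d (l1 ++ l2 ++ l3 ++ l4 ++ l5 ++ l6 ++ l7).
  by rewrite !List.in_app_iff; case=> [h|h|h|[h|h|h|h]]; auto 10.
have core_in i : i < n -> i \notin unfilled T -> i \in [seq i <- iota 0 n | i \notin unfilled T].
  by move=> Hi iU; rewrite mem_filter iU mem_iota.
split=> //.
- split; last by move=> x _; rewrite inE.
  rewrite map_inj_in_uniq ?iota_uniq // => i j.
  by rewrite !mem_iota; exact: inj.
- have lC i j : listed T i j = listed T j i by rewrite /listed !pmemE ![_ || ((j, i) \in _)]orbC.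
  (* The demands on core pairs are listed in increasing order only, and both relations are
     symmetric. *)
  suff lw i j : i < j -> j < n -> adj (f i) (f j) -> listed T i j.
    move=> i j Hi Hj ij; case: (ltngtP i j) => [l|l|E]; first exact: lw.
      by rewrite lC; apply: lw; rewrite // adjC.
    by move: ij; rewrite E adjxx.
  move=> Hij Hj ij; have Hi := ltn_trans Hij Hj; apply/negP => /negP nl.
  have := ref [:: Pair (nth 0 im i) (nth 0 im j)].
  rewrite /= !lt // ij; case=> //.
  apply: inc; constructor 1; apply: (In_map (fun p => [:: Pair (nth 0 im p.1) (nth 0 im p.2)]) (x := (i, j))).
  by rewrite mem_filter /= Hij nl; apply/allpairsP; exists (i, j); rewrite !mem_iota.
- move=> x y _ _ xc xy.
  case: (boolP (y \in [seq f i | i <- iota 0 n])) => [/coreP[i Hi yi]|yc].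
    case: (boolP (i \in unfilled T)) => [iU|/(core_in _ Hi) iU]; first by exists i.
    exfalso.
    case: (boolP (unnamed s v x)) => [ux|/unnamedP[k Hk xk]].
      apply: (ref [:: Outer (nth 0 im i) (nth 0 im i)]); [|by rewrite /= !lt|rewrite /=].
        apply: inc; constructor 4; constructor 1; exact: (In_map (fun i => [:: Outer (nth 0 im i) (nth 0 im i)])).
      by rewrite andbT; apply/existsP; exists x; rewrite ux -[v _]/(f i) -yi xy.
    apply: (ref [:: Pair (nth 0 im i) k]); [|by rewrite /= !lt // Hk|rewrite /=].
      apply: inc; constructor 2; apply: (In_allpairs (fun i x => [:: Pair (nth 0 im i) x])) => //.
      exact: restP xk xc.
    by rewrite andbT -[v (nth _ _ _)]/(f i) -yi -xk adjC.
  exfalso; case: (boolP (unnamed s v x)) => [ux|/unnamedP[k Hk xk]];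
  case: (boolP (unnamed s v y)) => [uy|/unnamedP[l Hl yl]].
  + by move: (holds_indep H ux uy); rewrite xy.
  + apply: (ref [:: Outer l l]); [|by rewrite /= Hl|rewrite /=].
      apply: inc; constructor 4; constructor 2; apply: (In_map (fun l => [:: Outer l l])).
      exact: restP yl yc.
    by rewrite andbT; apply/existsP; exists x; rewrite ux -yl xy.
  + apply: (ref [:: Outer k k]); [|by rewrite /= Hk|rewrite /=].
      apply: inc; constructor 4; constructor 2; apply: (In_map (fun l => [:: Outer l l])).
      exact: restP xk xc.
    by rewrite andbT; apply/existsP; exists y; rewrite uy -xk adjC xy.
  + apply: (ref [:: Pair k l]); [|by rewrite /= Hk Hl|rewrite /=].
      apply: inc; constructor 3; apply: (In_allpairs (fun x y => [:: Pair x y]));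
      [exact: restP xk xc|exact: restP yl yc].
    by rewrite andbT -xk -yl.
- move=> x i j ij Hi Hj _ xc xi xj.
  case: (boolP (unnamed s v x)) => [ux|/unnamedP[k Hk xk]].
    apply: (ref [:: Outer (nth 0 im i) (nth 0 im j)]); [|by rewrite /= !lt|rewrite /=].
      apply: inc; constructor 4; constructor 3.
      exact: (In_map (fun p => [:: Outer (nth 0 im p.1) (nth 0 im p.2)]) ij).
    by rewrite andbT; apply/existsP; exists x; rewrite ux xi.
  apply: (ref [:: Pair (nth 0 im i) k; Pair (nth 0 im j) k]); [|by rewrite /= !lt // Hk|rewrite /=].
    apply: inc; constructor 4; constructor 4.
    apply: (In_allpairs (fun p x => [:: Pair (nth 0 im p.1) x; Pair (nth 0 im p.2) x]) ij).
    exact: restP xk xc.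
  by rewrite -xk adjC xi adjC xj.
Qed.

Lemma solve_sound fuel forb ts s (v : nat -> G) :
  (forall p, List.In p forb -> ~~ contains p G) -> holds s v ->
  solve fuel forb ts s -> exists2 T, List.In T ts & exists f, piece T [set: G] f.
Proof.
move=> nf; elim: fuel s v => //= fuel IH s v H.
(* The local [branch] of [solve] is written out, for an induction on the list of items in which the
   state varies. *)
have branch l s' (v' : nat -> G) : holds s' v' ->
  (fix branch (l : seq item) (s : state) {struct l} :=
     if l is it :: l' then
       if refuted s it then branch l' s else in_range s it &?
       (let s' := assume s it in killed forb s' (size (yes s') - size (yes s)) |? solve fuel forb ts s')
        &? branch l' (refuse s it)
     else solve fuel forb ts s) l s' -> exists2 T, List.In T ts & exists f, piece T [set: G] f.
  elim: l s' v' => [|it l IHl] s' v' H'; first by move=> /= /(IH _ _ H').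
  case: ifP => [_|_]; first exact: (IHl _ _ H').
  case/andP => /andP[ir]; case: (boolP (holds_item s' v' it)) => [Hi|Hi _]; last exact: (IHl _ _ (refuse_holds H' ir Hi)).
  have [w Hw] := assume_holds H' ir Hi; case/orP=> [k|sv] _; last exact: (IH _ _ Hw sv).
  by case: (killed_sound Hw nf k).
case E: violated => [l|].
  case: l E => [/(violated_sound H) //|it l _]; exact: (branch (it :: l) _ _ H).
case F: find_some => [l|//].
case: l F => [F _|it l _]; last exact: (branch (it :: l) _ _ H).
elim: ts F {branch IH E} => //= T ts IHt; case E: fit => [r|].
  by move=> [r0]; rewrite r0 in E; exists T; [left|exact: (fit_sound H E)].
by case/IHt => T' inT pT; exists T'; [right|].
Qed.

Lemma solve_pattern fuel forb ts p :
  (forall p, List.In p forb -> ~~ contains p G) ->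
  all (fun q => (q.1 < psize p) && (q.2 < psize p)) (pedges p) ->
  has_matching 3 (pedges p) -> solve fuel forb ts (start p) ->
  contains p G -> exists2 T, List.In T ts & exists f, piece T [set: G] f.
Proof.
move=> nf /allP rng m3 sv /existsP[f /andP[/injectiveP inj /forallP es]].
(* A default vertex is needed for codes out of range. Without any vertex the pattern would be empty,
   against its three disjoint edges. *)
have [x0 _ | G0] := pickP G; last first.
  case: p f m3 rng {sv es inj} => [[|n] es o] /= f m3 rng; last by have := G0 (f ord0).
  by case: es m3 rng => // q es _ /(_ q (mem_head _ _)).
pose v i := if insub i is Some j then f j else x0.
have vE i (Hi : i < psize p) : v i = f (Ordinal Hi) by rewrite /v insubT.
apply: (solve_sound (v := v) nf _ sv); split=> //=.
- by move=> i j Hi Hj; rewrite !vE => /inj[].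
- move=> i j ij; have /andP[/= Hi Hj] := rng _ ij; split=> //; rewrite !vE.
  by have /forallP/(_ (Ordinal Hj))/implyP := es (Ordinal Hi); apply.
- by move=> i x; rewrite leqNgt => /negP.
(* With the three disjoint edges of the pattern, an edge between unnamed vertices makes a matching
   of size four. *)
- move=> x y ux uy; apply/negP => xy.
  have [ps [sz sub u]] := has_matching_ends m3.
  have {}u : uniq (ends ps).
    apply: u; apply/allP => -[i j] ij; have /andP[/= Hi Hj] := rng _ ij.
    have /forallP/(_ (Ordinal Hj))/implyP/(_ ij)/adj_neq := es (Ordinal Hi).
    by apply: contraNneq => E; rewrite E in Hi *; apply/eqP; congr (f _); apply: val_inj.
  have rngs i : i \in ends ps -> i < psize p.
    case/flattenP => _ /mapP[[a b] /sub/rng/andP[Ha Hb] ->].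
    by rewrite !inE => /orP[] /eqP->.
  have injv : {in ends ps &, injective v}.
    by move=> i j /rngs Hi /rngs Hj; rewrite !vE => /inj[].
  have nx z : unnamed (start p) v z -> z \notin map v (ends ps).
    apply: contra => /mapP[i /rngs Hi ->]; apply/mapP; exists i => //.
    by rewrite mem_iota.
  move: (nx _ ux) (nx _ uy) => {}nx ny.
  have adjE i j : (i, j) \in ps -> adj (v i) (v j).
    move=> /sub ij; have /andP[/= Hi Hj] := rng _ ij; rewrite !vE.
    by have /forallP/(_ (Ordinal Hj))/implyP := es (Ordinal Hi); apply.
  case: ps sz {sub rngs} u injv nx ny adjE => [|[a b] [|[c d] [|[e g] [|]]]] // _ u injv nx ny E.
  apply: (good_max good_G (a := x) (b := y) (c := v a) (d := v b) (e := v c)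
    (f := v d) (g := v e) (h := v g)) => //; try by apply: E; rewrite !inE eqxx ?orbT.
  rewrite -(map_inj_in_uniq injv) in u.
  by rewrite cons_uniq [X in _ && X]cons_uniq u inE negb_or (adj_neq xy) nx ny.
Qed.
End Sound.


(** * The case analysis *)

(** With each starting subgraph come the templates of the good graphs that contain it but neither
    [C7] nor an earlier entry. The search from [P6] always ends in contradictions, hence its empty
    list. *)
Definition starts : seq (pattern * seq template) :=
  [:: (C5K2, [:: K3_plus G3; star_plus G3]);
      (K3K3K2, [:: K3_plus bow; plain B7; K3_plus G2; disjoint3 tri tri tri; disjoint3 tri tri star]);
      (K3P4, [:: plain B8; E1_template; E2_template; plain B9; K3_plus G1]);
      (K3K2K2, [:: petals tri tri tri; petals tri tri ray; star_plus bow; petals tri ray ray;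
                  star_plus G2; disjoint3 tri star star]);
      (C6, [:: plain B3; plain B5; plain B2; plain B4; plain B6]);
      (P7, [:: plain B2; plain B6; plain B1]);
      (P6, [::]);
      (K2K2K2, [:: star_plus G1; plain B1])].

Fixpoint solve_all fuel forb l :=
  if l is (p, ts) :: l' then
    all (fun q => (q.1 < psize p) && (q.2 < psize p)) (pedges p) &?
    has_matching 3 (pedges p) &? solve fuel forb ts (start p) &?
    solve_all fuel (p :: forb) l'
  else true.

(** The whole case analysis is this evaluation; 60 is a sufficient bound on the depth of nested
    choices. *)
Lemma solve_all_starts : solve_all 60 [:: C7] starts.
Proof. by vm_cast_no_check (erefl true). Qed.

Lemma solve_all_sound (G : sgraph) fuel forb l : good G ->
  (forall p, List.In p forb -> ~~ contains p G) -> solve_all fuel forb l ->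
  has (fun p => contains p G) [seq x.1 | x <- l] ->
  exists2 T, List.In T (flatten [seq x.2 | x <- l]) & exists f, piece T [set: G] f.
Proof.
move=> gG; elim: l forb => // -[p ts] l IH forb nf /andP[/andP[/andP[rng m3] sv] sl].
rewrite map_cons [has _ _]/=; case: (boolP (contains p G)) => [pG _|npG].
  have [T Tts Hf] := solve_pattern gG nf rng m3 sv pG.
  by exists T => //; apply/List.in_app_iff; left.
case/(IH (p :: forb)) => // [q [<-|/nf]//|T Tl Hf].
by exists T => //; apply/List.in_app_iff; right.
Qed.

(** The last entry of [starts] is the matching of size three, so no graph escapes the list. *)
Lemma good_templates (G : sgraph) : good G -> contains K2K2K2 G -> ~~ contains C7 G ->
  exists2 T, List.In T (flatten [seq l.2 | l <- starts]) & exists f, piece T [set: G] f.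
Proof.
move=> gG c3 nC7; apply: (solve_all_sound gG _ solve_all_starts).
  by move=> p [<-|].
by rewrite /= c3 !orbT.
Qed.


(** * Members of the templates are good *)

Fixpoint subseqs (A : Type) (l : seq A) : seq (seq A) :=
  if l is x :: l' then let r := subseqs l' in r ++ map (cons x) r else [:: [::]].

Lemma filter_subseqs (A : eqType) (a : pred A) l : filter a l \in subseqs l.
Proof.
elim: l => //= x l IH; rewrite mem_cat; case: ifP => _; last by rewrite IH.
by apply/orP; right; exact: (map_f (cons x)).
Qed.

Section Check.
(* The code [n] stands for any vertex outside the core. *)
Variables (n : nat) (es : seq code) (us : seq nat) (ap : seq code).

(** Can the two codes stand for different vertices? Two occurrences of [n] can, as there may be many
    vertices outside the core. *)
Definition sep i j := ~~ eqn i j |? eqn i n.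

Definition sep2 (p q : code) := sep p.1 q.1 &? sep p.1 q.2 &? sep p.2 q.1 &? sep p.2 q.2.

(** The adjacencies that can occur, in both directions. Those at [n] are an upper bound: an outside
    vertex may see any unfilled vertex, but need not. *)
Definition links : seq code :=
  es ++ [seq (p.2, p.1) | p <- es] ++ [seq (u, n) | u <- us] ++ [seq (n, u) | u <- us].

Definition max_ok :=
  every_in (fun p => let l1 := filter (sep2 p) links in
  every_in (fun q => let l2 := filter (sep2 q) l1 in
  every_in (fun r => ~~ some_in (sep2 r) l2) l2) l1) links.

(** The third edge is sought in [es] only, because edges at outside vertices need not be present. *)
Definition ext_ok :=
  every_in (fun p => let es1 := filter (sep2 p) es in
  every_in (fun q => some_in (sep2 q) es1) (filter (sep2 p) links)) links.

Definition unapart x i j := if eqn x n then ~~ pmem ap i j else true.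

(** The cycle is [p.1], [p.2], [q.2], [r.2]. At each corner, [unapart] discards the case of an
    outside vertex seeing two core vertices that are kept apart. *)
Definition c4_ok :=
  every_in (fun p => every_in (fun q =>
    if eqn p.2 q.1 &? sep p.1 q.2 &? unapart p.2 p.1 q.2 then
    every_in (fun r =>
      if eqn q.2 r.1 &? pmem links r.2 p.1 &? sep p.2 r.2 &? unapart r.2 p.1 q.2
         &? unapart p.1 p.2 r.2 &? unapart q.2 p.2 r.2
      then let es1 := filter (fun e => ~~ inside p r e) es in
        every_in (fun s => some_in (sep2 s) es1)
          (filter (fun s => sep2 s p &? sep2 s r) links)
      else true) links else true) links) links.
End Check.

(** The list [O] runs through all possible sets of optional edges, so the edges of the core are
    known exactly in each check. *)
Definition template_ok (T : template) :=
  let n := fam_size T in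
  all (fun q => (q.1 < n) && (q.2 < n)) (required T ++ optional T) &?
  all (gtn n) (unfilled T) &?
  has_matching 3 (required T) &?
  every_in (fun O => let es := required T ++ O in
    max_ok n es (unfilled T) &? ext_ok n es (unfilled T) &?
    c4_ok n es (unfilled T) (apart T)) (subseqs (optional T)).

Definition petal_family (b : bool) := if b then tri else ray.
Definition small_family (b : bool) := if b then tri else star.

Section Piece.
Variables (G : sgraph) (T : template) (f : nat -> G).
Hypotheses (pieceT : piece T [set: G] f) (okT : template_ok T).

Let n := fam_size T.
Let core := [seq f i | i <- iota 0 n].
Let g x := index x core.
Let O := [seq q <- optional T | adj (f q.1) (f q.2)].
Let es := required T ++ O.
Let L := links n es (unfilled T).

Let size_core : size core = n.
Proof. by rewrite size_map size_iota. Qed.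

Let uniq_core : uniq core.
Proof. by case: pieceT => -[]. Qed.

Let nth_core i : i < n -> nth (f 0) core i = f i.
Proof. by move=> Hi; rewrite (nth_map 0) ?size_iota // nth_iota. Qed.

Let gK i : i < n -> g (f i) = i.
Proof. by move=> Hi; rewrite /g -(nth_core Hi) index_uniq ?size_core. Qed.

Let coreE x : (x \in core) = (g x < n).
Proof. by rewrite /g -size_core index_mem. Qed.

Let fK x : g x < n -> f (g x) = x.
Proof. by move=> Hx; rewrite -nth_core // nth_index // coreE. Qed.

Let gn x : x \notin core -> g x = n.
Proof. by move=> /memNindex; rewrite size_core. Qed.

Let sepP x y : x != y -> sep n (g x) (g y).
Proof.
move=> xy; rewrite /sep !eqnE; case: eqP => //= E; apply/eqP/gn.
by apply: contra xy; rewrite coreE => Hx; rewrite -(fK Hx) E fK // -E.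
Qed.

Let sep_f x i : i < n -> sep n (g x) i -> x != f i.
Proof.
move=> Hi; rewrite /sep !eqnE => H; apply: contraTneq H => ->.
by rewrite gK // eqxx (ltn_eqF Hi).
Qed.

Let wf_codes p : p \in required T ++ optional T -> (p.1 < n) && (p.2 < n).
Proof. by case/andP: okT => /andP[/andP[/allP H _] _] _; exact: H. Qed.

Let wf_unfilled u : u \in unfilled T -> u < n.
Proof. by case/andP: okT => /andP[/andP[_ /allP H] _] _; exact: H. Qed.

Let esP p : p \in es -> [/\ p.1 < n, p.2 < n & adj (f p.1) (f p.2)].
Proof.
rewrite mem_cat => /orP[pR|].
  have /andP[-> ->] : (p.1 < n) && (p.2 < n) by apply: wf_codes; rewrite mem_cat pR.
  by split=> //; case: pieceT => _ H _ _ _; apply: H; case: p pR.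
rewrite mem_filter => /andP[-> pO].
by have /andP[-> ->] : (p.1 < n) && (p.2 < n) by apply: wf_codes; rewrite mem_cat pO orbT.
Qed.

Let es_adj i j : i < n -> j < n -> adj (f i) (f j) -> ((i, j) \in es) || ((j, i) \in es).
Proof.
case: pieceT => _ _ H _ _ Hi Hj ij; have := H i j Hi Hj ij.
rewrite !mem_cat !mem_filter /= (adjC (f j)) ij /= /listed !pmemE.
by case: ((i, j) \in required T); case: ((j, i) \in required T);
  case: ((i, j) \in optional T); case: ((j, i) \in optional T).
Qed.

Let linkP x y : adj x y -> (g x, g y) \in L.
Proof.
move=> xy; have LE p : (p \in L) = [|| p \in es, p \in [seq (p.2, p.1) | p <- es],
    p \in [seq (u, n) | u <- unfilled T] | p \in [seq (n, u) | u <- unfilled T]].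
  by rewrite /L /links (mem_cat p es) (mem_cat p (map _ es)) (mem_cat p (map (fun u => (u, n)) _)).
rewrite LE; have swap i j : (i, j) \in es -> (j, i) \in [seq (p.2, p.1) | p <- es].
  exact: (map_f (fun p => (p.2, p.1))).
case: pieceT => _ _ _ H _.
case: (boolP (x \in core)) (boolP (y \in core)) => [xc|xc] [yc|yc].
- move: (xc) (yc); rewrite !coreE => gx gy.
  have := es_adj gx gy; rewrite !fK // => /(_ xy)/orP[->//|/swap ->]; rewrite orbT //.
- have [||||u Hu xu] := H y x; rewrite ?inE // 1?adjC //.
  by rewrite (gn yc) xu (gK (wf_unfilled Hu)) (map_f (fun u => (u, n)) Hu) !orbT.
- have [||||u Hu yu] := H x y; rewrite ?inE //.
  by rewrite (gn xc) yu (gK (wf_unfilled Hu)) (map_f (fun u => (n, u)) Hu) !orbT.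
- have [||||u Hu yu] := H x y; rewrite ?inE //.
  by rewrite yu coreE gK ?wf_unfilled in yc.
Qed.

Let checks : [/\ max_ok n es (unfilled T), ext_ok n es (unfilled T)
  & c4_ok n es (unfilled T) (apart T)].
Proof.
case/andP: okT => _; rewrite every_inE => /allP/(_ O (filter_subseqs _ _)).
by case/andP => /andP[].
Qed.

Let sep2P a b c d : [&& a != c, a != d, b != c & b != d] ->
  sep2 n (g a, g b) (g c, g d).
Proof. by case/and4P=> /sepP H1 /sepP H2 /sepP H3 /sepP H4; rewrite /sep2 /= H1 H2 H3 H4. Qed.

Let sep2_f a b p : p \in es -> sep2 n (g a, g b) p ->
  f p.1 \notin [:: a; b] /\ f p.2 \notin [:: a; b].
Proof.
case/esP=> H1 H2 _ /andP[/andP[/andP[/= s1 s2] s3] s4].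
rewrite !inE !negb_or ![f _ == _]eq_sym.
by rewrite (sep_f H1 s1) (sep_f H2 s2) (sep_f H1 s3) (sep_f H2 s4).
Qed.

(** The map [g] sends a core vertex to its code and every other vertex to [n]; distinct vertices get
    separated codes and edges become [links]. The checks then apply, and the edge of [es] that they
    provide is carried back by [f]. *)
Lemma piece_good : good G.
Proof.
have [mx ex c4] := checks; split.
- move=> a b c d e h k l; rewrite /= !inE !negb_or -!andbA => u ab cd eh kl.
  case/and5P: u => u1 u2 u3 u4 /and5P[u5 u6 u7 u8 /and5P[u9 u10 u11 u12 /and5P[u13 u14 u15 u16 /and5P[u17 u18 u19 u20 /and5P[u21 u22 u23 u24 /and5P[u25 u26 u27 u28 _]]]]]].
  move: mx; rewrite /max_ok every_inE => /allP/(_ _ (linkP ab)).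
  rewrite every_inE => /allP/(_ (g c, g d)).
  rewrite mem_filter linkP // andbT sep2P ?u2 ?u3 ?u8 ?u9 //= => /(_ isT).
  rewrite every_inE => /allP/(_ (g e, g h)).
  rewrite !mem_filter linkP // andbT !sep2P /=; try by apply/and4P.
  move=> /(_ isT)/negP; apply; rewrite some_inE; apply/hasP; exists (g k, g l).
    by rewrite !mem_filter linkP // andbT !sep2P //=; apply/and4P.
  by rewrite sep2P //; apply/and4P.
- move=> a b c d; rewrite /= !inE !negb_or -!andbA.
  case/and5P=> u1 u2 u3 u4 /and3P[u5 u6 _] ab cd.
  move: ex; rewrite /ext_ok every_inE => /allP/(_ _ (linkP ab)).
  rewrite every_inE => /allP/(_ (g c, g d)).
  rewrite mem_filter linkP // andbT sep2P /=; last by apply/and4P.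
  move=> /(_ isT); rewrite some_inE => /hasP[p]; rewrite mem_filter => /andP[s1 pe] s2.
  have [_ _ pa] := esP pe; exists (f p.1), (f p.2).
  have [] := sep2_f pe s1; have [] := sep2_f pe s2; rewrite !inE !negb_or.
  by move=> /andP[-> ->] /andP[-> ->] /andP[-> ->] /andP[-> ->].
- move=> a b c d e h; rewrite /= !inE !negb_or -!andbA.
  case/and5P=> u1 u2 u3 u4 /and5P[u5 u6 u7 u8 /and5P[u9 u10 u11 u12 /and4P[u13 u14 u15 _]]].
  move=> ab cd eh ce dh.
  (* If [x] is outside the core, then [y] and [z] are core vertices, and they are not kept apart
     since [x] sees both. *)
  have un x y z : adj x y -> adj x z -> unapart n (apart T) (g x) (g y) (g z).
    move=> xy xz; rewrite /unapart eqnE; case: eqP => // gx.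
    have xc : x \notin core by rewrite coreE gx ltnn.
    have [H1 H2] : (exists2 i, i < n & y = f i) /\ (exists2 i, i < n & z = f i).
      case: pieceT => _ _ _ H _.
      by split; [have [||||i] := H x y|have [||||i] := H x z]; rewrite ?inE //; exists i => //; apply: wf_unfilled.
    case: H1 H2 xy xz => i Hi -> [j Hj ->]; rewrite !gK // => xi xj.
    case: pieceT => _ _ _ _ H; apply/negP; rewrite pmemE => /orP[] /H H'.
      exact: (H' x).
    exact: (H' x).
  move: c4; rewrite /c4_ok every_inE => /allP/(_ _ (linkP cd)).
  have [dc he] : adj d c /\ adj h e by rewrite adjC cd adjC eh.
  have [ec hd] : adj e c /\ adj h d by rewrite adjC ce adjC dh.
  rewrite every_inE => /allP/(_ _ (linkP dh)) /=.
  rewrite eqnE eqxx (sepP u12) (un d c h dc dh) every_inE => /allP/(_ _ (linkP he)) /=.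
  rewrite eqxx pmemE (linkP ec) /= (sepP u13) (un e c h ec eh).
  rewrite (un c d e cd ce) (un h d e hd he) every_inE => /allP/(_ (g a, g b)).
  rewrite mem_filter (linkP ab) andbT !sep2P /=; last 2 first.
  + by apply/and4P; split.
  + by apply/and4P; split.
  move=> /(_ isT); rewrite some_inE => /hasP[p]; rewrite mem_filter => /andP[io pe] s1.
  have [p1 p2 pa] := esP pe; have [n1 n2] := sep2_f pe s1.
  have fin x y : adj (f x) (f y) -> x < n -> f x \notin [:: a; b] -> f y \notin [:: a; b] ->
      x \notin [:: g c; g d; g h; g e] -> exists x y : G,
      [/\ adj x y, x \notin [:: a; b; c; d; e; h] & y \notin [:: a; b]].
    move=> xy Hx; rewrite !inE !negb_or => /andP[xa xb] /andP[ya yb] /and4P[xc xd xh xe].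
    exists (f x), (f y); rewrite xy !inE !negb_or xa xb ya yb; split=> //.
    by apply/and5P; split=> //; [move: xc|move: xd|apply/andP; split; [move: xe|move: xh]];
      apply: contraNneq => <-; rewrite gK.
  move: io; rewrite /inside negb_and => /orP[] io; first exact: (fin p.1 p.2).
  by apply: (fin p.2 p.1) => //; rewrite adjC.
Qed.
End Piece.


(** * The matching complex: Buchsbaum means good with three disjoint edges *)

Section Matching.
Variable G : sgraph.
Implicit Types (e f g : {set G}) (F : {set {set G}}).
Let D := matching_complex G.

Lemma edgesP e : reflect (exists x y, adj x y /\ e = [set x; y]) (e \in edges G).
Proof.
apply: (iffP imsetP) => [[[x y] xy ->]|[x [y [xy ->]]]].
  by exists x, y; move: xy; rewrite inE.
by exists (x, y); rewrite ?inE.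
Qed.

Lemma mem_edges (x y : G) : adj x y -> [set x; y] \in edges G.
Proof. by move=> xy; apply/edgesP; exists x, y. Qed.

Lemma disjoint_edges (a b c d : G) :
  [disjoint [set a; b] & [set c; d]] = [&& a != c, a != d, b != c & b != d].
Proof.
rewrite -setI_eq0; apply/eqP/and4P => [E|[n1 n2 n3 n4]].
  have H x y : x \in [set a; b] -> y \in [set c; d] -> x != y.
    move=> Hx Hy; apply: contraTneq Hy => <-; apply/negP => Hx'.
    by have := in_set0 x; rewrite -E inE Hx Hx'.
  by split; apply: H; rewrite !inE eqxx ?orbT.
apply/setP => x; rewrite !inE; apply/negbTE; rewrite negb_and.
apply/orP; case: (altP (x =P a)) => [->|xa]; first by right; rewrite negb_or n1 n2.
case: (altP (x =P b)) => [->|xb]; first by right; rewrite negb_or n3 n4.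
by left.
Qed.

Lemma edge_neq0 e : e \in edges G -> e != set0.
Proof. by case/edgesP => x [y [_ ->]]; apply/set0Pn; exists x; rewrite !inE eqxx. Qed.

Lemma face1 e : ([set e] \in D) = (e \in edges G).
Proof.
rewrite inE sub1set andbC; case: trivIsetP => // -[] A B.
by rewrite !inE => /eqP-> /eqP->; rewrite eqxx.
Qed.

Lemma face_sub F F' : F' \subset F -> F \in D -> F' \in D.
Proof.
move=> FF'; rewrite !inE => /andP[FE tF]; rewrite (subset_trans FF' FE) /=.
exact: trivIsetS FF' tF.
Qed.

Lemma faceU1 e F : e |: F \in D -> e \notin F ->
  [/\ e \in edges G, F \in D & forall f, f \in F -> [disjoint e & f]].
Proof.
move=> eF neF; split; last first.
- move=> f fF; move: eF; rewrite inE => /andP[_ /trivIsetP t].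
  apply: t; rewrite ?inE ?eqxx ?fF ?orbT //; by apply: contraNneq neF => ->.
- by apply: face_sub eF; exact: subsetUr.
- by rewrite -face1; apply: face_sub eF; exact: subsetUl.
Qed.

Lemma face_cons e F : e \in edges G -> F \in D -> (forall f, f \in F -> [disjoint e & f]) ->
  e |: F \in D /\ e \notin F.
Proof.
move=> ee; rewrite inE => /andP[FE /trivIsetP tF] dF; split.
  rewrite inE subUset sub1set ee FE; apply/trivIsetP => A B.
  rewrite !inE => /orP[/eqP->|AF] /orP[/eqP->|BF]; rewrite ?eqxx // => AB.
  - exact: dF.
  - by rewrite disjoint_sym; exact: dF.
  - exact: tF.
by apply/negP => /dF; rewrite -setI_eq0 setIid (negbTE (edge_neq0 ee)).
Qed.

Lemma link1 e f : ([set f] \in link D e) = [&& e \in edges G, f \in edges G & [disjoint e & f]].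
Proof.
rewrite inE; apply/and3P/and3P => [[fD nef efD]|[ee ef d]].
  have [ee _ H] := faceU1 efD nef; split=> //; first by rewrite -face1.
  by apply: H; rewrite inE.
have [|||H1 H2] := @face_cons e [set f]; rewrite ?face1 // => g.
by rewrite inE => /eqP->.
Qed.

Lemma link2 e f g : f != g -> ([set f; g] \in link D e) =
  [&& e \in edges G, f \in edges G, g \in edges G & [&& [disjoint e & f], [disjoint e & g] & [disjoint f & g]]].
Proof.
move=> fg; rewrite inE; apply/and3P/and4P => [[fD nef efD]|[ee ef eg /and3P[d1 d2 d3]]].
  have [ee _ H] := faceU1 efD nef.
  have [|ef gD H2] := @faceU1 f [set g] fD; first by rewrite inE.
  by split=> //; rewrite -?face1 //; rewrite !H ?H2 ?inE ?eqxx ?orbT.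
have [|||H1 _] := @face_cons f [set g]; rewrite ?face1 //; first by move=> h; rewrite inE => /eqP->.
by have [|||H2 H3] := @face_cons e [set f; g] => // h; rewrite !inE => /orP[]/eqP->.
Qed.

Lemma skelE e f g : skeleton_adj (link D e) f g =
  [&& e \in edges G, f \in edges G, g \in edges G & [&& [disjoint e & f], [disjoint e & g] & [disjoint f & g]]].
Proof.
rewrite /skeleton_adj /=; case: (altP (f =P g)) => [->|fg] /=; last exact: link2.
apply/esym/negbTE/negP => /and4P[_ eg _ /and3P[_ _]].
by rewrite -setI_eq0 setIid (negbTE (edge_neq0 eg)).
Qed.

Lemma link_face F e : F \in link D e -> [/\ e \in edges G, F \in D & forall f, f \in F -> [disjoint e & f]].
Proof. by rewrite inE => /and3P[_ ne eF]; exact: faceU1. Qed.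

Lemma has_dimP (V : finType) (C : {set {set V}}) d : has_dim C d <->
  (exists2 A, A \in C & #|A| = d.+1) /\ (forall A, A \in C -> #|A| <= d.+1).
Proof.
rewrite /has_dim; split=> [E|[[A AC cA] le]].
  split; last by move=> A AC; rewrite -E leq_bigmax_cond.
  have C0 : 0 < #|C|.
    rewrite lt0n; apply: contra_eq_neq E => /eqP; rewrite cards_eq0 => /eqP->.
    by rewrite big_set0.
  by have [A AC cA] := eq_bigmax_cond (fun A : {set V} => #|A|) C0; exists A; rewrite -?cA.
apply/eqP; rewrite eqn_leq -{2}cA leq_bigmax_cond // andbT.
by apply/bigmax_leqP.
Qed.

(* [s] lists some edges of the matching [F]. *)
Lemma matching_ends F (s : seq {set G}) : F \in D -> uniq s -> {subset s <= F} ->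
  exists ps : seq (G * G), [/\ s = [seq [set p.1; p.2] | p <- ps],
    {in ps, forall p, adj p.1 p.2} & uniq (flatten [seq [:: p.1; p.2] | p <- ps])].
Proof.
rewrite inE => /andP[/subsetP FE /trivIsetP tF]; elim: s => [|e s IH] /=; first by exists [::].
case/andP=> es us sF; case: IH => // [f fs|ps [sE aps ups]].
  by apply: sF; rewrite inE fs orbT.
have eF := sF e (mem_head _ _); have /edgesP[x [y [xy eE]]] := FE _ eF.
exists ((x, y) :: ps); split=> /=; first by rewrite -eE -sE.
  by move=> p; rewrite inE => /orP[/eqP->|/aps].
rewrite ups inE negb_or (adj_neq xy) !andbT /=.
suff H z : z \in e -> z \notin flatten [seq [:: p.1; p.2] | p <- ps].
  by rewrite !H // eE !inE eqxx ?orbT.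
move=> ze; apply/negP => /flattenP[_ /mapP[p pps ->] zp].
have ps_s : [set p.1; p.2] \in s by rewrite sE; exact: (map_f (fun q : G * G => [set q.1; q.2])).
have : [disjoint e & [set p.1; p.2]].
  apply: tF => //; first by apply: sF; rewrite inE ps_s orbT.
  by apply: contraNneq es => ->.
move/disjointFr => /(_ _ ze); rewrite !inE in zp *; by rewrite zp.
Qed.

Lemma contains_K2K2K2P : reflect (exists a b c d e f : G,
  [/\ uniq [:: a; b; c; d; e; f], adj a b, adj c d & adj e f]) (contains K2K2K2 G).
Proof.
apply: (iffP existsP) => [[v /andP[/injectiveP inj /forallP es]]|].
  have E i j (Hi : i < 6) (Hj : j < 6) : (i, j) \in pedges K2K2K2 ->
      adj (v (Ordinal Hi)) (v (Ordinal Hj)).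
    by move=> ij; have /forallP/(_ (Ordinal Hj))/implyP := es (Ordinal Hi); apply.
  pose o i (Hi : i < 6) := v (Ordinal Hi).
  have u : uniq (map v [:: Ordinal (isT : 0 < 6); Ordinal (isT : 1 < 6);
      Ordinal (isT : 2 < 6); Ordinal (isT : 3 < 6); Ordinal (isT : 4 < 6);
      Ordinal (isT : 5 < 6)]) by rewrite map_inj_uniq.
  by do 6!eexists; split; [exact: u|exact: E..].
case=> a [b [c [d [e [f [u ab cd ef]]]]]].
exists [ffun i : 'I_6 => nth a [:: a; b; c; d; e; f] i]; apply/andP; split.
  apply/injectiveP => i j; rewrite !ffunE => /eqP; rewrite nth_uniq //.
  by move/eqP/val_inj.
apply/forallP => i; apply/forallP => j; apply/implyP; rewrite !ffunE !inE !xpair_eqE.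
by case/or3P=> /andP[/eqP-> /eqP->].
Qed.

Lemma edges_disjoint2 (a b c d : G) : adj a b -> adj c d -> uniq [:: a; b; c; d] =
  [disjoint [set a; b] & [set c; d]].
Proof.
by move=> /adj_neq ab /adj_neq cd; rewrite disjoint_edges /= !inE !negb_or ab cd !andbT /= -!andbA.
Qed.

Lemma skel_sym e f g : skeleton_adj (link D e) f g = skeleton_adj (link D e) g f.
Proof. by rewrite /skeleton_adj /= eq_sym setUC. Qed.

Lemma matching_of_ends (ps : seq (G * G)) : {in ps, forall p, adj p.1 p.2} ->
  uniq (flatten [seq [:: p.1; p.2] | p <- ps]) ->
  exists F, [/\ F \in D, #|F| = size ps
    & forall f, f \in F -> f \in [seq [set p.1; p.2] | p <- ps]].
Proof.
elim: ps => [|[x y] ps IH] aps /=.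
  exists set0; rewrite cards0; split=> // [|f]; last by rewrite inE.
  by rewrite inE sub0set; apply/trivIsetP => A; rewrite inE.
rewrite inE negb_or -!andbA => /and4P[xy xps yps ups].
have xy_adj := aps _ (mem_head _ _).
have [|F [FD cF sF]] := IH _ ups; first by move=> p pps; apply: aps; rewrite inE pps orbT.
have [|H nF] := face_cons (mem_edges xy_adj) FD.
  move=> f /sF/mapP[p pps ->]; rewrite disjoint_edges.
  have ne z : z \notin flatten [seq [:: p.1; p.2] | p <- ps] -> (z != p.1) && (z != p.2).
    move=> zps; rewrite -negb_or; apply: contra zps => zp; apply/flattenP.
    by exists [:: p.1; p.2]; [exact: (map_f (fun p : G * G => [:: p.1; p.2]))|rewrite !inE].
  by have /andP[-> ->] := ne _ xps; have /andP[-> ->] := ne _ yps.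
exists ([set x; y] |: F); split=> // [|f]; first by rewrite cardsU1 nF cF.
by rewrite !inE => /orP[->//|/sF ->]; rewrite orbT.
Qed.

Lemma matching_of_K2K2K2 : contains K2K2K2 G -> exists2 F, F \in D & #|F| = 3.
Proof.
case/contains_K2K2K2P => a [b [c [d [e [f [u ab cd ef]]]]]].
have [||F [FD cF _]] := @matching_of_ends [:: (a, b); (c, d); (e, f)] => //; last by exists F.
by move=> p; rewrite !inE => /or3P[]/eqP->.
Qed.

Lemma edge_pair e x y : e \in edges G -> x \in e -> y \in e -> x != y ->
  e = [set x; y] /\ adj x y.
Proof.
case/edgesP=> a [b [ab ->]]; rewrite !inE => /orP[]/eqP-> /orP[]/eqP->; rewrite ?eqxx //.
by rewrite setUC adjC.
Qed.

Lemma disjoint_edgesP e f : e \in edges G -> f \in edges G -> [disjoint e & f] ->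
  exists a b c d, [/\ e = [set a; b], f = [set c; d], adj a b, adj c d & uniq [:: a; b; c; d]].
Proof.
case/edgesP=> a [b [ab ->]] /edgesP[c [d [cd ->]]] dj.
by exists a, b, c, d; split=> //; rewrite edges_disjoint2.
Qed.

Lemma face_le3 F : (forall a b c d e f g h : G, uniq [:: a; b; c; d; e; f; g; h] ->
    adj a b -> adj c d -> adj e f -> adj g h -> False) -> F \in D -> #|F| <= 3.
Proof.
move=> mx FD; rewrite leqNgt; apply/negP => F4.
have [|x|ps [sE aps ups]] := @matching_ends F (take 4 (enum F)) FD.
- by rewrite take_uniq ?enum_uniq.
- by move/mem_take; rewrite mem_enum.
have : size ps = 4.
  by rewrite -(size_map (fun p => [set p.1; p.2])) -sE size_takel // -cardE.
case: ps aps ups {sE} => [|[a b] [|[c d] [|[e f] [|[g h] [|]]]]] // aps ups _.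
by apply: mx ups (aps (a, b) _) (aps (c, d) _) (aps (e, f) _) (aps (g, h) _);
  rewrite !inE eqxx ?orbT.
Qed.

(** For connectedness, take [f] and [g] in the link of [e], with neighbours [f'] and [g']. If one of
    [f], [f'] is disjoint from one of [g], [g'], there is a path. Otherwise the four edges form a
    4-cycle, and the edge from [good_c4] is connected to both pairs. *)
Lemma good_buchsbaum2 : good G -> contains K2K2K2 G -> buchsbaum2 D.
Proof.
move=> gG c3; have [F3 F3D cF3] := matching_of_K2K2K2 c3.
have le3 F : F \in D -> #|F| <= 3 by apply: face_le3; exact: (good_max gG).
have ext e f : e \in edges G -> f \in edges G -> [disjoint e & f] ->
    exists2 g, g \in edges G & [disjoint e & g] && [disjoint f & g].
  move=> ee ef /(disjoint_edgesP ee ef)[a [b [c [d [-> -> ab cd u]]]]].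
  have [x [y [xy]]] := good_ext gG u ab cd.
  rewrite !inE !negb_or => /and4P[xa xb xc xd] /and4P[ya yb yc yd].
  exists [set x; y]; first exact: mem_edges.
  rewrite !disjoint_edges !(eq_sym _ x) !(eq_sym _ y).
  by rewrite xa xb xc xd ya yb yc yd.
split; first by apply/has_dimP; split; [exists F3|].
move=> e; rewrite face1 => ee.
have link_le F : F \in link D e -> #|F| <= 2.
  by rewrite inE => /and3P[_ ne /le3]; rewrite cardsU1 ne.
have nb f : [set f] \in link D e -> exists g, skeleton_adj (link D e) f g.
  rewrite link1 => /and3P[_ ef d]; have [g eg /andP[dg fg]] := ext e f ee ef d.
  by exists g; rewrite skelE ee ef eg d dg fg.
split.
  apply/has_dimP; split=> //.
  (* The two ends of [e] meet at most two of three disjoint edges. *)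
  have [f fF d] : exists2 f, f \in edges G & [disjoint e & f].
    case/contains_K2K2K2P: c3 => a [b [c [d [p [q [u ab cd pq]]]]]].
    case/edgesP: ee => x [y [xy ->]].
    have [H|] := boolP [disjoint [set x; y] & [set a; b]]; first by exists [set a; b]; rewrite ?mem_edges.
    have [H|] := boolP [disjoint [set x; y] & [set c; d]]; first by exists [set c; d]; rewrite ?mem_edges.
    have [H|] := boolP [disjoint [set x; y] & [set p; q]]; first by exists [set p; q]; rewrite ?mem_edges.
    rewrite !disjoint_edges; move: u; rewrite /= !inE.
    rewrite !negb_or !negb_and !negbK => u /or4P H1 /or4P H2 /or4P H3.
    by case: H1 => /eqP E1; case: H2 => /eqP E2; case: H3 => /eqP E3; subst;
      rewrite ?eqxx ?andbF in u.
  have [|g fg] := nb f; first by rewrite link1 ee fF d.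
  exists [set f; g]; first by case/andP: fg.
  by rewrite cards2; case/andP: fg => ->.
move=> f g Hf Hg; have [f' ff'] := nb f Hf; have [g' gg'] := nb g Hg.
have := ff'; have := gg'; rewrite !skelE => /and4P[_ eg eg' /and3P[deg deg' dgg']].
case/and4P => _ ef ef' /and3P[def def' dff'].
have skel p q : p \in edges G -> q \in edges G -> [disjoint e & p] -> [disjoint e & q] ->
    [disjoint p & q] -> skeleton_adj (link D e) p q.
  by move=> ep eq dp dq pq; rewrite skelE ee ep eq dp dq pq.
have [dfg|nfg] := boolP [disjoint f & g]; first by apply/connect1/skel.
have [df'g|nf'g] := boolP [disjoint f' & g].
  by apply: (connect_trans (connect1 ff')); apply/connect1/skel.
have [dfg'|nfg'] := boolP [disjoint f & g'].
  apply: connect_trans (connect1 (skel _ _ ef eg' def deg' dfg')) _.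
  by apply/connect1/skel; rewrite // disjoint_sym.
have [df'g'|nf'g'] := boolP [disjoint f' & g'].
  apply: (connect_trans (connect1 ff')).
  apply: connect_trans (connect1 (skel _ _ ef' eg' def' deg' df'g')) _.
  by apply/connect1/skel; rewrite // disjoint_sym.
have meet (A B : {set G}) : ~~ [disjoint A & B] -> exists2 z, z \in A & z \in B.
  by rewrite -setI_eq0 => /set0Pn[z]; rewrite inE => /andP[zA zB]; exists z.
(* The four intersections are the corners of the cycle [p], [q], [s], [r]. *)
have [p pf pg] := meet _ _ nfg; have [q qf qg'] := meet _ _ nfg'.
have [r rf' rg] := meet _ _ nf'g; have [s sf' sg'] := meet _ _ nf'g'.
have dis (A B : {set G}) x y : [disjoint A & B] -> x \in A -> y \in B -> x != y.
  by move=> AB xA yB; apply: contraTneq yB => <-; rewrite (disjointFr AB xA).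
have pq := dis _ _ _ _ dgg' pg qg'; have rs := dis _ _ _ _ dgg' rg sg'.
have pr := dis _ _ _ _ dff' pf rf'; have qs := dis _ _ _ _ dff' qf sf'.
have ps := dis _ _ _ _ dff' pf sf'; have qr := dis _ _ _ _ dff' qf rf'.
have [_ apq] := edge_pair ef pf qf pq; have [_ ars] := edge_pair ef' rf' sf' rs.
have [_ apr] := edge_pair eg pg rg pr; have [_ aqs] := edge_pair eg' qg' sg' qs.
have [a [b [ab eE]]] := edgesP _ ee.
have [ae be] : a \in e /\ b \in e by rewrite eE !inE !eqxx orbT.
have u : uniq [:: a; b; p; q; r; s].
  rewrite /= !inE !negb_or (adj_neq ab) pq pr ps qr qs rs !andbT.
  have nf z : z \in f -> (a != z) * (b != z) by move=> zf; split; exact: dis def _ zf.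
  have nf' z : z \in f' -> (a != z) * (b != z) by move=> zf; split; exact: dis def' _ zf.
  by rewrite !(nf p pf) !(nf q qf) !(nf' r rf') !(nf' s sf').
have [x [y [xy]]] := good_c4 gG u ab apq ars apr aqs.
rewrite !inE !negb_or => /and5P[xa xb xp xq /andP[xr xs]] /andP[ya yb].
have [fE _] := edge_pair ef pf qf pq; have [f'E _] := edge_pair ef' rf' sf' rs.
have [gE _] := edge_pair eg pg rg pr; have [g'E _] := edge_pair eg' qg' sg' qs.
have eh : [disjoint e & [set x; y]].
  by rewrite eE disjoint_edges !(eq_sym _ x) !(eq_sym _ y) xa xb ya yb.
(* As [x] is in neither edge and [y] in at most one of two disjoint edges, [xy] is disjoint from [k]
   or from [k']. *)
have via k k' : skeleton_adj (link D e) k k' -> x \notin k -> x \notin k' ->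
    connect (skeleton_adj (link D e)) k [set x; y].
  move=> kk' xk xk'; have := kk'; rewrite skelE => /and4P[_ ek ek' /and3P[dk dk' dkk']].
  have dh (z : {set G}) : x \notin z -> y \notin z -> [disjoint z & [set x; y]].
    by move=> xz yz; rewrite disjoint_sym disjoints_subset subUset !sub1set !inE xz yz.
  have [yk|yk] := boolP (y \in k); last by apply/connect1/skel => //; rewrite ?mem_edges ?dh.
  have yk' : y \notin k' by rewrite (disjointFr dkk' yk).
  by apply: connect_trans (connect1 kk') _; apply/connect1/skel => //; rewrite ?mem_edges ?dh.
apply: (connect_trans (via _ _ ff' _ _)).
- by rewrite fE !inE negb_or xp xq.
- by rewrite f'E !inE negb_or xr xs.
rewrite (sym_connect_sym (skel_sym e)).
apply: (via _ _ gg').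
- by rewrite gE !inE negb_or xp xr.
- by rewrite g'E !inE negb_or xq xs.
Qed.

Lemma buchsbaum2_good : buchsbaum2 D -> good G /\ contains K2K2K2 G.
Proof.
case=> /has_dimP[[F3 F3D cF3] le3] lk; split; last first.
  have [||ps [sE aps ups]] := @matching_ends F3 (enum F3) F3D; rewrite ?enum_uniq //.
    by move=> x; rewrite mem_enum.
  have : size ps = 3.
    by rewrite -(size_map (fun p => [set p.1; p.2])) -sE -cardE.
  case: ps aps ups {sE} => [|[a b] [|[c d] [|[e f] [|]]]] // aps ups _.
  apply/contains_K2K2K2P; exists a, b, c, d, e, f; split=> //.
  + by apply: (aps (a, b)); rewrite !inE eqxx.
  + by apply: (aps (c, d)); rewrite !inE eqxx orbT.
  + by apply: (aps (e, f)); rewrite !inE eqxx !orbT.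
split.
- move=> a b c d e f g h u ab cd ef gh.
  have [||F [FD cF _]] := @matching_of_ends [:: (a, b); (c, d); (e, f); (g, h)] => //.
    by move=> p; rewrite !inE => /or4P[]/eqP->.
  by have := le3 _ FD; rewrite cF.
- move=> a b c d u ab cd.
  have eE := mem_edges ab; have fE := mem_edges cd.
  have df : [disjoint [set a; b] & [set c; d]] by rewrite -edges_disjoint2.
  have [|/has_dimP[[F FL cF] _] con] := lk [set a; b]; first by rewrite face1.
  (* The link of [ab] has a face with two elements, so it has a vertex other than [cd]; the first
     step of a path from [cd] to it is the edge sought. *)
  have [g gF gf] : exists2 g, g \in F & g != [set c; d].
    apply/exists_inP; apply: contraLR isT; rewrite negb_exists_in => /forall_inP H.
    have /subset_leq_card : F \subset [set [set c; d]].
      by apply/subsetP => g /H; rewrite negbK inE.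
    by rewrite cF cards1.
  have [_ FD dF] := link_face FL.
  have gL : [set g] \in link D [set a; b].
    rewrite link1 eE dF // andbT /=; move: FD; rewrite inE => /andP[/subsetP H _]; exact: H.
  have fL : [set [set c; d]] \in link D [set a; b] by rewrite link1 eE fE df.
  have /connectP[[|h p] /= hp gE] := con _ _ fL gL.
  + by rewrite gE eqxx in gf.
  case/andP: hp => + _; rewrite skelE => /and4P[_ _ /edgesP[x [y [xy ->]]] /and3P[_ d1 d2]].
  exists x, y; move: d1 d2; rewrite !disjoint_edges !inE !negb_or.
  rewrite ![x == _]eq_sym ![y == _]eq_sym.
  by case/and4P=> -> -> -> -> /and4P[-> -> -> ->].
- move=> a b c d e f u ab cd ef ce df.
  case: (boolP [exists x, exists y, [&& adj x y, x \notin [:: a; b; c; d; e; f]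
      & y \notin [:: a; b]]]) => [/existsP[x /existsP[y /and3P[]]]|none]; first by exists x, y.
  have inW x y : adj x y -> x \notin [:: a; b] -> y \notin [:: a; b] -> x \in [:: c; d; e; f].
    move=> xy xab yab; apply: contraNT none => xW; apply/existsP; exists x; apply/existsP; exists y.
    by rewrite xy yab andbT; move: xab xW; rewrite !inE !negb_or => /andP[-> ->].
  exfalso; move: u; rewrite /= !inE !negb_or -!andbA.
  case/and5P=> u1 u2 u3 u4 /and5P[u5 u6 u7 u8 /and5P[u9 u10 u11 u12 /and4P[u13 u14 u15 _]]].
  have eE := mem_edges ab.
  have [|_ con] := lk [set a; b]; first by rewrite face1.
  have fL : [set [set c; d]] \in link D [set a; b].
    by rewrite link1 eE mem_edges // disjoint_edges u2 u3 u6 u7.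
  have gL : [set [set c; e]] \in link D [set a; b].
    by rewrite link1 eE mem_edges // disjoint_edges u2 u4 u6 u8.
  (* Every edge that avoids [a] and [b] now lies within the cycle, so in the link [cd] and [ef] have
     only each other as neighbours. This cuts them off from [ce]. *)
  have cl : closed (skeleton_adj (link D [set a; b])) [:: [set c; d]; [set e; f]].
    apply: (intro_closed (sym_connect_sym (@skel_sym _))) => z w.
    rewrite skelE => /and4P[_ _ /edgesP[x [y [xy ->]]] /and3P[_ dw dzw]] zZ.
    move: dw; rewrite disjoint_edges => /and4P[ax ay bx by_].
    have xW : x \in [:: c; d; e; f] by apply: (inW x y) => //; rewrite !inE !negb_or ![_ == a]eq_sym ![_ == b]eq_sym ?ax ?bx ?ay ?by_.
    have yW : y \in [:: c; d; e; f] by apply: (inW y x); rewrite 1?adjC //; rewrite !inE !negb_or ![_ == a]eq_sym ![_ == b]eq_sym ?ax ?bx ?ay ?by_.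
    move: zZ dzw (adj_neq xy); rewrite !inE => /orP[]/eqP->; rewrite disjoint_edges;
      case/and4P; rewrite ![_ == x]eq_sym ![_ == y]eq_sym => n1 n2 n3 n4;
      move: xW yW; rewrite !inE (negbTE n1) (negbTE n2) (negbTE n3) (negbTE n4) ?orbF /=;
      by case/orP=> /eqP-> /orP[]/eqP->; rewrite ?eqxx ?orbT // [[set _; _]]setUC eqxx ?orbT.
  have := closed_connect cl (con _ _ fL gL); rewrite !inE eqxx /= => /esym/orP[]/eqP E.
    have : e \in [set c; d] by rewrite -E !inE eqxx orbT.
    by rewrite !inE ![e == _]eq_sym (negbTE u11) (negbTE u13).
  have : c \in [set e; f] by rewrite -E !inE eqxx.
  by rewrite !inE (negbTE u11) (negbTE u12).
Qed.
End Matching.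

Lemma piece_buchsbaum2 (G : sgraph) (T : template) (f : nat -> G) :
  piece T [set: G] f -> template_ok T -> buchsbaum2 (matching_complex G).
Proof.
move=> pT okT; apply: good_buchsbaum2 (piece_good pT okT) _.
have [_ req _ _ _] := pT.
case/andP: okT => /andP[/andP[/allP rng _] m3] _.
have [ps [sz sub ups]] := has_matching_ends m3.
have rngs p : p \in ps -> [/\ p.1 < fam_size T, p.2 < fam_size T & adj (f p.1) (f p.2)].
  move=> /sub pR; have /rng/andP[-> ->] : p \in required T ++ optional T by rewrite mem_cat pR.
  by split=> //; apply: req; case: p pR.
have {}ups : uniq (ends ps).
  apply: ups; apply/allP => -[i j] ij; have /adj_neq := req _ _ ij.
  by apply: contraNneq => /= ->.
have injs : {in ends ps &, injective f}.
  suff H i : i \in ends ps -> i < fam_size T by move=> i j /H Hi /H Hj; exact: piece_inj pT Hi Hj.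
  by case/flattenP => _ /mapP[p /rngs[H1 H2 _] ->]; rewrite !inE => /orP[]/eqP->.
case: ps sz {sub} rngs ups injs => [|[a b] [|[c d] [|[e g] [|]]]] // _ rngs ups injs.
rewrite -(map_inj_in_uniq injs) in ups.
apply/contains_K2K2K2P; exists (f a), (f b), (f c), (f d), (f e), (f g); split=> //.
- by have [|] := rngs (a, b); rewrite ?inE ?eqxx.
- by have [|] := rngs (c, d); rewrite ?inE ?eqxx ?orbT.
- by have [|] := rngs (e, g); rewrite ?inE ?eqxx ?orbT.
Qed.


(** * Pieces and induced copies *)

Section Copies.
Variable G : sgraph.
Implicit Type A : {set G}.

(** An isomorphism from [H] onto the subgraph induced on [A]. With values in [G] itself, it avoids
    the subtype of vertices of [induced A]. *)
Definition copy (H : sgraph) A (h : H -> G) : Prop :=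
  [/\ injective h, forall x, h x \in A, forall y, y \in A -> exists x, y = h x
    & forall x y, adj (h x) (h y) = adj x y].

Lemma adj_induced A (u v : induced A) : adj u v = adj (val u) (val v).
Proof.
apply/andP/idP => [[_ /orP[|vu]] //|uv]; first by rewrite adjC.
by split; [apply: contraTneq uv => ->; rewrite adjxx|rewrite /= uv].
Qed.

Lemma induced_copyP A (H : sgraph) : isomorphic (induced A) H <-> exists h, @copy H A h.
Proof.
split=> [[g [g' gK g'K] gadj]|[h [inj hA surj hadj]]].
  exists (fun x => val (g' x)); split.
  - by move=> x y /val_inj /(can_inj g'K).
  - by move=> x; exact: valP.
  - by move=> y yA; exists (g (Sub y yA)); rewrite gK.
  - by move=> x y; rewrite -adj_induced -gadj !g'K.
have ex (u : induced A) : exists x, val u == h x.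
  by have [x ->] := surj _ (valP u); exists x.
pose g (u : induced A) := xchoose (ex u).
have hg u : h (g u) = val u by apply/esym/eqP/(xchooseP (ex u)).
pose g' (x : H) : induced A := Sub (h x) (hA x).
exists g; last by move=> u v; rewrite adj_induced -!hg hadj.
exists g' => [u|x]; first by apply: val_inj; rewrite /= hg.
by apply: inj; rewrite hg.
Qed.

Lemma iso_copyP (H : sgraph) : isomorphic G H <-> exists h, @copy H [set: G] h.
Proof.
split=> [[g [g' gK g'K] gadj]|[h [inj _ surj hadj]]].
  exists g'; split=> [|x|y _|x y]; rewrite ?inE //; first exact: can_inj g'K.
    by exists (g y); rewrite gK.
  by rewrite -gadj !g'K.
have ex u : exists x, u == h x by have [|x ->] := surj u; rewrite ?inE //; exists x.
pose g u := xchoose (ex u).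
have hg u : h (g u) = u by apply/esym/eqP/(xchooseP (ex u)).
exists g; last by move=> u v; rewrite -{2}(hg u) -{2}(hg v) hadj.
by exists h => [u|x]; [exact: hg|apply: inj; rewrite hg].
Qed.

Definition nonisolated A := forall x, x \in A -> exists2 y, y \in A & adj x y.

Definition family_ok (F : family) :=
  all (fun q => [&& q.1 < fam_size F, q.2 < fam_size F & q.1 != q.2])
    (required F ++ optional F) && all (gtn (fam_size F)) (unfilled F).

Section Family.
Variables (F : family) (okF : family_ok F).
Let n := fam_size F.

Lemma family_codes i j : (i, j) \in required F ++ optional F -> [/\ i < n, j < n & i != j].
Proof. by case/andP: okF => /allP H _ /H /and3P. Qed.

Lemma adj_member O k (N : 'I_k -> {set 'I_n}) (i j : 'I_n) : {subset O <= optional F} ->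
  @adj (member O N) (inl i) (inl j) = pmem (required F ++ O) i j.
Proof.
move=> sO; rewrite /= pmemE; apply: andb_idl.
have sub p : p \in required F ++ O -> p \in required F ++ optional F.
  by rewrite !mem_cat => /orP[->//|/sO ->]; rewrite orbT.
by case/orP=> /sub/family_codes[_ _ /eqP ne]; apply/eqP => -[] /(congr1 val) //= /esym.
Qed.

Lemma copy_piece O k (N : 'I_k -> {set 'I_n}) A (h : member O N -> G) (x0 : G) :
  {subset O <= optional F} ->
  (forall (i : 'I_k) (u : 'I_n), u \in N i -> val u \in unfilled F) ->
  copy A h -> piece (plain F) A (fun i => if insub i is Some j then h (inl j) else x0).
Proof.
move=> sO NU [inj hA surj hadj]; set f := fun i => _.
have fE i (Hi : i < n) : f i = h (inl (Ordinal Hi)) by rewrite /f insubT.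
have fP (j : 'I_n) : f j = h (inl j) by rewrite /f valK.
split.
- split; last by move=> x /mapP[i]; rewrite mem_iota => Hi ->; rewrite fE.
  rewrite map_inj_in_uniq ?iota_uniq // => i j; rewrite !mem_iota => Hi Hj.
  by rewrite !fE => /inj[].
- move=> i j ij; have [Hi Hj _] : [/\ i < n, j < n & i != j].
    by apply: family_codes; rewrite mem_cat ij.
  by rewrite !fE hadj adj_member //= pmemE mem_cat ij.
- move=> i j /= Hi Hj; rewrite !fE hadj adj_member // /listed !pmemE /= !mem_cat.
  case/orP=> /orP[->|/sO ->]; rewrite ?orbT //; by case: ifP.
- move=> x y xA yA xc xy; have [[i|i] xE] := surj _ xA.
    case/negP: xc; apply/mapP; exists (val i); last by rewrite fP.
    by rewrite mem_iota /= add0n ltn_ord.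
  have [[u|u] yE] := surj _ yA; last by move: xy; rewrite xE yE hadj => /andP[].
  exists (val u); last by rewrite fP.
  by apply: (NU i); move: xy; rewrite xE yE hadj.
- by [].
Qed.

(** The optional edges are those present in [G] and the new vertices are the vertices of [A] off the
    core. Their neighbourhoods are nonempty because no vertex is isolated in [A]. *)
Lemma piece_copy A f : nonisolated A -> piece (plain F) A f ->
  exists (O : seq (nat * nat)) (k : nat) (N : 'I_k -> {set 'I_n}) (h : member O N -> G),
    [/\ {subset O <= optional F}, forall i : 'I_k, N i != set0,
        forall (i : 'I_k) (u : 'I_n), u \in N i -> val u \in unfilled F & copy A h].
Proof.
move=> niA pf; have [[uc cA] req lst out _] := pf; set core := map f _ in uc cA out.
pose O := [seq q <- optional F | adj (f q.1) (f q.2)].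
pose R := [set x in A | x \notin core].
pose N (i : 'I_#|R|) := [set u : 'I_n | (val u \in unfilled F) && adj (enum_val i) (f u)].
have inR (i : 'I_#|R|) : enum_val i \in A /\ enum_val i \notin core.
  by have := enum_valP i; rewrite inE => /andP.
have injf i j : i < n -> j < n -> f i = f j -> i = j by exact: piece_inj pf.
have fc (i : 'I_n) : f i \in core by apply: map_f; rewrite mem_iota /= add0n ltn_ord.
pose h (z : member O N) := match z with inl i => f i | inr i => enum_val i end.
have sO : {subset O <= optional F} by move=> q; rewrite mem_filter => /andP[].
exists O, #|R|, N, h; split=> //.
- move=> i; have [xA xc] := inR i; have [y yA xy] := niA _ xA.
  have [u Hu yE] := out _ _ xA yA xc xy.
  have Hn : u < n by case/andP: okF => _ /allP; apply.
  by apply/set0Pn; exists (Ordinal Hn); rewrite inE /= Hu -yE.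
- by move=> i u; rewrite inE => /andP[].
have adj_out x y : x \in A -> y \in A -> x \notin core -> y \notin core -> adj x y = false.
  move=> xA yA xc yc; apply/negP => xy; have [u Hu yE] := out _ _ xA yA xc xy.
  case/negP: yc; rewrite yE; apply/mapP; exists u => //; rewrite mem_iota.
  by case/andP: okF => _ /allP; apply.
split.
- move=> [i|i] [j|j] /=.
  + by move/injf => E; congr inl; apply/val_inj/E.
  + by move=> E; have [_] := inR j; rewrite -E fc.
  + by move=> E; have [_] := inR i; rewrite E fc.
  + by move/enum_val_inj ->.
- by move=> [i|i] /=; [apply/cA/fc|case: (inR i)].
- move=> y yA; have [|yc] := boolP (y \in core).
    case/mapP=> i; rewrite mem_iota => Hi ->; by exists (inl (Ordinal (Hi : i < n))).
  have yR : y \in R by rewrite inE yA.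
  by exists (inr (enum_rank_in yR y)); rewrite /= enum_rankK_in.
have mix (i : 'I_#|R|) (j : 'I_n) : adj (enum_val i) (f j) = (j \in N i).
  rewrite inE; case: (boolP (adj _ _)) => [xy|_]; last by rewrite andbF.
  have [xA xc] := inR i; have [u Hu yE] := out _ _ xA (cA _ (fc j)) xc xy.
  have Hn : u < n by case/andP: okF => _ /allP; apply.
  by rewrite andbT [\val j](injf _ _ (ltn_ord j) Hn yE) Hu.
move=> [i|i] [j|j]; last 1 first.
- have [xA xc] := inR i; have [yA yc] := inR j; rewrite adj_out //.
  by apply/esym/negbTE/negP => /andP[].
- rewrite adj_member //=; apply/idP/idP => [ij|].
    have := lst _ _ (ltn_ord i) (ltn_ord j) ij.
    rewrite /listed /= !pmemE !mem_cat !mem_filter /= (adjC (f j)) ij /=.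
    by case: ((_, _) \in _); case: ((_, _) \in required F);
      case: ((_, _) \in optional F); case: ((_, _) \in optional F).
  rewrite pmemE !mem_cat !mem_filter /=.
  by case/orP=> /orP[/req|/andP[]] //; rewrite adjC.
- rewrite adjC mix; apply/idP/andP => [->//|[_ /orP[]//]].
- rewrite mix; apply/idP/andP => [->//|[_ /orP[]//]].
Qed.
End Family.
End Copies.


Section Pieces.
Variable G : sgraph.
Implicit Type A : {set G}.

Lemma in_family_induced A F (x0 : G) : family_ok F -> nonisolated A ->
  in_family F (induced A) <-> exists f, piece (plain F) A f.
Proof.
move=> okF niA; split=> [[O [k [N [sO N0 NU /induced_copyP[h hA]]]]]|[f pf]].
  by eexists; exact: (copy_piece okF x0 sO NU hA).
have [O [k [N [h [sO N0 NU hA]]]]] := piece_copy okF niA pf.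
by exists O, k, N; split=> //; apply/induced_copyP; exists h.
Qed.

Lemma in_familyP F (x0 : G) : family_ok F -> nonisolated [set: G] ->
  in_family F G <-> exists f, piece (plain F) [set: G] f.
Proof.
move=> okF niA; split=> [[O [k [N [sO N0 NU /iso_copyP[h hA]]]]]|[f pf]].
  by eexists; exact: (copy_piece okF x0 sO NU hA).
have [O [k [N [h [sO N0 NU hA]]]]] := piece_copy okF niA pf.
by exists O, k, N; split=> //; apply/iso_copyP; exists h.
Qed.

Section Fixed.
Variables (n : nat) (es : seq (nat * nat)) (H : sgraph) (c : 'I_n -> H).
Hypotheses (bij_c : bijective c)
  (adj_c : forall i j, adj (c i) (c j) = pmem es i j)
  (es_codes : all (fun q => (q.1 < n) && (q.2 < n)) es).
Let F := Family n es [::] [::].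

(** A family without optional edges and unfilled vertices has the single member [H], whose vertices
    [c] enumerates by their codes. This serves the triangle, the bowtie, the complete graph on four
    vertices and the 4-cycle. *)
Lemma copy_fixed A (h : H -> G) (x0 : G) : copy A h ->
  piece (plain F) A (fun i => if insub i is Some j then h (c j) else x0).
Proof.
case=> inj hA surj hadj; set f := fun i => _.
have fE i (Hi : i < n) : f i = h (c (Ordinal Hi)) by rewrite /f insubT.
have injc := bij_inj bij_c.
split=> //.
- split; last by move=> x /mapP[i]; rewrite mem_iota => Hi ->; rewrite fE.
  rewrite map_inj_in_uniq ?iota_uniq // => i j; rewrite !mem_iota => Hi Hj.
  by rewrite !fE => /inj/injc[].
- move=> i j ij; have /andP[/= Hi Hj] := allP es_codes _ ij.
  by rewrite !fE hadj adj_c pmemE ij.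
- by move=> i j /= Hi Hj; rewrite !fE hadj adj_c /listed /= => ->.
- move=> x y xA _ xc _; case/negP: xc; have [z ->] := surj _ xA.
  have [c' c'K cK'] := bij_c; rewrite -(cK' z); apply/mapP; exists (val (c' z)).
    by rewrite mem_iota /= add0n ltn_ord.
  by rewrite /f valK.
Qed.

Lemma fixed_copy A f : nonisolated A -> piece (plain F) A f ->
  exists h : H -> G, copy A h /\ forall i : 'I_n, h (c i) = f i.
Proof.
move=> niA pf; have [c' c'K cK'] := bij_c; exists (fun z => f (c' z)).
split; last by move=> i; rewrite c'K.
have [[uc cA] req lst out _] := pf.
split=> [x y /(piece_inj pf)|x|y yA|x y].
- move=> /(_ (ltn_ord _) (ltn_ord _)) E; apply: (can_inj cK').
  exact: val_inj.
- exact: (piece_mem pf).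
- have [|yc] := boolP (y \in [seq f i | i <- iota 0 n]).
    case/mapP=> i; rewrite mem_iota => Hi ->; exists (c (Ordinal (Hi : i < n))).
    by rewrite c'K.
  by have [z zA /(out _ _ yA zA yc)[]] := niA _ yA.
- rewrite -{2}(cK' x) -{2}(cK' y) adj_c; apply/idP/idP.
    by move/(lst _ _ (ltn_ord _) (ltn_ord _)); rewrite /listed /=; case: ifP.
  by rewrite pmemE => /orP[/req|/req] //; rewrite adjC.
Qed.
End Fixed.

Definition star_at A c :=
  [/\ c \in A, forall x, x \in A -> x != c -> adj c x
    & forall x y, x \in A -> y \in A -> adj x y -> x = c \/ y = c].

Lemma copy_star n A (h : star_graph n -> G) : copy A h ->
  star_at A (h ord0) /\ #|A| = n.+1.
Proof.
case=> inj hA surj hadj; split; first split=> //.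
- move=> x xA; have [i ->] := surj _ xA; rewrite hadj => ne.
  by apply/andP; split=> //; apply: contraNneq ne => <-.
- move=> x y xA yA; have [i ->] := surj _ xA; have [j ->] := surj _ yA.
  by rewrite hadj => /andP[_ /orP[]/eqP->]; [left|right].
have -> : A = [set h i | i in [set: 'I_n.+1]].
  apply/setP => x; apply/idP/imsetP => [/surj[i ->]|[i _ ->]//].
  by exists i; rewrite ?inE.
by rewrite card_imset // cardsT card_ord.
Qed.

Lemma star_copy A c n : star_at A c -> #|A| = n.+1 ->
  exists h : star_graph n -> G, copy A h /\ h ord0 = c.
Proof.
case=> cA cadj only cardA; pose s := c :: enum (A :\ c).
have szs : size s = n.+1.
  by rewrite /= -cardE; move: cardA; rewrite (cardsD1 c) cA add1n => -[->].
have us : uniq s by rewrite /= enum_uniq mem_enum !inE eqxx.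
have mems x : (x \in s) = (x \in A).
  by rewrite inE mem_enum !inE; case: eqP => // ->.
pose h (i : star_graph n) := nth c s (val i).
have lt (i : star_graph n) : val i < size s by rewrite szs; exact: ltn_ord.
exists h; split=> //; split.
- by move=> i j /eqP; rewrite nth_uniq // => /eqP/val_inj.
- by move=> i; rewrite -mems mem_nth.
- move=> y; rewrite -mems => ys; have Hy : index y s < n.+1 by rewrite -szs index_mem.
  by exists (Ordinal Hy); rewrite /h /= nth_index.
have hc i : (h i == c) = (i == ord0).
  by rewrite -[RHS]val_eqE /= -(nth_uniq c (lt i) (lt ord0) us).
have hA i : h i \in A by rewrite -mems mem_nth.
move=> i j; apply/idP/andP => [ij|[ne]].
  split; first by apply: contraTneq ij => ->; rewrite adjxx.
  by have [/eqP|/eqP] := only _ _ (hA i) (hA j) ij; rewrite hc /= => ->; rewrite ?orbT.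
move=> /orP[]/eqP E; subst.
  by apply: cadj; rewrite // hc eq_sym.
by rewrite adjC; apply: cadj; rewrite // hc.
Qed.

Lemma star_piece A c x : star_at A c -> x \in A -> x != c ->
  piece (plain star) A (nth c [:: c; x]).
Proof.
case=> cA cadj only xA xc; split=> //=.
- by rewrite !inE eq_sym xc; split=> // y; rewrite !inE => /orP[]/eqP->.
- by move=> i j; rewrite inE => /eqP[-> ->] /=; exact: cadj.
- by case=> [|[|i]] [|[|j]] //=; rewrite adjxx.
- move=> y z yA zA; rewrite !inE negb_or => /andP[yc yx] yz.
  by exists 0; rewrite ?inE //=; have [E|//] := only _ _ yA zA yz; rewrite E eqxx in yc.
Qed.

Lemma ray_piece A c p q : star_at A c -> p \in A -> q \in A -> uniq [:: p; c; q] ->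
  piece (plain ray) A (nth c [:: p; c; q]).
Proof.
case=> cA cadj only pA qA u; have := u; rewrite /= !inE !negb_or !andbT -andbA.
case/and3P=> pc pq cq; split=> //=.
- by split=> // y; rewrite !inE => /or3P[]/eqP->.
- move=> i j; rewrite !inE => /orP[]/eqP[-> ->] /=; last by apply: cadj; rewrite // eq_sym.
  by rewrite adjC; exact: cadj.
- have npq : adj p q = false.
    by apply/negP => /(only _ _ pA qA)[] E; rewrite E eqxx in pc cq.
  by case=> [|[|[|i]]] [|[|[|j]]] //=; rewrite ?adjxx ?npq // adjC npq.
- move=> y z yA zA; rewrite !inE !negb_or => /and3P[yp yc yq] yz.
  by exists 1; rewrite ?inE //=; have [E|//] := only _ _ yA zA yz; rewrite E eqxx in yc.
Qed.

(* [k] is the code of the center and the other codes are those of leaves. *)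
Lemma center_star_at F A f k : nonisolated A -> piece (plain F) A f ->
  optional F = [::] -> unfilled F = [:: k] -> k < fam_size F ->
  (forall i j, (i, j) \in required F -> i = k \/ j = k) ->
  (forall i, i < fam_size F -> i != k -> pmem (required F) k i) -> star_at A (f k).
Proof.
move=> niA pf opt unf Hk req1 req2; have [[uc cA] req lst out _] := pf.
have out' x y : x \in A -> y \in A -> x \notin [seq f i | i <- iota 0 (fam_size F)] ->
    adj x y -> y = f k.
  by move=> xA yA xc /(out _ _ xA yA xc)[u]; rewrite /= unf inE => /eqP->.
split; first exact: (piece_mem pf).
  move=> x xA xk; have [/mapP[i]|xc] := boolP (x \in [seq f i | i <- iota 0 (fam_size F)]).
    rewrite mem_iota => Hi xE; have ik : i != k by apply: contraNneq xk => <-; apply/eqP.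
    by have := req2 _ Hi ik; rewrite pmemE xE => /orP[/req|/req] //; rewrite adjC.
  by have [y yA xy] := niA _ xA; rewrite adjC -(out' _ _ xA yA xc xy).
move=> x y xA yA xy.
have [/mapP[i]|/out' H] := boolP (x \in [seq f i | i <- iota 0 (fam_size F)]); last by right; exact: H.
rewrite mem_iota => Hi xE.
have [/mapP[j]|/out' H] := boolP (y \in [seq f i | i <- iota 0 (fam_size F)]); last by left; apply: H => //; rewrite adjC.
rewrite mem_iota => Hj yE; have := lst _ _ Hi Hj; rewrite -xE -yE => /(_ xy).
rewrite /listed /= opt /=; case: ifP => //; rewrite pmemE.
by move=> /orP[]/req1[] E _; rewrite xE yE E; auto.
Qed.

Lemma piece_star A f : nonisolated A -> piece (plain star) A f -> star_at A (f 0).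
Proof.
move=> niA pf; apply: (center_star_at niA pf) => // [i j|i].
  by rewrite inE => /eqP[-> _]; left.
by case: i => [|[|i]].
Qed.

Lemma piece_ray A f : nonisolated A -> piece (plain ray) A f -> star_at A (f 1).
Proof.
move=> niA pf; apply: (center_star_at niA pf) => // [i j|i].
  by rewrite !inE => /orP[]/eqP[-> ->]; auto.
by case: i => [|[|[|i]]].
Qed.

Lemma complete_adj n (i j : complete_graph n) : adj i j = (i != j).
Proof. by apply/andP/idP => [[]|->]. Qed.

Lemma tri_codes n (c : 'I_n -> 'I_n) : n = 3 -> injective c -> 
  forall i j : 'I_n, @adj (complete_graph n) (c i) (c j) = pmem (required tri) i j.
Proof.
move=> n3; rewrite {}n3 in c * => inj i j; rewrite complete_adj (inj_eq inj).
by case: i j => [[|[|[|i]]] Hi] [[|[|[|j]]] Hj].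
Qed.

Lemma K3_or_star_induced A (x0 : G) : nonisolated A -> K3_or_star (induced A) <->
  (exists f, piece (plain tri) A f) \/ (exists f, piece (plain star) A f).
Proof.
move=> niA.
have b3 : bijective (fun i : 'I_3 => i) by exists id.
have a3 := tri_codes (c := fun i : 'I_3 => i) erefl (fun x y E => E).
split=> [[/induced_copyP[h hA]|[n n1 /induced_copyP[h /[dup] hA /copy_star[sA cA]]]]|].
- by left; eexists; exact: (copy_fixed (H := complete_graph 3) b3 a3 isT x0 hA).
- right; have : 0 < #|A :\ h ord0|.
    by move: cA; rewrite (cardsD1 (h ord0)); case: sA => -> _ _; rewrite add1n => -[->].
  case/card_gt0P=> x; rewrite !inE => /andP[xh xA].
  by eexists; exact: star_piece sA xA xh.
case=> [[f pf]|[f pf]].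
  by have [h [hA _]] := fixed_copy (H := complete_graph 3) b3 a3 niA pf; left; apply/induced_copyP; exists h.
have sA := piece_star niA pf; right.
have f1A : f 1 \in A by apply: (piece_mem pf).
have f10 : f 1 != f 0 by apply/eqP => /(piece_inj pf (i := 1) (j := 0)); move=> /(_ isT isT).
have c1 : 0 < #|A :\ f 0| by apply/card_gt0P; exists (f 1); rewrite !inE f10.
have cA : #|A| = (#|A|.-1).+1 by rewrite prednK // (cardsD1 (f 0)) addn_gt0 c1 orbT.
have [h [hA _]] := star_copy sA cA; exists #|A|.-1; last by apply/induced_copyP; exists h.
by rewrite (cardsD1 (f 0)); case: sA => -> _ _.
Qed.

Lemma bowtie_induced A (x0 : G) : nonisolated A ->
  isomorphic (induced A) bowtie <-> exists f, piece (plain bow) A f.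
Proof.
move=> niA.
have b5 : bijective (fun i : 'I_5 => i) by exists id.
have a5 (i j : 'I_5) : @adj bowtie i j = pmem (required bow) i j.
  by case: i j => [[|[|[|[|[|i]]]]] Hi] [[|[|[|[|[|j]]]]] Hj].
split=> [/induced_copyP[h hA]|[f pf]].
  by eexists; exact: (copy_fixed (c := fun i : 'I_5 => (i : bowtie)) b5 a5 isT x0 hA).
have [h [hA _]] := fixed_copy (c := fun i : 'I_5 => (i : bowtie)) b5 a5 niA pf.
by apply/induced_copyP; exists h.
Qed.

Definition petal_at A p := exists (H : sgraph) (x : H) (h : H -> G),
  [/\ petal x, copy A h & h x = p].

Lemma petal_atP A p : nonisolated A -> petal_at A p <->
  exists2 F, (F = tri \/ F = ray) & exists2 f, piece (plain F) A f & f 0 = p.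
Proof.
move=> niA; split=> [[H [x [h [px hA <-]]]]|[F HF [f pf <-]]].
  case: px h hA => [{}x|n {}x n2 x0] h hA.
    (* The transposition of 0 and [x], which gives the gluing vertex the code 0. *)
    pose c (i : 'I_3) : 'I_3 := if i == ord0 then x else if i == x then ord0 else i.
    have cK : involutive c.
      move=> i; rewrite /c; case: (eqVneq i ord0) => [->|i0].
        by case: (eqVneq (x : 'I_3) ord0) => [->|]; rewrite ?eqxx.
      by case: (eqVneq i x) => [->|ix]; rewrite ?eqxx // (negbTE i0) (negbTE ix).
    have bt : bijective c by exists c.
    have at_ := tri_codes (c := c) erefl (bij_inj bt).
    exists tri; first by left.
    eexists; first exact: (copy_fixed (H := complete_graph 3) bt at_ isT (h x) hA).
    rewrite /=; case: insubP => // i _ i0; have -> : i = ord0 by apply: val_inj; rewrite i0.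
    by rewrite /c eqxx.
  exists ray; first by right.
  have [sA cA] := copy_star hA; have [inj hin _ _] := hA.
  have hx : h x != h ord0 by rewrite (inj_eq inj).
  have : 0 < #|A :\ h ord0 :\ h x|.
    move: cA; rewrite (cardsD1 (h ord0)) (cardsD1 (h x) (A :\ _)) !inE hx !hin.
    rewrite !add1n => -[E]; by rewrite -ltnS E.
  case/card_gt0P=> y; rewrite !inE => /and3P[yx y0 yA].
  exists (nth (h ord0) [:: h x; h ord0; y]); last by [].
  by apply: ray_piece; rewrite //= !inE !negb_or hx (eq_sym _ y) yx (eq_sym _ y) y0.
case: HF pf => -> pf.
  have b3 : bijective (fun i : 'I_3 => i) by exists id.
  have a3 := tri_codes (c := fun i : 'I_3 => i) erefl (fun x y E => E).
  have [h [hA hE]] := fixed_copy (H := complete_graph 3) b3 a3 niA pf.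
  by exists (complete_graph 3), ord0, h; split; [constructor|exact: hA|exact: hE].
have sA := piece_ray niA pf.
have f0A : f 0 \in A by apply: (piece_mem pf).
have f2A : f 2 \in A by apply: (piece_mem pf).
have f01 : f 0 != f 1 by apply/eqP => /(piece_inj pf (i := 0) (j := 1)); move=> /(_ isT isT).
have f21 : f 2 != f 1 by apply/eqP => /(piece_inj pf (i := 2) (j := 1)); move=> /(_ isT isT).
have f02 : f 2 != f 0 by apply/eqP => /(piece_inj pf (i := 2) (j := 0)); move=> /(_ isT isT).
(* The center and two leaves are set aside, which shows that the star has at least two edges. *)
have cA : #|A| = (#|A :\ f 1 :\ f 0 :\ f 2|).+3.
  rewrite (cardsD1 (f 1)) (cardsD1 (f 0) (A :\ _)) (cardsD1 (f 2) (A :\ _ :\ _)).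
  by rewrite !inE f01 f21 f02 f0A f2A; case: sA => -> _ _.
have [h [hA h0]] := star_copy sA cA; have [_ _ surj _] := hA.
have [x xE] := surj _ f0A.
exists (star_graph (#|A :\ f 1 :\ f 0 :\ f 2|).+2), x, h; split=> //.
constructor=> //; by apply: contraNneq f01 => x0; rewrite xE x0 h0.
Qed.
End Pieces.


(** * Assembled templates as decompositions of the graph *)

Section Assemble.
Variables (n : nat) (bs : seq (seq nat * family)).
Let m := size bs.
Let block k := nth ([::], tri) bs k.
Let F k := (block k).2.
Let s k i := nth 0 (block k).1 i.
Let T := assemble n bs.

Definition unfilled_codes (b : seq nat * family) := [seq nth 0 b.1 i | i <- unfilled b.2].

(** What is needed to cut a member of the whole back into members of the blocks. A common unfilled
    code would leave open to which block an attached vertex belongs, and an edge from elsewhere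
    between two codes of a block would spoil that block. *)
Definition blocks_ok :=
  [&& all (fun b => [&& size b.1 == fam_size b.2, uniq b.1, all (gtn n) b.1
                      & family_ok b.2]) bs,
      all (fun i => has (fun b => i \in b.1) bs) (iota 0 n),
      all (fun k => all (fun l => (k == l) || ~~ has (mem (unfilled_codes (block k)))
                                   (unfilled_codes (block l))) (iota 0 m)) (iota 0 m)
    & all (fun b => all (fun i => all (fun j => listed T i j ==>
                     listed (plain b.2) (index i b.1) (index j b.1)) b.1) b.1) bs].

Lemma mem_assembled (A : eqType) (B : eqType) (g : seq nat -> A -> B) (P : family -> seq A) p :
  reflect (exists k q, [/\ k < m, q \in P (F k) & p = g (block k).1 q])
    (p \in flatten [seq [seq g b.1 q | q <- P b.2] | b <- bs]).
Proof.
apply: (iffP flattenP) => [[z /(nthP [::])[k]]|[k [q [Hk Hq ->]]]].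
  rewrite size_map => Hk <-; rewrite (nth_map ([::], tri)) // => /mapP[q Hq ->].
  by exists k, q.
exists [seq g (block k).1 q | q <- P (F k)]; last exact: map_f.
by apply/(nthP [::]); exists k; rewrite ?size_map // (nth_map ([::], tri)).
Qed.

Let ren b (q : code) := (nth 0 b q.1, nth 0 b q.2).

Lemma assembled_required p :
  reflect (exists k q, [/\ k < m, q \in required (F k) & p = (s k q.1, s k q.2)])
    (p \in required T).
Proof. exact: (mem_assembled ren). Qed.

Lemma assembled_optional p :
  reflect (exists k q, [/\ k < m, q \in optional (F k) & p = (s k q.1, s k q.2)])
    (p \in optional T).
Proof. exact: (mem_assembled ren). Qed.

Lemma assembled_unfilled u :
  reflect (exists k q, [/\ k < m, q \in unfilled (F k) & u = s k q]) (u \in unfilled T).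
Proof. exact: (mem_assembled (fun b => nth 0 b)). Qed.

Lemma listed_assembled k i j : k < m -> listed (plain (F k)) i j -> listed T (s k i) (s k j).
Proof.
move=> Hk.
have req q : q \in required (F k) -> (s k q.1, s k q.2) \in required T.
  by move=> Hq; apply/assembled_required; exists k, q.
have opt q : q \in optional (F k) -> (s k q.1, s k q.2) \in optional T.
  by move=> Hq; apply/assembled_optional; exists k, q.
rewrite /listed !pmemE; case: ifP => [/orP[]/req -> //|_ /orP[]/opt ->]; rewrite ?orbT //;
by case: ifP.
Qed.

Hypothesis okB : blocks_ok.

Lemma block_ok k : k < m ->
  [/\ size (block k).1 = fam_size (F k), uniq (block k).1,
      forall i, i < fam_size (F k) -> s k i < n & family_ok (F k)].
Proof.
move=> Hk; case/and4P: okB => /(all_nthP ([::], tri))/(_ k Hk)/and4P[/eqP sz u /allP lt okF] _ _ _.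
by split=> // i Hi; apply: lt; rewrite mem_nth // sz.
Qed.

Lemma code_block i : i < n -> exists k j, [/\ k < m, j < fam_size (F k) & i = s k j].
Proof.
move=> Hi; case/and4P: okB => _ /allP/(_ i); rewrite mem_iota => /(_ Hi) hb _ _.
have Hk := hb; rewrite has_find in Hk; have := nth_find ([::], tri) hb.
set k := find _ _ => ik; exists k, (index i (block k).1); split=> //.
  by case: (block_ok Hk) => <- _ _ _; rewrite index_mem.
by rewrite /s nth_index.
Qed.

Lemma unfilled_lt k u : k < m -> u \in unfilled (F k) -> u < fam_size (F k).
Proof. by case/block_ok=> _ _ _ /andP[_ /allP H] /H. Qed.

Lemma unfilled_block k l u v : k < m -> l < m -> u \in unfilled (F k) ->
  v \in unfilled (F l) -> s k u = s l v -> k = l.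
Proof.
move=> Hk Hl Hu Hv E; case/and4P: okB => _ _ /allP/(_ k) + _.
rewrite mem_iota => /(_ Hk)/allP/(_ l); rewrite mem_iota => /(_ Hl)/orP[/eqP//|/hasPn].
by move/(_ (s l v) (map_f _ Hv)); rewrite -E => /negP[]; apply: (map_f (s k)).
Qed.

Lemma listed_block k i j : k < m -> i < fam_size (F k) -> j < fam_size (F k) ->
  listed T (s k i) (s k j) -> listed (plain (F k)) i j.
Proof.
move=> Hk Hi Hj; have [sz u _ _] := block_ok Hk.
case/and4P: okB => _ _ _ /(all_nthP ([::], tri))/(_ k Hk).
move/allP/(_ (s k i)); rewrite mem_nth ?sz // => /(_ isT).
move/allP/(_ (s k j)); rewrite mem_nth ?sz // => /(_ isT)/implyP H /H.
by rewrite !index_uniq ?sz.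
Qed.

Section Decomposition.
Variable G : sgraph.

(** Parts that carry all the edges and overlap in shared core vertices only. Disjoint unions and
    gluings at a vertex are both of this kind. *)
Record decomposition (As : nat -> {set G}) (fs : nat -> nat -> G) : Prop := Decomposition {
  dec_piece : forall k, k < m -> piece (plain (F k)) (As k) (fs k);
  dec_edge : forall x y, adj x y -> exists k, [/\ k < m, x \in As k & y \in As k];
  dec_compat : forall k l i j, k < m -> l < m -> i < fam_size (F k) -> j < fam_size (F l) ->
    s k i = s l j -> fs k i = fs l j;
  dec_meet : forall k l x, k < m -> l < m -> k != l -> x \in As k -> x \in As l ->
    exists i j, [/\ i < fam_size (F k), j < fam_size (F l), s k i = s l j & x = fs k i]
}.

(** A code is realized in the first block that contains it, and [dec_compat] makes this choice
    immaterial. An outside vertex cannot see two vertices kept apart: it would lie in two parts,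
    which meet only inside the core. *)
Lemma assemble_piece As fs : decomposition As fs -> exists f, piece T [set: G] f.
Proof.
case=> pc ed compat meet.
pose f i := let k := find (fun b => i \in b.1) bs in fs k (index i (block k).1).
have fE k j : k < m -> j < fam_size (F k) -> f (s k j) = fs k j.
  move=> Hk Hj; have [sz u _ _] := block_ok Hk.
  have sb : s k j \in (block k).1 by rewrite mem_nth // sz.
  have hb : has (fun b => s k j \in b.1) bs by apply/(has_nthP ([::], tri)); exists k.
  have Hl := hb; rewrite has_find in Hl; have := nth_find ([::], tri) hb.
  rewrite /f; set l := find _ _ in Hl * => sl; apply: compat => //.
    by case: (block_ok Hl) => <- _ _ _; rewrite index_mem.
  by rewrite /s nth_index.
have inA i k : i < n -> k < m -> f i \in As k -> exists2 j, j < fam_size (F k) & i = s k j.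
  move=> Hi Hk; have [l [j [Hl Hj ->]]] := code_block Hi; rewrite fE // => jk.
  have [lk|lk] := eqVneq l k; first by exists j; rewrite -lk.
  have [a [b [Ha Hb ab E]]] := meet _ _ _ Hl Hk lk (piece_mem (pc _ Hl) Hj) jk.
  by exists b => //; rewrite (piece_inj (pc _ Hl) Hj Ha E).
have inj i j : i < n -> j < n -> f i = f j -> i = j.
  move=> Hi Hj E; have [k [a [Hk Ha iE]]] := code_block Hi.
  have [|b Hb jE] := inA j k Hj Hk; first by rewrite -E iE fE // (piece_mem (pc _ Hk)).
  by move: E; rewrite iE jE !fE // => /(piece_inj (pc _ Hk) Ha Hb) ->.
pose core := [seq f i | i <- iota 0 n].
have coreP k j : k < m -> j < fam_size (F k) -> fs k j \in core.
  move=> Hk Hj; rewrite -fE //; apply: map_f; rewrite mem_iota.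
  by case: (block_ok Hk) => _ _ lt _; exact: lt.
have out k x y : k < m -> x \in As k -> y \in As k -> x \notin core -> adj x y ->
    exists2 u, u \in unfilled (F k) & y = fs k u.
  move=> Hk xk yk xc xy; case: (pc _ Hk) => _ _ _ out _; apply: (out x) => //.
  by apply: contra xc => /mapP[i]; rewrite mem_iota => Hi ->; exact: coreP.
exists f; split.
- split; last by move=> x _; rewrite inE.
  by rewrite map_inj_in_uniq ?iota_uniq // => i j; rewrite !mem_iota; exact: inj.
- move=> i j /assembled_required[k [[a b] [Hk ab [-> ->]]]].
  have [_ _ _ okF] := block_ok Hk.
  have [Ha Hb _] : [/\ a < fam_size (F k), b < fam_size (F k) & a != b].
    by apply: (family_codes okF); rewrite mem_cat ab.
  by rewrite !fE //; case: (pc _ Hk) => _ H _ _ _; exact: H.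
- move=> i j Hi Hj ij; have [k [Hk ik jk]] := ed _ _ ij.
  have [a Ha iE] := inA _ _ Hi Hk ik; have [b Hb jE] := inA _ _ Hj Hk jk.
  move: ij; rewrite iE jE !fE // => ij; apply: listed_assembled => //.
  by case: (pc _ Hk) => _ _ H _ _; exact: H.
- move=> x y _ _ xc xy; have [k [Hk xk yk]] := ed _ _ xy.
  have [u Hu ->] := out _ _ _ Hk xk yk xc xy.
  exists (s k u); last by rewrite fE // (unfilled_lt Hk).
  by apply/assembled_unfilled; exists k, u.
- move=> x i j /= ij Hi Hj _ xc xi xj.
  have [k [Hk xk ik]] := ed _ _ xi; have [l [Hl xl jl]] := ed _ _ xj.
  have [u Hu iE] := out _ _ _ Hk xk ik xc xi; have [v Hv jE] := out _ _ _ Hl xl jl xc xj.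
  have {}iE : i = s k u.
    apply: inj => //; last by rewrite fE // (unfilled_lt Hk).
    by case: (block_ok Hk) => _ _ lt _; apply/lt/(unfilled_lt Hk).
  have {}jE : j = s l v.
    apply: inj => //; last by rewrite fE // (unfilled_lt Hl).
    by case: (block_ok Hl) => _ _ lt _; apply/lt/(unfilled_lt Hl).
  have kl : k = l.
    apply/eqP/negP => /negP kl; have [a [b [Ha _ _ xE]]] := meet _ _ _ Hk Hl kl xk xl.
    by case/negP: xc; rewrite xE coreP.
  move: ij; rewrite mem_filter => /andP[/andP[_]] + _; rewrite -all_predC.
  move/(all_nthP ([::], tri))/(_ k Hk) => /=; rewrite iE jE -kl negb_and.
  by case/orP=> /negP[]; [|rewrite kl in Hk *]; exact: (map_f (s _)).
Qed.

(** Part [k] consists of the core of block [k] and of the outside vertices attached to its unfilled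
    vertices. By [apart], an outside vertex is attached to one block only. *)
Lemma piece_assemble f : nonisolated [set: G] -> piece T [set: G] f ->
  exists As fs, decomposition As fs.
Proof.
move=> ni pf; have [[uc _] req lst out ap] := pf.
pose fs k i := f (s k i); pose core := [seq f i | i <- iota 0 n].
pose As k := [set x | (x \in [seq f i | i <- (block k).1]) ||
  (x \notin core) && has (fun u => adj x (fs k u)) (unfilled (F k))].
exists As, fs.
have lt k i : k < m -> i < fam_size (F k) -> s k i < n by case/block_ok=> _ _ H _; exact: H.
have inB k i : k < m -> i < fam_size (F k) -> s k i \in (block k).1.
  by move=> Hk Hi; have [sz _ _ _] := block_ok Hk; rewrite mem_nth ?sz.
have Bin k i : k < m -> i \in (block k).1 -> exists2 j, j < fam_size (F k) & i = s k j.
  move=> Hk ik; have [sz _ _ _] := block_ok Hk; exists (index i (block k).1).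
    by rewrite -sz index_mem.
  by rewrite /s nth_index.
have fcore k i : k < m -> i < fam_size (F k) -> f (s k i) \in core.
  by move=> Hk Hi; apply: map_f; rewrite mem_iota lt.
have apart_uv k l u v x : k < m -> l < m -> u \in unfilled (F k) -> v \in unfilled (F l) ->
    x \notin core -> adj x (fs k u) -> adj x (fs l v) -> k = l.
  (* [apart] lists each pair in increasing order only, so this order is assumed first. *)
  have gen k' l' u' v' : k' < m -> l' < m -> u' \in unfilled (F k') -> v' \in unfilled (F l') ->
      x \notin core -> adj x (fs k' u') -> adj x (fs l' v') -> s k' u' < s l' v' -> k' = l'.
    move=> Hk Hl Hu Hv xc xu xv uv; apply/eqP/negP => /negP kl.
    apply: (ap x (s k' u') (s l' v')) => //; rewrite ?inE ?lt ?unfilled_lt //.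
    rewrite mem_filter /= uv; apply/andP; split.
      rewrite -all_predC; apply/(all_nthP ([::], tri)) => j Hj /=.
      apply/negP => /andP[/mapP[a Ha E1] /mapP[b Hb E2]].
      have E1' := unfilled_block Hk Hj Hu Ha E1; have E2' := unfilled_block Hl Hj Hv Hb E2.
      by rewrite E1' E2' eqxx in kl.
    by apply/allpairsP; exists (s k' u', s l' v'); split=> //; apply/assembled_unfilled; [exists k', u'|exists l', v'].
  move=> Hk Hl Hu Hv xc xu xv; case: (ltngtP (s k u) (s l v)) => [uv|vu|].
  - exact: (gen k l u v).
  - by apply/esym; apply: (gen l k v u).
  - exact: unfilled_block.
split.
- move=> k Hk; have [sz ub _ _] := block_ok Hk.
  have coreE : [seq fs k i | i <- iota 0 (fam_size (F k))] = [seq f i | i <- (block k).1].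
    apply: (@eq_from_nth _ (f 0)); rewrite ?size_map ?size_iota // => i Hi.
    by rewrite (nth_map 0) ?size_iota // (nth_map 0) ?sz // nth_iota.
  split.
  + rewrite /= coreE; split; last by move=> x xB; rewrite inE xB.
    rewrite map_inj_in_uniq // => i j /(Bin _ _ Hk)[a Ha ->] /(Bin _ _ Hk)[b Hb ->].
    by move/(piece_inj pf); apply; apply: lt.
  + by move=> i j ij; apply: req; apply/assembled_required; exists k, (i, j).
  + move=> i j /= Hi Hj ij; apply: (listed_block Hk) => //.
    by apply: lst => //; apply: lt.
  + move=> x y; rewrite /= coreE !inE => + _ xB xy; rewrite (negbTE xB) /=.
    case/andP=> xc /hasP[u Hu xu]; have [||||v Hv yE] := out x y; rewrite ?inE //.
    have /assembled_unfilled[l [w [Hl Hw vE]]] := Hv; exists w; last first.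
      by rewrite yE vE (apart_uv k l u w x) // /fs -vE -yE.
    by rewrite (apart_uv k l u w x) // /fs -vE -yE.
  + by [].
- move=> x y xy.
  have mixed x' y' : adj x' y' -> x' \notin core ->
      exists k, [/\ k < m, x' \in As k & y' \in As k].
    move=> xy' xc; have [||||v Hv yE] := out x' y'; rewrite ?inE //.
    have /assembled_unfilled[l [w [Hl Hw vE]]] := Hv; exists l; split=> //; rewrite inE.
      by rewrite xc; apply/orP; right; apply/hasP; exists w; rewrite // /fs -vE -yE.
    by rewrite yE vE map_f // inB // unfilled_lt.
  have [xc|xc] := boolP (x \in core); last exact: mixed.
  have [yc|yc] := boolP (y \in core); last first.
    by have [|k [Hk ? ?]] := mixed y x _ yc; [rewrite adjC|exists k].
  case/mapP: xc yc xy => i; rewrite mem_iota => Hi -> /mapP[j]; rewrite mem_iota => Hj -> ij.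
  have same k a b : k < m -> (a, b) \in required (F k) ++ optional (F k) ->
      f (s k a) \in As k /\ f (s k b) \in As k.
    move=> Hk ab; have [_ _ _ okF] := block_ok Hk.
    have [Ha Hb _] := family_codes okF ab.
    by rewrite !inE (map_f f (inB k a Hk Ha)) (map_f f (inB k b Hk Hb)).
  have := lst _ _ Hi Hj ij; rewrite /listed !pmemE.
  by case: ifP => [/orP[]/assembled_required|_ /orP[]/assembled_optional];
    case=> k [[a b] [Hk ab [-> ->]]]; exists k;
    have [|H1 H2] := same k a b Hk; rewrite ?mem_cat ?ab ?orbT.
- by move=> k l i j _ _ _ _ E; rewrite /fs E.
- move=> k l x Hk Hl kl; rewrite !inE.
  have [xc|xc] := boolP (x \in core); rewrite ?orbF /=; last first.
    have nB j : j < m -> x \notin [seq f i | i <- (block j).1].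
      move=> Hj; apply: contra xc => /mapP[i /(Bin _ _ Hj)[a Ha ->] ->]; exact: fcore.
    rewrite !(negbTE (nB _ _)) //= => /hasP[u Hu xu] /hasP[v Hv xv].
    by rewrite (apart_uv k l u v x) ?eqxx in kl.
  move=> /mapP[i /(Bin _ _ Hk)[a Ha ->] xE] /mapP[j /(Bin _ _ Hl)[b Hb ->] xE'].
  exists a, b; split=> //; apply: (piece_inj pf); rewrite ?lt //.
  by rewrite -xE -xE'.
Qed.
End Decomposition.
End Assemble.


(** * Connected components as blocks *)

Section Components.
Variable G : sgraph.

Definition comp_set (x : G) := [set y | connect adj x y].

Definition transversal_of_components (xs : seq G) : Prop :=
  [/\ uniq xs, forall w, exists2 x, x \in xs & connect adj x w
    & forall x y, x \in xs -> y \in xs -> connect adj x y -> x = y].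

Lemma connC : connect_sym (@adj G).
Proof. by apply: sym_connect_sym => x y; exact: adj_sym. Qed.

Lemma num_components_transversal xs :
  transversal_of_components xs -> num_components G = size xs.
Proof.
case=> u cov sep; rewrite /num_components /n_comp_mem.
have <- : size (map (root adj) xs) = size xs by rewrite size_map.
have ur : uniq (map (root adj) xs).
  rewrite map_inj_in_uniq // => x y xs_x xs_y /eqP.
  by rewrite (root_connect connC); exact: sep.
rewrite -(card_uniqP ur); apply: eq_card => w; rewrite !inE andbT.
apply/idP/mapP => [/eqP rw|[x _ ->]]; last by rewrite roots_root //; exact: connC.
have [x xs_x xw] := cov w; exists x => //; rewrite -{1}rw; apply/eqP.
by rewrite (root_connect connC) connC.
Qed.

Lemma ex_transversal : exists2 xs, transversal_of_components xs & size xs = num_components G.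
Proof.
exists (enum (roots (@adj G))).
  split; first exact: enum_uniq.
    move=> w; exists (root adj w); last by rewrite connC connect_root.
    by rewrite mem_enum; exact: (roots_root connC).
  move=> x y; rewrite !mem_enum => /eqP rx /eqP ry.
  by rewrite -(root_connect connC) rx ry => /eqP.
by rewrite -cardE /num_components /n_comp_mem; apply: eq_card => w; rewrite !inE andbT.
Qed.

(** An earlier neighbour for every code but 0 gives connectedness by induction on codes; the last
    clause serves [decomposition_nonisolated]. *)
Definition connected_family (F : family) :=
  [&& 0 < fam_size F,
      all (fun i => has (fun j => pmem (required F) i j) (iota 0 i)) (iota 1 (fam_size F).-1)
    & all (fun i => has (fun j => pmem (required F) i j) (iota 0 (fam_size F)))
          (iota 0 (fam_size F))].

Lemma pmem_required_adj T A (f : nat -> G) i j : piece T A f ->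
  pmem (required T) i j -> adj (f i) (f j).
Proof. by case=> _ req _ _ _; rewrite pmemE => /orP[/req|/req] //; rewrite adjC. Qed.

Lemma piece_connect F A (f : nat -> G) : connected_family F -> family_ok F -> nonisolated A ->
  piece (plain F) A f -> forall x, x \in A -> connect adj (f 0) x.
Proof.
case/and3P=> n0 /allP cn _ okF niA pf.
have core i : i < fam_size F -> connect adj (f 0) (f i).
  elim/ltn_ind: i => -[|i] IH Hi; first exact: connect0.
  have /hasP[j] : has (fun j => pmem (required F) i.+1 j) (iota 0 i.+1).
    by apply: cn; rewrite mem_iota add1n prednK.
  rewrite mem_iota => /andP[_ Hj] ij.
  apply: (connect_trans (IH j Hj (ltn_trans Hj Hi))).
  by apply: connect1; rewrite adjC; exact: (pmem_required_adj pf).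
move=> x xA; have [/mapP[i]|xc] := boolP (x \in [seq f i | i <- iota 0 (fam_size F)]).
  by rewrite mem_iota => Hi ->; exact: core.
have [y yA xy] := niA _ xA; have [_ _ _ out _] := pf.
have [u Hu yE] := out _ _ xA yA xc xy.
apply: (@connect_trans _ _ y); last by apply: connect1; rewrite adjC.
by rewrite yE; apply: core; case/andP: okF => _ /allP; apply.
Qed.
End Components.

Section AssembledComponents.
Variables (n : nat) (bs : seq (seq nat * family)) (G : sgraph) (x0 : G).
Hypotheses (okB : blocks_ok n bs) (niG : no_isolated G).
Let m := size bs.
Let block k := nth ([::], tri) bs k.
Let F k := (block k).2.
Let s k i := nth 0 (block k).1 i.

Lemma no_isolated_setT : nonisolated [set: G].
Proof. by move=> x _; have [y xy] := niG x; exists y; rewrite ?inE. Qed.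

Hypothesis connF : all (fun b => connected_family b.2) bs.

Let conn k : k < m -> connected_family (F k).
Proof. by move=> Hk; exact: (all_nthP ([::], tri) connF). Qed.

Lemma decomposition_nonisolated As fs k : decomposition bs As fs -> k < m ->
  @nonisolated G (As k).
Proof.
move=> dec Hk x xA; have pk := dec_piece dec Hk.
have [/mapP[i]|xc] := boolP (x \in [seq fs k i | i <- iota 0 (fam_size (F k))]).
  have /and3P[_ _ /allP cv] := conn Hk => iI ->; have /hasP[j] := cv _ iI.
  rewrite mem_iota => Hj ij; exists (fs k j); first exact: (piece_mem pk).
  exact: (pmem_required_adj pk ij).
have [y xy] := niG x; have [l [Hl xl yl]] := dec_edge dec xy.
have [E|kl] := eqVneq k l; first by exists y; rewrite ?E.
have [i [j [Hi _ _ xE]]] := dec_meet dec Hk Hl kl xA xl.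
by case/mapP: xc; exists i; rewrite // mem_iota.
Qed.

Lemma decomposition_cover As fs (x : G) : decomposition bs As fs -> exists2 k, k < m & x \in As k.
Proof. by move=> dec; have [y xy] := niG x; have [k [Hk xk _]] := dec_edge dec xy; exists k. Qed.

Hypothesis disj_codes : forall k l i j, k < m -> l < m -> i < fam_size (F k) ->
  j < fam_size (F l) -> s k i = s l j -> k = l.

Let code_inj k i j : k < m -> i < fam_size (F k) -> j < fam_size (F k) -> s k i = s k j -> i = j.
Proof.
move=> Hk Hi Hj /eqP; have [sz u _ _] := block_ok okB Hk.
by rewrite nth_uniq ?sz // => /eqP.
Qed.

(** When blocks share no code, the parts of a decomposition are disjoint and connected, and every
    edge lies within one of them, so they are the components. Conversely the components form a
    decomposition. *)
Lemma components_assemble : (exists f, piece (assemble n bs) [set: G] f) <->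
  exists xs, [/\ transversal_of_components xs, size xs = m
    & forall k, k < m -> exists f, piece (plain (F k)) (comp_set (nth x0 xs k)) f].
Proof.
split=> [[f pf]|[xs [[u cov sep] sz pc]]].
  have [As [fs dec]] := piece_assemble okB no_isolated_setT pf.
  have disjA k l x : k < m -> l < m -> x \in As k -> x \in As l -> k = l.
    move=> Hk Hl xk xl; apply/eqP/negP => /negP kl.
    have [i [j [Hi Hj E _]]] := dec_meet dec Hk Hl kl xk xl.
    by rewrite (disj_codes Hk Hl Hi Hj E) eqxx in kl.
  have clA k x y : k < m -> connect adj x y -> x \in As k -> y \in As k.
    move=> Hk xy xk; suff cl : closed adj (As k) by rewrite -(closed_connect cl xy).
    apply: (intro_closed (@connC G)) => a b ab ak; have [l [Hl al bl]] := dec_edge dec ab.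
    by rewrite (disjA k l a).
  have cA k : k < m -> comp_set (fs k 0) = As k.
    move=> Hk; have pk := dec_piece dec Hk; have f0 : fs k 0 \in As k.
      by apply: (piece_mem pk); case/and3P: (conn Hk).
    apply/setP => x; rewrite inE; apply/idP/idP => [c|xk]; first exact: clA c f0.
    have [_ _ _ okF] := block_ok okB Hk.
    exact: (piece_connect (conn Hk) okF (decomposition_nonisolated dec Hk) pk).
  pose xs := [seq fs k 0 | k <- iota 0 m].
  have nx k : k < m -> nth x0 xs k = fs k 0.
    by move=> Hk; rewrite (nth_map 0) ?size_iota // nth_iota.
  exists xs; split; [split|by rewrite size_map size_iota|].
  - rewrite map_inj_in_uniq ?iota_uniq // => k l; rewrite !mem_iota => Hk Hl E.
    apply: (disjA k l (fs k 0)) => //; rewrite -cA // inE ?E; exact: connect0.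
  - move=> w; have [k Hk wk] := decomposition_cover w dec.
    exists (fs k 0); first by apply/mapP; exists k; rewrite ?mem_iota.
    by move: wk; rewrite -cA // inE.
  - move=> x y /mapP[k]; rewrite mem_iota => Hk -> /mapP[l]; rewrite mem_iota => Hl -> c.
    rewrite (disjA k l (fs l 0)) // -cA // inE //; exact: connect0.
  - by move=> k Hk; exists (fs k); rewrite nx // cA //; exact: (dec_piece dec).
pose As k := comp_set (nth x0 xs k).
have nxs k : k < m -> nth x0 xs k \in xs by move=> Hk; rewrite mem_nth ?sz.
have disjA k l x : k < m -> l < m -> x \in As k -> x \in As l -> k = l.
  move=> Hk Hl; rewrite !inE => xk xl; apply/eqP; rewrite -(nth_uniq x0 _ _ u) ?sz //.
  by apply/eqP/sep; rewrite ?nxs //; apply: connect_trans xk _; rewrite connC.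
(* A finite choice, made by induction on the number of blocks. *)
have [fs pfs] : exists fs : nat -> nat -> G, forall k, k < m -> piece (plain (F k)) (As k) (fs k).
  elim: m pc => [|q IH] pc; first by exists (fun _ _ => x0).
  have [|fs pfs] := IH; first by move=> k /ltnW; exact: pc.
  have [f pf] := pc q (leqnn _); exists (fun k => if k == q then f else fs k) => k.
  by rewrite ltnS leq_eqVlt; case: eqP => [->//|_ /= /pfs].
apply: (assemble_piece okB (As := As) (fs := fs)); split=> //.
- move=> x y xy; have [z zx zc] := cov x.
  have Hk : index z xs < m by rewrite -sz index_mem.
  exists (index z xs); rewrite !inE nth_index //; split=> //.
  by apply: connect_trans zc _; exact: connect1.
- move=> k l i j Hk Hl Hi Hj E; have kl := disj_codes Hk Hl Hi Hj E; subst l.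
  by rewrite (code_inj Hk Hi Hj E).
- by move=> k l x Hk Hl kl xk xl; rewrite (disjA k l x) ?eqxx in kl.
Qed.
End AssembledComponents.


(** * Gluing at a vertex *)

Section Glue.
Variables (G H1 H2 : sgraph) (x : H1) (y : H2).
Implicit Type A : {set G}.

Definition glued A A1 A2 p := [/\ A = A1 :|: A2, A1 :&: A2 = [set p]
  & forall u v, u \in A1 -> v \in A2 -> adj u v -> u = p \/ v = p].

Lemma copy_image (H : sgraph) (h : H -> G) : injective h ->
  (forall a b, adj (h a) (h b) = adj a b) -> copy (h @: [set: H]) h.
Proof.
move=> inj hadj; split=> // [a|b /imsetP[a _ ->]]; last by exists a.
exact: imset_f.
Qed.

Lemma glue_ll (u v : H1) : @adj (glue x y) (inl u) (inl v) = adj u v.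
Proof.
apply/andP/idP => [[_ /orP[|]] //|uv]; first by rewrite adjC.
by split; [apply: contraTneq uv => -[->]; rewrite adjxx|rewrite /= uv].
Qed.

Lemma glue_rr (u v : {z : H2 | z != y}) :
  @adj (glue x y) (inr u) (inr v) = adj (val u) (val v).
Proof.
apply/andP/idP => [[_ /orP[|]] //|uv]; first by rewrite adjC.
by split; [apply: contraTneq uv => -[->]; rewrite adjxx|rewrite /= uv].
Qed.

Lemma glue_lr (u : H1) (v : {z : H2 | z != y}) :
  @adj (glue x y) (inl u) (inr v) = (u == x) && adj y (val v).
Proof. by apply/andP/idP => [[_ /orP[]]|-> //]. Qed.

Lemma copy_glue A (h : glue x y -> G) : copy A h -> exists A1 A2 (h1 : H1 -> G) (h2 : H2 -> G),
  [/\ copy A1 h1, copy A2 h2, h1 x = h (inl x), h2 y = h (inl x) & glued A A1 A2 (h (inl x))].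
Proof.
case=> inj hA surj hadj.
pose h1 a := h (inl a).
(* The vertex [y] is absent from the second summand of [glue x y]; it is represented there by
   [x]. *)
pose h2 b := if insub b is Some c then h (inr c) else h (inl x).
have h2y : h2 y = h (inl x) by rewrite /h2 insubF // eqxx.
have h2E (c : {z : H2 | z != y}) : h2 (val c) = h (inr c) by rewrite /h2 valK.
have split2 b : b = y \/ exists c : {z : H2 | z != y}, b = val c.
  by case: (eqVneq b y) => [->|by_]; [left|right; exists (Sub b by_)].
exists (h1 @: [set: H1]), (h2 @: [set: H2]), h1, h2; split=> //.
- apply: copy_image => [a b /inj[] //|a b]; by rewrite hadj glue_ll.
- apply: copy_image => [a b|a b].
    case: (split2 a) (split2 b) => [->|[c ->]] [->|[d ->]]; rewrite ?h2y ?h2E // => /inj //.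
    by case=> ->.
  case: (split2 a) (split2 b) => [->|[c ->]] [->|[d ->]]; rewrite ?h2y ?h2E ?hadj.
  + by rewrite glue_ll !adjxx.
  + by rewrite glue_lr eqxx.
  + by rewrite adjC glue_lr eqxx adjC.
  + by rewrite glue_rr.
split.
- apply/setP => z; rewrite inE; apply/idP/orP => [/surj[[a|c] ->]|].
  + by left; apply: imset_f.
  + by right; rewrite -h2E imset_f.
  + case=> /imsetP[a _ ->]; first exact: hA.
    by case: (split2 a) => [->|[c ->]]; rewrite ?h2y ?h2E.
- apply/setP => z; rewrite !inE; apply/andP/eqP => [[/imsetP[a _ ->] /imsetP[b _]]|->].
    case: (split2 b) => [->|[c ->]]; first by rewrite h2y.
    by rewrite h2E => /inj.
  by split; [exact: imset_f|rewrite -h2y imset_f].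
- move=> u v /imsetP[a _ ->] /imsetP[b _ ->]; case: (split2 b) => [->|[c ->]]; first by rewrite h2y; right.
  by rewrite h2E hadj glue_lr => /andP[/eqP-> _]; left.
Qed.

Lemma glue_copy A A1 A2 p (h1 : H1 -> G) (h2 : H2 -> G) : copy A1 h1 -> copy A2 h2 ->
  h1 x = p -> h2 y = p -> glued A A1 A2 p ->
  exists h : glue x y -> G, copy A h /\ h (inl x) = p.
Proof.
move=> [inj1 hA1 surj1 adj1] [inj2 hA2 surj2 adj2] h1x h2y [-> I E].
pose h (z : glue x y) := match z with inl a => h1 a | inr b => h2 (val b) end.
have sep a (b : {z : H2 | z != y}) : h1 a <> h2 (val b).
  move=> ab; have : h1 a \in A1 :&: A2 by rewrite inE hA1 ab hA2.
  rewrite I inE => /eqP ap; case/negP: (valP b); apply/eqP/inj2.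
  by rewrite h2y -ab ap.
have lr a (b : {z : H2 | z != y}) : adj (h1 a) (h2 (val b)) = @adj (glue x y) (inl a) (inr b).
  rewrite glue_lr; apply/idP/andP => [ab|[/eqP-> yb]]; last by rewrite h1x -h2y adj2.
  have [ap|bp] := E _ _ (hA1 a) (hA2 (val b)) ab; last by case: (sep x b); rewrite bp.
  have ax : a = x by apply: inj1; rewrite ap.
  by rewrite ax eqxx -adj2 h2y -h1x -ax.
exists h; split=> //; split.
- move=> [a|a] [b|b] /=.
  + by move/inj1->.
  + by move/sep.
  + by move/esym/sep.
  + by move/inj2/val_inj->.
- by move=> [a|a]; rewrite inE /= ?hA1 ?hA2 ?orbT.
- move=> z; rewrite inE => /orP[/surj1[a ->]|/surj2[b ->]]; first by exists (inl a).
  have [->|by_] := eqVneq b y; first by exists (inl x); rewrite /= h1x h2y.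
  by exists (inr (Sub b by_)).
- move=> [a|a] [b|b].
  + by rewrite glue_ll adj1.
  + exact: lr.
  + by rewrite adjC [RHS]adjC; exact: lr.
  + by rewrite glue_rr adj2.
Qed.
End Glue.

Lemma copy_nonisolated (G H : sgraph) (A : {set G}) (h : H -> G) :
  no_isolated H -> copy A h -> nonisolated A.
Proof.
move=> niH [_ hA surj hadj] _ /surj[x ->]; have [y xy] := niH x.
by exists (h y); rewrite ?hadj.
Qed.

Section AssembledGlue.
Variables (n : nat) (bs : seq (seq nat * family)) (G : sgraph).
Hypotheses (okB : blocks_ok n bs).
Let m := size bs.
Let block k := nth ([::], tri) bs k.
Let F k := (block k).2.
Let s k i := nth 0 (block k).1 i.

(** The gluing vertex has the code 0 in every block and in the whole, and two blocks have no other
    code in common. *)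
Definition glued_codes := all (fun k => (0 < fam_size (F k)) && (s k 0 == 0) &&
  all (fun l => (k == l) || all (fun i => all (fun j => (s k i == s l j) ==> ((i == 0) && (j == 0)))
    (iota 0 (fam_size (F l)))) (iota 0 (fam_size (F k)))) (iota 0 m)) (iota 0 m).

Hypothesis glueB : glued_codes.

Definition rooted_pieces (As : nat -> {set G}) (p : G) :=
  [/\ forall k, k < m -> exists2 f, piece (plain (F k)) (As k) f & f 0 = p,
      forall x y, adj x y -> exists k, [/\ k < m, x \in As k & y \in As k]
    & forall k l x, k < m -> l < m -> k != l -> x \in As k -> x \in As l -> x = p].

Let root k : k < m -> 0 < fam_size (F k) /\ s k 0 = 0.
Proof.
move=> Hk; have /allP/(_ k) := glueB; rewrite mem_iota => /(_ Hk).
by case/andP=> /andP[-> /eqP].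
Qed.

Let shared k l i j : k < m -> l < m -> k != l -> i < fam_size (F k) -> j < fam_size (F l) ->
  s k i = s l j -> i = 0 /\ j = 0.
Proof.
move=> Hk Hl kl Hi Hj E; have /allP/(_ k) := glueB; rewrite mem_iota => /(_ Hk).
case/andP=> _ /allP/(_ l); rewrite mem_iota (negbTE kl) => /(_ Hl)/allP/(_ i).
rewrite mem_iota => /(_ Hi)/allP/(_ j); rewrite mem_iota => /(_ Hj).
by rewrite E eqxx => /andP[/eqP-> /eqP->].
Qed.

Lemma assemble_rooted (x0 : G) As p : rooted_pieces As p ->
  exists f, piece (assemble n bs) [set: G] f.
Proof.
case=> pc ed meet.
have [fs pfs] : exists fs : nat -> nat -> G, forall k, k < m ->
    piece (plain (F k)) (As k) (fs k) /\ fs k 0 = p.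
  elim: m pc => [|q IH] pc; first by exists (fun _ _ => x0).
  have [|fs pfs] := IH; first by move=> k /ltnW; exact: pc.
  have [f pf f0] := pc q (leqnn _); exists (fun k => if k == q then f else fs k) => k.
  by rewrite ltnS leq_eqVlt; case: eqP => [->//|_ /= /pfs].
apply: (assemble_piece okB (As := As) (fs := fs)); split=> //.
- by move=> k /pfs[].
- move=> k l i j Hk Hl Hi Hj E; have [kl|kl] := eqVneq k l; last first.
    have [-> ->] := shared Hk Hl kl Hi Hj E.
    by have [_ ->] := pfs k Hk; have [_ ->] := pfs l Hl.
  subst l; congr fs; have [sz u _ _] := block_ok okB Hk.
  by apply/eqP; rewrite -(nth_uniq 0 _ _ u) ?sz //; apply/eqP.
- move=> k l x Hk Hl kl xk xl; have [H1 H2] := root Hk; have [H3 H4] := root Hl.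
  have E0 : s k 0 = s l 0 by rewrite H2 H4.
  exists 0, 0; split=> //.
  by have [_ ->] := pfs k Hk; exact: (meet k l).
Qed.

Lemma rooted_assemble f : no_isolated G -> 0 < m ->
  all (fun b => connected_family b.2) bs -> piece (assemble n bs) [set: G] f ->
  exists As p, rooted_pieces As p /\ forall k, k < m -> nonisolated (As k).
Proof.
move=> niG m0 connF pf; have [As [fs dec]] := piece_assemble okB (no_isolated_setT niG) pf.
have fs0 k : k < m -> fs k 0 = fs 0 0.
  move=> Hk; have [H1 H2] := root Hk; have [H3 H4] := root m0.
  have E0 : s k 0 = s 0 0 by rewrite H2 H4.
  exact: (dec_compat dec).
exists As, (fs 0 0); split; last first.
  by move=> k; exact: (decomposition_nonisolated niG connF dec).
split; last 1 first.
- move=> k l x Hk Hl kl xk xl; have [i [j [Hi Hj E ->]]] := dec_meet dec Hk Hl kl xk xl.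
  by have [-> _] := shared Hk Hl kl Hi Hj E; exact: fs0.
- by move=> k Hk; exists (fs k); [exact: (dec_piece dec)|exact: fs0].
- exact: (dec_edge dec).
Qed.
End AssembledGlue.


(** * The graphs of the theorem as templates *)

Definition disjoint_codes (bs : seq (seq nat * family)) :=
  let m := size bs in let block k := nth ([::], tri) bs k in
  all (fun k => all (fun l => (k == l) || ~~ has (mem (block k).1) (block l).1) (iota 0 m))
    (iota 0 m).

Lemma disjoint_codesP n bs : blocks_ok n bs -> disjoint_codes bs ->
  let block k := nth ([::], tri) bs k in
  forall k l i j, k < size bs -> l < size bs -> i < fam_size (block k).2 ->
    j < fam_size (block l).2 -> nth 0 (block k).1 i = nth 0 (block l).1 j -> k = l.
Proof.
move=> okB dj block k l i j Hk Hl Hi Hj E.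
have [szk _ _ _] := block_ok okB Hk; have [szl _ _ _] := block_ok okB Hl.
have := allP dj k; rewrite mem_iota => /(_ Hk)/allP/(_ l); rewrite mem_iota => /(_ Hl).
case/orP=> [/eqP//|/hasPn/(_ (nth 0 (block l).1 j))].
by rewrite mem_nth ?szl // => /(_ isT)/negP[]; rewrite -E /= mem_nth ?szk.
Qed.

Definition B_families := [:: B1; B2; B3; B4; B5; B6; B7; B8; B9].

Definition big_families := [:: bow; G1; G2; G3].

Definition two_blocks b F :=
  let n := fam_size (small_family b) in
  [:: (iota 0 n, small_family b); (iota n 5, F)].

(** Convertible to [K3_plus F] or [star_plus F], according to [b]; this links it with the templates
    in [starts]. *)
Definition two_template b F := assemble (fam_size (small_family b) + 5) (two_blocks b F).

Lemma B_template_ok i : i < 9 -> template_ok (plain (nth B1 B_families i)).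
Proof.
case: i => [|[|[|[|[|[|[|[|[|i]]]]]]]]]; last by [].
all: by move=> _; vm_cast_no_check (erefl true).
Qed.

Lemma E1_template_ok : template_ok E1_template.
Proof. by vm_cast_no_check (erefl true). Qed.

Lemma E2_template_ok : template_ok E2_template.
Proof. by vm_cast_no_check (erefl true). Qed.

Lemma two_template_ok b F : List.In F big_families -> template_ok (two_template b F).
Proof. by case: b => /= -[<-|[<-|[<-|[<-|//]]]]; vm_cast_no_check (erefl true). Qed.

Lemma disjoint3_template_ok a b c :
  template_ok (disjoint3 (small_family a) (small_family b) (small_family c)).
Proof. by case: a; case: b; case: c; vm_cast_no_check (erefl true). Qed.

Lemma petals_template_ok a b c :
  template_ok (petals (petal_family a) (petal_family b) (petal_family c)).
Proof. by case: a; case: b; case: c; vm_cast_no_check (erefl true). Qed.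

Section Classification.
Variable G : sgraph.
Hypothesis niG : no_isolated G.
Variable x0 : G.

Let niT : nonisolated [set: G] := no_isolated_setT niG.

Lemma comp_set_nonisolated (x : G) : nonisolated (comp_set x).
Proof.
move=> y; rewrite inE => xy; have [z yz] := niG y; exists z => //.
by rewrite inE; apply: connect_trans xy _; exact: connect1.
Qed.

Lemma comp_set_eq (x y : G) : connect adj x y -> comp_set x = comp_set y.
Proof.
move=> xy; apply/setP => z; rewrite !inE; apply/idP/idP; apply: connect_trans => //.
by rewrite connC.
Qed.

Lemma K3_or_star_component (x : G) : K3_or_star (component x) <->
  exists b f, piece (plain (small_family b)) (comp_set x) f.
Proof.
have H := K3_or_star_induced x0 (comp_set_nonisolated (x := x)).
split=> [/H[[f pf]|[f pf]]|[[] [f pf]]]; first by exists true, f.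
- by exists false, f.
- by apply/H; left; exists f.
- by apply/H; right; exists f.
Qed.

Lemma bowtie_or_G123_component (x : G) : bowtie_or_G123 (component x) <->
  exists F f, List.In F big_families /\ piece (plain F) (comp_set x) f.
Proof.
have niA := comp_set_nonisolated (x := x).
have H0 := bowtie_induced x0 niA.
have H1 := @in_family_induced _ _ G1 x0 isT niA.
have H2 := @in_family_induced _ _ G2 x0 isT niA.
have H3 := @in_family_induced _ _ G3 x0 isT niA.
split.
  by case=> [/H0[f pf]|[/H1[f pf]|/H2[f pf]|/H3[f pf]]]; eexists; exists f; split; try exact: pf; rewrite /=; tauto.
case=> F [f [/= [<-|[<-|[<-|[<-|//]]]] pf]].
- by left; apply/H0; exists f.
- by right; constructor 1; apply/H1; exists f.
- by right; constructor 2; apply/H2; exists f.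
- by right; constructor 3; apply/H3; exists f.
Qed.

Lemma two_blocks_ok b F : List.In F big_families ->
  [/\ blocks_ok (fam_size (small_family b) + 5) (two_blocks b F),
      disjoint_codes (two_blocks b F)
    & all (fun b => connected_family b.2) (two_blocks b F)].
Proof. by case: b => /= [] [<-|[<-|[<-|[<-|//]]]]; split; vm_compute. Qed.

Definition two_components := disconnected G /\ num_components G = 2 /\
  exists x y : G, [/\ ~~ connect adj x y, K3_or_star (component x) & bowtie_or_G123 (component y)].

Lemma two_componentsP : two_components <->
  exists b F f, List.In F big_families /\ piece (two_template b F) [set: G] f.
Proof.
split=> [[_ [n2 [x [y [xy /K3_or_star_component[b [f pf]]
    /bowtie_or_G123_component[F [g [inF pg]]]]]]]]|[b [F [f [inF pf]]]]].
  have [ok dj cn] := two_blocks_ok b inF.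
  have [|h ph] := (components_assemble x0 ok niG cn (disjoint_codesP ok dj)).2; last by exists b, F, h.
  exists [:: x; y]; split=> //; last by case=> [|[|k]] // _; [exists f|exists g].
  have [xs [u cov sep] sz] := ex_transversal G.
  have [a xa ax] := cov x; have [c xc cy] := cov y.
  have ac : a != c by apply: contraNneq xy => ac; rewrite connC in ax; apply: connect_trans ax _; rewrite ac.
  (* With two components in all, the representatives of the components of [x] and [y] exhaust the
     transversal. *)
  have xsE : {subset xs <= [:: a; c]}.
    have [|||_ E] := @uniq_min_size _ [:: a; c] xs.
    + by rewrite /= inE ac.
    + by move=> z; rewrite !inE => /orP[]/eqP->.
    + by rewrite sz n2.
    by move=> z; rewrite -E.
  split=> [|w|u1 u2].
  - by rewrite /= inE andbT; apply: contraNneq xy => ->; exact: connect0.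
  - have [z /xsE] := cov w; rewrite !inE => /orP[]/eqP-> zw.
      by exists x; [rewrite !inE eqxx|apply: connect_trans zw; rewrite connC].
    by exists y; [rewrite !inE eqxx orbT|apply: connect_trans zw; rewrite connC].
  - rewrite !inE => /orP[]/eqP-> /orP[]/eqP-> //; first by move=> c'; rewrite c' in xy.
    by rewrite connC => c'; rewrite c' in xy.
have [ok dj cn] := two_blocks_ok b inF.
have [|xs [tr sz pc]] := (components_assemble x0 ok niG cn (disjoint_codesP ok dj)).1; first by exists f.
case: xs tr sz pc => [|x [|y []]] // tr _ pc.
have xy : ~~ connect adj x y.
  case: tr => /= /andP[xy _] _ sep; apply: contra xy => c; rewrite inE.
  by apply/eqP/sep; rewrite // !inE eqxx ?orbT.
split; first by exists x, y.
split; first by rewrite (num_components_transversal tr).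
exists x, y; split=> //.
- by apply/K3_or_star_component; exists b; exact: (pc 0).
- by apply/bowtie_or_G123_component; have [g pg] := pc 1 isT; exists F, g.
Qed.

Definition three_blocks a b c :=
  let n1 := fam_size (small_family a) in let n2 := fam_size (small_family b) in
  let n3 := fam_size (small_family c) in
  [:: (iota 0 n1, small_family a); (iota n1 n2, small_family b); (iota (n1 + n2) n3, small_family c)].

Lemma three_blocks_ok a b c :
  let bs := three_blocks a b c in
  [/\ blocks_ok (fam_size (small_family a) + fam_size (small_family b) + fam_size (small_family c)) bs,
      disjoint_codes bs & all (fun b => connected_family b.2) bs].
Proof. by case: a; case: b; case: c; split; vm_compute. Qed.

Definition three_components := disconnected G /\ num_components G = 3 /\
  forall x : G, K3_or_star (component x).

Lemma three_componentsP : three_components <->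
  exists a b c f, piece (disjoint3 (small_family a) (small_family b) (small_family c)) [set: G] f.
Proof.
split=> [[_ [n3 K]]|[a [b [c [f pf]]]]].
  have [xs tr sz] := ex_transversal G; rewrite n3 in sz.
  case: xs tr sz => [|x [|y [|z []]]] // tr _.
  have /K3_or_star_component[a pa] := K x; have /K3_or_star_component[b pb] := K y.
  have /K3_or_star_component[c pc] := K z; exists a, b, c.
  have [ok dj cn] := three_blocks_ok a b c.
  apply: (components_assemble x0 ok niG cn (disjoint_codesP ok dj)).2.
  by exists [:: x; y; z]; split=> //; case=> [|[|[|k]]].
have [ok dj cn] := three_blocks_ok a b c.
have [|xs [tr sz pc]] := (components_assemble x0 ok niG cn (disjoint_codesP ok dj)).1; first by exists f.
split.
  case: xs tr sz pc => [|x [|y [|z []]]] // tr _ _; exists x, y.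
  case: tr => /= /andP[xy _] _ sep; apply: contra xy => xy; rewrite inE.
  by apply/orP; left; apply/eqP/sep; rewrite // !inE eqxx ?orbT.
split; first by rewrite (num_components_transversal tr).
move=> w; apply/K3_or_star_component; case: tr => u cov _; have [x xxs xw] := cov w.
rewrite -(comp_set_eq xw) -(nth_index x0 xxs).
have : index x xs < 3 by rewrite -[3]sz index_mem.
move: (index x xs) pc => [|[|[|k]]] // pc _.
- by exists a; exact: (pc 0).
- by exists b; exact: (pc 1).
- by exists c; exact: (pc 2).
Qed.

Lemma complete_no_isolated n : no_isolated (complete_graph n.+2).
Proof.
move=> y; exists (if y == ord0 then ord_max else ord0); rewrite complete_adj.
by case: (eqVneq y ord0) => [->|].
Qed.

Lemma petal_no_isolated (H : sgraph) (x : H) : petal x -> no_isolated H.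
Proof.
case=> [_|n _ n2 _]; first exact: complete_no_isolated.
move=> y.
case: n n2 y => // n _ y; have [->|y0] := eqVneq y ord0.
  by exists ord_max; apply/andP; split=> //.
by exists ord0; apply/andP; split=> //; rewrite eqxx orbT.
Qed.

Definition petal_blocks a b c := [:: ([:: 0; 1; 2], petal_family a);
  ([:: 0; 3; 4], petal_family b); ([:: 0; 5; 6], petal_family c)].

Lemma petal_blocks_ok a b c : let bs := petal_blocks a b c in
  [/\ blocks_ok 7 bs, glued_codes bs & all (fun b => connected_family b.2) bs].
Proof. by case: a; case: b; case: c; split; vm_compute. Qed.

Lemma petal_at_family A (p : G) : nonisolated A -> petal_at A p <->
  exists b, exists2 f, piece (plain (petal_family b)) A f & f 0 = p.
Proof.
move=> niA; split=> [/(petal_atP _ niA)[F [->|->] pf]|[[] pf]].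
- by exists true.
- by exists false.
- by apply/(petal_atP _ niA); exists tri; [left|].
- by apply/(petal_atP _ niA); exists ray; [right|].
Qed.

(** A copy of the iterated gluing is cut twice by [copy_glue] into three petals at a common vertex
    [p]. In the other direction the first two parts of a rooted decomposition are glued, and then
    the third. *)
Lemma in_B_P_petals : in_B_P G <->
  exists a b c f, piece (petals (petal_family a) (petal_family b) (petal_family c)) [set: G] f.
Proof.
split=> [[H1 [H2 [H3 [x1 [x2 [x3 [p1 p2 p3 /iso_copyP[h hG]]]]]]]]|[a [b [c [f pf]]]]].
  have [A12 [A3 [h12 [h3 [c12 c3 r12 r3 [cov12 int12 ed12]]]]]] := copy_glue hG.
  have [A1 [A2 [h1 [h2 [c1 c2 r1 r2 [cov int ed]]]]]] := copy_glue c12.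
  set p := h _ in r12 r3 int12 ed12; rewrite r12 in r1 r2 int ed.
  have [a pa] : exists b, exists2 f, piece (plain (petal_family b)) A1 f & f 0 = p.
    apply/(petal_at_family _ (copy_nonisolated (petal_no_isolated p1) c1)).
    by exists H1, x1, h1.
  have [b pb] : exists b, exists2 f, piece (plain (petal_family b)) A2 f & f 0 = p.
    apply/(petal_at_family _ (copy_nonisolated (petal_no_isolated p2) c2)).
    by exists H2, x2, h2.
  have [c pc] : exists b, exists2 f, piece (plain (petal_family b)) A3 f & f 0 = p.
    apply/(petal_at_family _ (copy_nonisolated (petal_no_isolated p3) c3)).
    by exists H3, x3, h3.
  exists a, b, c; have [ok gl _] := petal_blocks_ok a b c.
  apply: (assemble_rooted ok gl x0 (As := nth A1 [:: A1; A2; A3]) (p := p)); split.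
  - by case=> [|[|[|k]]].
  - have pA1 : p \in A1 by have := set11 p; rewrite -int inE => /andP[].
    have pA2 : p \in A2 by have := set11 p; rewrite -int inE => /andP[].
    have pA3 : p \in A3 by have := set11 p; rewrite -int12 inE => /andP[].
    have pA k : p \in nth A1 [:: A1; A2; A3] k.
      by case: k => [|[|[|k]]] //=; rewrite nth_nil.
    have s12 : {subset A1 <= A12} by move=> z; rewrite cov inE => ->.
    have s22 : {subset A2 <= A12} by move=> z; rewrite cov inE orbC => ->.
    have cross k l u v : k < l -> l < 3 -> u \in nth A1 [:: A1; A2; A3] k ->
        v \in nth A1 [:: A1; A2; A3] l -> adj u v -> u = p \/ v = p.
      case: l k => [|[|[|l]]] [|[|k]] //= _ _ uA vA.
      + exact: ed.
      + by apply: ed12 => //; exact: s12.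
      + by apply: ed12 => //; exact: s22.
    have cover u : exists2 k, k < 3 & u \in nth A1 [:: A1; A2; A3] k.
      have := in_setT u; rewrite cov12 cov !inE => /orP[/orP[]|] uA;
      by [exists 0|exists 1|exists 2].
    move=> u v uv; have [k Hk uk] := cover u; have [l Hl vl] := cover v.
    case: (ltngtP k l) => [kl|lk|kl]; last by exists k; split=> //; rewrite kl.
      have [E|E] := cross _ _ _ _ kl Hl uk vl uv; first by exists l; rewrite E pA.
      by exists k; rewrite E pA.
    have [|E|E] := cross _ _ _ _ lk Hk vl uk; first by rewrite adjC.
      by exists k; rewrite E pA.
    by exists l; rewrite E pA.
  - have m12 z : z \in A1 -> z \in A2 -> z = p.
      by move=> z1 z2; apply/set1P; rewrite -int inE z1 z2.
    have m3 z : z \in A12 -> z \in A3 -> z = p.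
      by move=> z1 z2; apply/set1P; rewrite -int12 inE z1 z2.
    have s12 : {subset A1 <= A12} by move=> z; rewrite cov inE => ->.
    have s22 : {subset A2 <= A12} by move=> z; rewrite cov inE orbC => ->.
    by case=> [|[|[|k]]] [|[|[|l]]] z //= _ _ _; auto.
have [ok gl cn] := petal_blocks_ok a b c.
have [As [p [[pc ed meet] niA]]] := rooted_assemble ok gl niG isT cn pf.
have cover u : exists2 k, k < 3 & u \in As k.
  by have [v uv] := niG u; have [k [Hk uk _]] := ed _ _ uv; exists k.
have pA k : k < 3 -> p \in As k.
  move=> Hk; have [g pg <-] := pc k Hk; apply: (piece_mem pg) => /=.
  by case: k Hk {pg} => [|[|[|k]]] // _; case: (a) (b) (c) => [] [] [].
have cross k l u v : k < 3 -> l < 3 -> k != l -> u \in As k -> v \in As l -> adj u v -> u = p \/ v = p.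
  move=> Hk Hl kl uk vl uv; have [j [Hj uj vj]] := ed _ _ uv.
  have [E|kj] := eqVneq k j; last by left; exact: (meet k j).
  by right; apply: (meet l k) => //; rewrite 1?eq_sym // E.
have [H1 [x1 [h1 [p1 c1 r1]]]] : petal_at (As 0) p.
  by apply/(petal_at_family _ (niA 0 isT)); exists a; exact: (pc 0).
have [H2 [x2 [h2 [p2 c2 r2]]]] : petal_at (As 1) p.
  by apply/(petal_at_family _ (niA 1 isT)); exists b; exact: (pc 1).
have [H3 [x3 [h3 [p3 c3 r3]]]] : petal_at (As 2) p.
  by apply/(petal_at_family _ (niA 2 isT)); exists c; exact: (pc 2).
exists H1, H2, H3, x1, x2, x3; split=> //; apply/iso_copyP.
have [h12 [c12 r12]] : exists h : glue x1 x2 -> G, copy (As 0 :|: As 1) h /\ h (inl x1) = p.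
  apply: (glue_copy c1 c2 r1 r2); split=> // [|u v]; last exact: (cross 0 1).
  apply/setP => z; rewrite !inE; apply/andP/eqP => [[]|->]; last by rewrite !pA.
  exact: (meet 0 1).
have [h [cG _]] : exists h : glue (inl x1 : glue x1 x2) x3 -> G, copy [set: G] h /\ h (inl (inl x1)) = p.
  apply: (glue_copy c12 c3 r12 r3); split=> [||u v].
  - apply/setP => z; rewrite !inE; have [[|[|[|k]]] // _ ->] := cover z; by rewrite ?orbT.
  - apply/setP => z; rewrite !inE; apply/andP/eqP => [[/orP[] zk zl]|->]; last by rewrite !pA.
      exact: (meet 0 2).
    exact: (meet 1 2).
  - by rewrite inE => /orP[] uk; [exact: (cross 0 2)|exact: (cross 1 2)].
by exists h.
Qed.

(** The argument common to [E1] and [E2]: two four-vertex blocks with code 0 in common, each block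
    being the template form of a fixed graph with a marked vertex. *)
Lemma two_glued_copy (H1 H2 : sgraph) (x1 : H1) (x2 : H2) F1 F2
    (bs := [:: (iota 0 4, F1); ([:: 0; 4; 5; 6], F2)]) :
  blocks_ok 7 bs -> glued_codes bs -> all (fun b => connected_family b.2) bs ->
  no_isolated H1 -> no_isolated H2 ->
  (forall A (h : H1 -> G), copy A h -> exists2 f, piece (plain F1) A f & f 0 = h x1) ->
  (forall A (h : H2 -> G), copy A h -> exists2 f, piece (plain F2) A f & f 0 = h x2) ->
  (forall A f, nonisolated A -> piece (plain F1) A f -> exists h : H1 -> G, copy A h /\ h x1 = f 0) ->
  (forall A f, nonisolated A -> piece (plain F2) A f -> exists h : H2 -> G, copy A h /\ h x2 = f 0) ->
  isomorphic G (glue x1 x2) <-> exists f, piece (assemble 7 bs) [set: G] f.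
Proof.
move=> ok gl cn ni1 ni2 to1 to2 of1 of2; split=> [/iso_copyP[h hG]|[f pf]].
  have [A1 [A2 [h1 [h2 [c1 c2 r1 r2 [cov int ed]]]]]] := copy_glue hG.
  set p := h _ in r1 r2 int ed.
  apply: (assemble_rooted ok gl x0 (As := nth A1 [:: A1; A2]) (p := p)).
  have pA1 : p \in A1 by have := set11 p; rewrite -int inE => /andP[].
  have pA2 : p \in A2 by have := set11 p; rewrite -int inE => /andP[].
  have m12 z : z \in A1 -> z \in A2 -> z = p.
    by move=> z1 z2; apply/set1P; rewrite -int inE z1 z2.
  have cover u : (u \in A1) || (u \in A2) by have := in_setT u; rewrite cov inE.
  split.
  - case=> [|[|k]] // _ /=.
      by have [f pf E] := to1 _ _ c1; exists f; rewrite ?E.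
    by have [f pf E] := to2 _ _ c2; exists f; rewrite ?E.
  - move=> u v uv; case/orP: (cover u) (cover v) => uA /orP[] vA.
    + by exists 0.
    + by have [E|E] := ed _ _ uA vA uv; [exists 1|exists 0]; rewrite /= E ?pA1 ?pA2 in uA vA *.
    + rewrite adjC in uv; have [E|E] := ed _ _ vA uA uv; [exists 1|exists 0];
      by rewrite /= E ?pA1 ?pA2 in uA vA *.
    + by exists 1.
  - by case=> [|[|k]] [|[|l]] z //= _ _ _; auto.
have [As [p [[pc ed meet] niA]]] := rooted_assemble ok gl niG isT cn pf.
have [f1 pf1 r1] := pc 0 isT; have [f2 pf2 r2] := pc 1 isT.
have [h1 [c1 q1]] := of1 _ _ (niA 0 isT) pf1; have [h2 [c2 q2]] := of2 _ _ (niA 1 isT) pf2.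
rewrite r1 in q1; rewrite r2 in q2.
have p1 : p \in As 0 by rewrite -q1; case: c1.
have p2 : p \in As 1 by rewrite -q2; case: c2.
have gA : glued [set: G] (As 0) (As 1) p.
  split.
  - apply/setP => z; rewrite !inE; have [v uv] := niG z.
    by have [[|[|k]] [// _ -> _]] := ed _ _ uv; rewrite ?orbT.
  - apply/setP => z; rewrite !inE; apply/andP/eqP => [[]|->] //; exact: (meet 0 1).
  - move=> u v u1 v2 uv; have [[|[|k]] [// _ uk vk]] := ed _ _ uv.
      by right; exact: (meet 0 1).
    by left; exact: (meet 0 1).
by apply/iso_copyP; have [h [hG _]] := glue_copy c1 c2 q1 q2 gA; exists h.
Qed.

Lemma complete4_codes (i j : 'I_4) : @adj (complete_graph 4) i j = pmem (required kfour) i j.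
Proof.
rewrite complete_adj.
by case: i j => [[|[|[|[|i]]]] Hi] [[|[|[|[|j]]]] Hj].
Qed.

Lemma cycle4_codes (i j : 'I_4) : @adj (cycle_graph 4) i j = pmem (required cfour) i j.
Proof. by case: i j => [[|[|[|[|i]]]] Hi] [[|[|[|[|j]]]] Hj]. Qed.

Lemma cycle_no_isolated n : no_isolated (cycle_graph n.+2).
Proof.
move=> y; exists (ordS y); apply/andP; split; last by rewrite eqxx.
rewrite -val_eqE /=; apply/eqP => E; have := ltn_ord y.
rewrite leq_eqVlt => /orP[/eqP yn|yn]; first by move: E; rewrite yn modnn => y0; rewrite y0 in yn.
by move: E; rewrite modn_small // => /esym/eqP; rewrite -[X in _ == X]addn0 -addn1 eqn_add2l.
Qed.

Lemma four_copy (H : sgraph) (c : 'I_4 -> H) es :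
  bijective c -> (forall i j, adj (c i) (c j) = pmem es i j) ->
  all (fun q => (q.1 < 4) && (q.2 < 4)) es ->
  (forall A (h : H -> G), copy A h ->
    exists2 f, piece (plain (Family 4 es [::] [::])) A f & f 0 = h (c ord0)) /\
  (forall A f, nonisolated A -> piece (plain (Family 4 es [::] [::])) A f ->
    exists h : H -> G, copy A h /\ h (c ord0) = f 0).
Proof.
move=> bc ac wf; split=> [A h hA|A f niA pf].
  eexists; first exact: (copy_fixed bc ac wf x0 hA).
  by rewrite /= (_ : insub 0 = Some (ord0 : 'I_4)) //; apply: insubT.
by have [h [hA hE]] := fixed_copy bc ac niA pf; exists h; rewrite hE.
Qed.

Let id4 : bijective (fun i : 'I_4 => i). Proof. by exists id. Qed.

Lemma E1_assemble : isomorphic G E1 <-> exists f, piece E1_template [set: G] f.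
Proof.
have [to_ of_] := @four_copy (complete_graph 4) _ _ id4 complete4_codes isT.
by apply: two_glued_copy => //; try exact: complete_no_isolated; vm_compute.
Qed.

Lemma E2_assemble : isomorphic G E2 <-> exists f, piece E2_template [set: G] f.
Proof.
have [to_ of_] := @four_copy (complete_graph 4) _ _ id4 complete4_codes isT.
have [to' of'] := @four_copy (cycle_graph 4) _ _ id4 cycle4_codes isT.
by apply: two_glued_copy => //; try exact: complete_no_isolated; try exact: cycle_no_isolated; vm_compute.
Qed.

Lemma in_some_B_piece : in_some_B G <->
  exists2 i, i < 9 & exists f, piece (plain (nth B1 B_families i)) [set: G] f.
Proof.
split=> [[[|i] // Hi /= FB]|[i Hi pf]].
  exists i => //; apply/(in_familyP x0 _ niT) => //.
  by case: i Hi {FB} => [|[|[|[|[|[|[|[|[|i]]]]]]]]].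
exists i.+1 => //=; apply/(in_familyP x0 _ niT) => //.
by case: i Hi {pf} => [|[|[|[|[|[|[|[|[|i]]]]]]]]].
Qed.
End Classification.


(** * The classification *)

Lemma contains_C7 (G : sgraph) : contains C7 G -> contains_subgraph G (cycle_graph 7).
Proof.
case/existsP=> f /andP[/injectiveP inj /forallP es]; exists f => // x y /andP[_ xy].
have E (i j : 'I_7) : j == ordS i -> adj (f i) (f j).
  move=> ij; have /forallP/(_ j)/implyP := es i; apply.
  by rewrite (eqP ij); case: i {ij j es} => [[|[|[|[|[|[|[|i]]]]]]] Hi].
by case/orP: xy => /E //; rewrite adjC.
Qed.

Theorem theorem4p1 (G : sgraph) (G_nonempty : 0 < #|G|)
    (G_no_isolated : no_isolated G) :
  buchsbaum2 (matching_complex G) <->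
  [\/ [\/ in_B_C7 G, in_B_P G | in_some_B G],
      isomorphic G E1 \/ isomorphic G E2
    | disconnected G /\
      ((num_components G = 3 /\ forall x : G, K3_or_star (component x)) \/
       (num_components G = 2 /\
        exists x y : G, [/\ ~~ connect adj x y,
                            K3_or_star (component x)
                          & bowtie_or_G123 (component y)]))].
Proof.
have /card_gt0P[x0 _] := G_nonempty.
have PE1 := E1_assemble G_no_isolated x0; have PE2 := E2_assemble G_no_isolated x0.
have PP := in_B_P_petals G_no_isolated x0; have PB := in_some_B_piece G_no_isolated x0.
have P2 := two_componentsP G_no_isolated x0; have P3 := three_componentsP G_no_isolated x0.
split=> [bG|].
  have [gG c3] := buchsbaum2_good bG.
  case: (boolP (contains C7 G)) => [/contains_C7 c7|nc7]; first by constructor 1; constructor 1.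
  have [T inT [f pf]] := good_templates gG c3 nc7.
  match goal with |- ?g => set goal := g end.
  have two b F g : List.In F big_families -> piece (two_template b F) [set: G] g -> goal.
    move=> inF pg; constructor 3; have [|d H] := P2.2; first by exists b, F, g.
    by split; last right.
  have three a b c g :
      piece (disjoint3 (small_family a) (small_family b) (small_family c)) [set: G] g -> goal.
    move=> pg; constructor 3; have [|d H] := P3.2; first by exists a, b, c, g.
    by split; last left.
  have petal' a b c g :
      piece (petals (petal_family a) (petal_family b) (petal_family c)) [set: G] g -> goal.
    by move=> pg; constructor 1; constructor 2; apply/PP; exists a, b, c, g.
  have B i g : i < 9 ->
      piece (plain (nth B1 B_families i)) [set: G] g -> goal.
    by move=> Hi pg; constructor 1; constructor 3; apply/PB; exists i => //; exists g.
  (* The templates come in the order of [starts]; each is sent to its clause of the theorem. *)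
  case: inT => [E|inT]; first by rewrite -E in pf; apply: (two true G3 f _ pf); rewrite /=; auto.
  case: inT => [E|inT]; first by rewrite -E in pf; apply: (two false G3 f _ pf); rewrite /=; auto.
  case: inT => [E|inT]; first by rewrite -E in pf; apply: (two true bow f _ pf); rewrite /=; auto.
  case: inT => [E|inT]; first by rewrite -E in pf; apply: (B 6 f).
  case: inT => [E|inT]; first by rewrite -E in pf; apply: (two true G2 f _ pf); rewrite /=; auto.
  case: inT => [E|inT]; first by rewrite -E in pf; exact: (three true true true f).
  case: inT => [E|inT]; first by rewrite -E in pf; exact: (three true true false f).
  case: inT => [E|inT]; first by rewrite -E in pf; apply: (B 7 f).
  case: inT => [E|inT]; first by rewrite -E in pf; constructor 2; left; apply/PE1; exists f.
  case: inT => [E|inT]; first by rewrite -E in pf; constructor 2; right; apply/PE2; exists f.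
  case: inT => [E|inT]; first by rewrite -E in pf; apply: (B 8 f).
  case: inT => [E|inT]; first by rewrite -E in pf; apply: (two true G1 f _ pf); rewrite /=; auto.
  case: inT => [E|inT]; first by rewrite -E in pf; exact: (petal' true true true f).
  case: inT => [E|inT]; first by rewrite -E in pf; exact: (petal' true true false f).
  case: inT => [E|inT]; first by rewrite -E in pf; apply: (two false bow f _ pf); rewrite /=; auto.
  case: inT => [E|inT]; first by rewrite -E in pf; exact: (petal' true false false f).
  case: inT => [E|inT]; first by rewrite -E in pf; apply: (two false G2 f _ pf); rewrite /=; auto.
  case: inT => [E|inT]; first by rewrite -E in pf; exact: (three true false false f).
  case: inT => [E|inT]; first by rewrite -E in pf; apply: (B 2 f).
  case: inT => [E|inT]; first by rewrite -E in pf; apply: (B 4 f).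
  case: inT => [E|inT]; first by rewrite -E in pf; apply: (B 1 f).
  case: inT => [E|inT]; first by rewrite -E in pf; apply: (B 3 f).
  case: inT => [E|inT]; first by rewrite -E in pf; apply: (B 5 f).
  case: inT => [E|inT]; first by rewrite -E in pf; apply: (B 1 f).
  case: inT => [E|inT]; first by rewrite -E in pf; apply: (B 5 f).
  case: inT => [E|inT]; first by rewrite -E in pf; apply: (B 0 f).
  case: inT => [E|inT]; first by rewrite -E in pf; apply: (two false G1 f _ pf); rewrite /=; auto.
  case: inT => [E|inT]; first by rewrite -E in pf; apply: (B 0 f).
  by [].
(* Conversely, the graphs with a 7-cycle are Buchsbaum by definition of their family, and every
   other clause gives a template that passed its check. *)
have ok T (f : nat -> G) (okT : template_ok T) (pf : piece T [set: G] f) := piece_buchsbaum2 pf okT.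
case=> [[[_ _ //]|/PP[a [b [c [f pf]]]]|/PB[i Hi [f pf]]]|[/PE1[f pf]|/PE2[f pf]]|[d [K|K]]].
- exact: ok (petals_template_ok a b c) pf.
- exact: ok (B_template_ok Hi) pf.
- exact: ok E1_template_ok pf.
- exact: ok E2_template_ok pf.
- have [a [b [c [f pf]]]] := P3.1 (conj d K); exact: ok (disjoint3_template_ok a b c) pf.
- have [b [F [f [inF pf]]]] := P2.1 (conj d K); exact: ok (two_template_ok b inF) pf.
Qed.
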